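(* For $y>0$ and $s\in\mathbb{C}$ with $\mathrm{Re}(s)>1$ let $$E_{1/2}(y,s)=\int_0^\infty\Bigl(\sqrt{\theta(y^2t^2)\,\theta(y^{-2}t^2)}-1\Bigr)t^s\,\frac{dt}{t},$$ which is well defined for such $y,s$. For any fixed $y>0$, $E_{1/2}(y,s)$ can be continued meromorphically to the whole $s$-plane. Moreover, the identity $$E_{1/2}(y,s)=Z_{1/2}(s)\,y^s+Z_{1/2}(1-s)\,y^{1-s}+\sqrt y\sum_{n=1}^\infty n^{\frac s4-\frac18}\Bigl(\sum_{d\mid n}c_{1/2}(d)\,c_{1/2}(n/d)\,d^{-\frac s2+\frac14}\Bigr)K_{\frac s2-\frac14}\bigl(2\pi\sqrt n\,y^2\bigr)$$ holds for any $y>0$ and $s\in\mathbb{C}$ (as an identity of meromorphic functions of $s$).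
   Context: The theta series is $\theta(x)=\sum_{n=-\infty}^{\infty}e^{-\pi n^2x}$ for $x>0$. The numbers $c_{1/2}(m)$ $(m=1,2,\dots)$ are defined by $$\theta(x)^{1/2}=\Bigl(1+2\sum_{n=1}^\infty e^{-\pi n^2x}\Bigr)^{1/2}=1+\sum_{m=1}^\infty c_{1/2}(m)e^{-\pi mx},$$ i.e. $c_{1/2}(m)$ is the coefficient of $X^m$ in the formal power series $\bigl(1+2\sum_{n\ge1}X^{n^2}\bigr)^{1/2}$. Further, $$Z_{1/2}(s)=\int_0^\infty\bigl(\theta(t^2)^{1/2}-1\bigr)t^s\,\frac{dt}{t},$$ which converges absolutely for $\mathrm{Re}(s)>1/2$ and is continued meromorphically to $\mathbb{C}$. $K_\nu$ is the $K$-Bessel function, $K_\nu(x)=\frac12\int_0^\infty e^{-\frac{x}{2}(t+\frac1t)}t^{-\nu}\frac{dt}{t}$ for $x>0$, $\nu\in\mathbb{C}$. *)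

(* Defs.v *)
From HB Require Import structures.
From mathcomp Require Import all_boot all_order all_algebra.
From mathcomp Require Import all_classical all_reals all_analysis.
From mathcomp Require Import complex.

Set Implicit Arguments.
Unset Strict Implicit.
Unset Printing Implicit Defensive.

Import Order.TTheory GRing.Theory Num.Theory.
Import numFieldNormedType.Exports.

Local Open Scope classical_set_scope.
Local Open Scope ring_scope.
Local Open Scope complex_scope.

Section Complex.
Context {R : realType}.
Implicit Types (f F : R[i] -> R[i]) (z s : R[i]).

Definition cexp z : R[i] :=
  (expR (complex.Re z))%:C * (cos (complex.Im z) +i* sin (complex.Im z)).

(* The principal power t ^ s; only meaningful for t > 0. *)
Definition cpow (t : R) s : R[i] := cexp (s * (ln t)%:C).

(* Lebesgue integrals of complex-valued functions over ]0, +oo[;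
   integrability means absolute convergence. *)
Definition cintegrable0y (g : R -> R[i]) : Prop :=
  (@lebesgue_measure R).-integrable `]0, +oo[
    (fun t => (complex.Re (g t))%:E) /\
  (@lebesgue_measure R).-integrable `]0, +oo[
    (fun t => (complex.Im (g t))%:E).

Definition cintegral0y (g : R -> R[i]) : R[i] :=
  (\int[@lebesgue_measure R]_(t in `]0, +oo[) complex.Re (g t))
  +i* (\int[@lebesgue_measure R]_(t in `]0, +oo[) complex.Im (g t)).

Definition mellin_integrand (g : R -> R) s (t : R) : R[i] :=
  (g t)%:C * cpow t s / t%:C.

Definition mellin_integrable (g : R -> R) s : Prop :=
  cintegrable0y (mellin_integrand g s).

Definition mellin (g : R -> R) s : R[i] :=
  cintegral0y (mellin_integrand g s).

(* The topology and the normed module structure live on the alias R[i]^o. *)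
Definition holomorphic_at f z : Prop :=
  \forall w \near (z : R[i]^o), derivable (f : R[i]^o -> R[i]^o) w 1.

Definition pole_at f z : Prop :=
  exists (n : nat) (g : R[i] -> R[i]),
    [/\ (0 < n)%N, holomorphic_at g z, g z != 0 &
        \forall w \near (z : R[i]^o)^', f w = g w / (w - z) ^+ n].

(* Meromorphic on the whole plane: holomorphic except for (necessarily
   isolated) poles. The value of f at a pole is irrelevant. *)
Definition meromorphic f : Prop :=
  forall z, holomorphic_at f z \/ pole_at f z.

(* By the identity theorem and the normalization above, F is determined by f
   on Re s > a, up to its values at its poles. *)
Definition meromorphic_continuation (a : R) f F : Prop :=
  meromorphic F /\ forall s, a < complex.Re s -> F s = f s.

Definition bessel_K (nu : R[i]) (x : R) : R[i] :=
  2^-1 * cintegral0y (fun t =>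
    (expR (- (x / 2) * (t + t^-1)))%:C * cpow t (- nu) / t%:C).

End Complex.

(* For a formal power series a with a 0 = 1, the coefficients of a^(1/2), the
   power series with constant term 1 whose square is a (see fps_sqrtP).
   fps_sqrt_seq a n lists the coefficients of degree 0, ..., n. *)
Fixpoint fps_sqrt_seq (F : fieldType) (a : nat -> F) (n : nat) : seq F :=
  if n is m.+1 then
    let s := fps_sqrt_seq a m in
    rcons s ((a m.+1 - \sum_(1 <= i < m.+1) s`_i * s`_(m.+1 - i)) / 2)
  else [:: 1].

Definition fps_sqrt (F : fieldType) (a : nat -> F) (n : nat) : F :=
  (fps_sqrt_seq a n)`_n.

Lemma size_fps_sqrt_seq (F : fieldType) (a : nat -> F) n :
  size (fps_sqrt_seq a n) = n.+1.
Proof. by elim: n => //= n IHn; rewrite size_rcons IHn. Qed.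

Lemma nth_fps_sqrt_seq (F : fieldType) (a : nat -> F) n i :
  (i <= n)%N -> (fps_sqrt_seq a n)`_i = fps_sqrt a i.
Proof.
elim: n => [|n IHn]; first by rewrite leqn0 => /eqP ->.
rewrite leq_eqVlt => /predU1P[-> //|lt_in].
by rewrite /= nth_rcons size_fps_sqrt_seq lt_in IHn.
Qed.

Lemma fps_sqrt0 (F : fieldType) (a : nat -> F) : fps_sqrt a 0 = 1.
Proof. by []. Qed.

Lemma fps_sqrtP (F : fieldType) (a : nat -> F) : (2 : F) != 0 -> a 0%N = 1 ->
  forall n, \sum_(i < n.+1) fps_sqrt a i * fps_sqrt a (n - i) = a n.
Proof.
move=> nz2 a0 [|n]; first by rewrite big_ord1 mulr1 a0.
rewrite big_ord_recl big_ord_recr /= /bump /= !add1n subnn subn0 !fps_sqrt0.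
rewrite mul1r mulr1.
set S := \sum_(i < n) _; suff ->: fps_sqrt a n.+1 = (a n.+1 - S) / 2.
  set x := a n.+1 - S; have -> : S + x / 2 = a n.+1 - x / 2.
    apply/eqP; rewrite eq_sym subr_eq -addrA -mulrDl -mulr2n -[x *+ 2]mulr_natr.
    by rewrite mulfK // addrC subrK.
  by rewrite addrC subrK.
rewrite {1}/fps_sqrt /= nth_rcons size_fps_sqrt_seq ltnn eqxx.
congr ((_ - _) / 2); rewrite big_add1 /= big_mkord; apply: eq_bigr => i _.
by rewrite subSS /bump /= add1n !nth_fps_sqrt_seq ?leq_subr ?ltn_ord.
Qed.

Section Theta.
Context {R : realType}.

Definition theta (x : R) : R :=
  fine (\esum_(n in [set: int]) (expR (- pi * n%:~R ^+ 2 * x))%:E).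

(* The coefficient of X^m in 1 + 2 \sum_(n >= 1) X^(n^2). *)
Definition theta_coef (m : nat) : R :=
  (m == 0)%N%:R + 2 * \sum_(1 <= n < m.+1) ((n ^ 2)%N == m)%:R.

Definition c_half (m : nat) : R := fps_sqrt theta_coef m.

Definition Z_half_integral (s : R[i]) : R[i] :=
  mellin (fun t => Num.sqrt (theta (t ^+ 2)) - 1) s.

Definition E_half_kernel (y t : R) : R :=
  Num.sqrt (theta (y ^+ 2 * t ^+ 2) * theta (y ^- 2 * t ^+ 2)) - 1.

Definition E_half_integral (y : R) (s : R[i]) : R[i] :=
  mellin (E_half_kernel y) s.

Definition fourier_term (y : R) (s : R[i]) (n : nat) : R[i] :=
  cpow n%:R (s / 4 - 1 / 8)
  * (\sum_(d <- divisors n)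
       (c_half d * c_half (n %/ d))%:C * cpow d%:R (- (s / 2) + 1 / 4))
  * bessel_K (s / 2 - 1 / 4) (2 * pi * Num.sqrt n%:R * y ^+ 2).

Definition fourier_partial_sum (y : R) (s : R[i]) (N : nat) : R[i]^o :=
  \sum_(1 <= n < N.+1) fourier_term y s n.

End Theta.

(* Main.v *)
(* Put A(t) = theta(t^2)^(1/2) - 1 = sum_(m >= 1) c(m) e^(-pi m t^2).
   Theta inversion, A(1/t) + 1 = t^(1/2) (A(t) + 1), makes Z(s) an entire
   function plus 1/(s - 1/2) - 1/s with Z(1/2 - s) = Z(s), and it splits the
   kernel of E(y,s) as
     A(t/y) + (y/t)^(1/2) A(yt) + (y/t)^(1/2) A(yt) A(y/t).
   The first two terms have Mellin transforms Z(s) y^s and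
   Z(s - 1/2) y^(1-s) = Z(1-s) y^(1-s).  The third one decays faster than any
   power of t at 0 and at oo, so its transform is entire; integrated term by
   term it is the series of K-Bessel functions.
   Term-by-term integration needs polynomial growth of c(m).  By Gauss,
     1 + 2 sum_n (-1)^n q^(n^2) = prod_k (1 - q^k) / (1 + q^k),
   so the logarithmic derivative of theta has coefficients of polynomial size;
   the resulting recurrence for c gives c(m) r^m bounded for every r < 1, and
   Parseval's identity then gives |c(m)| <= 8 (m + 1).
   Theta inversion is obtained by Polya's method: sums of cos^(2m) over the
   multiples of pi/l, evaluated by the binomial theorem, turn into theta series
   on both sides when m ~ l^2 / tau. *)

Require Import Defs.
From HB Require Import structures.
From mathcomp Require Import all_boot all_order all_algebra.
From mathcomp Require Import all_classical all_reals all_analysis.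
From mathcomp Require Import complex.
From mathcomp Require Import measurable_realfun.
From mathcomp Require Import ring lra zify.

Set Implicit Arguments.
Unset Strict Implicit.
Unset Printing Implicit Defensive.

Import Order.TTheory GRing.Theory Num.Theory.
Import numFieldNormedType.Exports.

Local Open Scope classical_set_scope.
Local Open Scope ring_scope.
Local Open Scope complex_scope.

(** * Gauss's product and the growth of the coefficients *)

(** The obstacle is the size of the coefficients. That the formal square root converges in the whole
    unit disc rests on theta having no zero there, and Gauss's product supplies this fact
    algebraically: its logarithmic derivative is computed with truncated polynomials, and the mean
    square over a circle becomes a finite average over roots of unity, so no contour integral is
    taken.

    In the kernel, inversion is applied to one factor only. The product [A(yt) A(y/t)] that results
    is small at both ends because one factor is exponentially small where the other grows at most
    like a fixed power.

    Holomorphy always comes from an explicit quadratic remainder of [t^s], integrated against a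
    rapidly decreasing function. Whatever is not rapidly decreasing is split off as an indicator
    function with an elementary transform, and these transforms carry all the poles. *)

Section GaussProduct.
Variables (S : comNzRingType) (x : S).

Let Q n : S := \prod_(1 <= k < n.+1) (1 + x ^+ k).
Let P n : S := \prod_(1 <= k < n.+1) (1 - x ^+ k).
Let U s n : S :=
  (\prod_(s.+1 <= k < n.+1) (1 - x ^+ k)) * \prod_(1 <= k < s) (1 + x ^+ k).

(* Shanks' finite form of Gauss's product; the terms of the last sum have
   order greater than [n] in [x]. *)
Lemma gauss_finite_product n :
  Q n * (1 + 2 * \sum_(1 <= j < n.+1) (-1) ^+ j * x ^+ (j ^ 2)) =
  P n + 2 * \sum_(1 <= s < n.+1) (-1) ^+ s * x ^+ (s * n.+1) * U s n.
Proof.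
elim: n => [|n IHn].
  by rewrite /Q /P !big_geq// mulr0 !addr0 mulr1.
set m := n.+1.
(* Telescoping certificate: passing from [n] to [m] changes the summand at [s] by
   [(-1)^(s+1) V (s+1) - (-1)^s V s]. The end [V 1] corrects [P], and the end [V m] is the new theta
   term. *)
pose V s : S := x ^+ (s * m) *
  ((\prod_(s <= k < m) (1 - x ^+ k)) * \prod_(1 <= k < s) (1 + x ^+ k)).
have -> : Q m = (1 + x ^+ m) * Q n by rewrite /Q big_nat_recr//= mulrC.
rewrite [X in 1 + 2 * X]big_nat_recr//= [X in P m + 2 * X]big_nat_recr//=.
have -> : P m = (1 - x ^+ m) * P n by rewrite /P big_nat_recr//= mulrC.
have -> : U m m = Q n by rewrite /U big_geq// mul1r.
have V1 : V 1%N = x ^+ m * P n by rewrite /V [X in _ * (_ * X)]big_geq// mulr1 mul1n.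
have Vm : V m = x ^+ (m ^ 2) * Q n.
  by rewrite /V [X in _ * (X * _)]big_geq// mul1r -mulnn.
have telV k : (k <= n)%N -> \sum_(1 <= s < k.+1)
    ((-1) ^+ s * x ^+ (s * m.+1) * U s m
     - (1 + x ^+ m) * ((-1) ^+ s * x ^+ (s * m) * U s n)) =
    (-1) ^+ k.+1 * V k.+1 + V 1%N.
  elim: k => [|k IHk] lekn; first by rewrite big_geq// expr1 mulN1r addNr.
  rewrite big_nat_recr//= IHk 1?ltnW// addrAC.
  congr (_ + _).
  have UE : U k.+1 m = (1 - x ^+ m) * U k.+1 n.
    by rewrite /U (@big_nat_recr _ _ _ n.+1 k.+2)//= mulrAC mulrC.
  have V'E : V k.+1 = x ^+ (k.+1 * m) * ((1 - x ^+ k.+1) * U k.+1 n).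
    by rewrite /V big_ltn ?ltnS// /U !mulrA.
  have V''E : V k.+2 = x ^+ (k.+2 * m) * ((1 + x ^+ k.+1) * U k.+1 n).
    rewrite /V (@big_nat_recr _ _ _ k.+1 1)//= /U.
    by congr (_ * _); rewrite mulrA mulrC.
  rewrite UE V'E V''E.
  have -> : x ^+ (k.+1 * m.+1) = x ^+ k.+1 * x ^+ (k.+1 * m).
    by rewrite mulnS exprD.
  have -> : x ^+ (k.+2 * m) = x ^+ m * x ^+ (k.+1 * m).
    by rewrite mulSn exprD.
  rewrite !(exprS (-1)) ; move: (x ^+ (k.+1 * m)) (U k.+1 n) (x ^+ m) ((-1)^+k) => a b c d.
  ring.
have := telV n (leqnn n); rewrite big_split/= sumrN -mulr_sumr Vm V1.
have -> : x ^+ (m * m.+1) = x ^+ m * x ^+ (m ^ 2) by rewrite mulnS exprD mulnn.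
move: IHn; rewrite -/m.
move: (\sum_(1 <= s < m) _ * U s n) (\sum_(1 <= s < m) _ * U s m).
move: (\sum_(1 <= j < m) _) (Q n) (P n) (x ^+ (m ^ 2)) (x ^+ m) ((-1) ^+ m).
move=> a q p y z e A B IH tel.
have -> : B = (1 + z) * A + (e * (y * q) + z * p) by rewrite -tel; ring.
transitivity ((1 + z) * (q * (1 + 2 * a)) + (1 + z) * q * (2 * (e * y))).
  by ring.
by rewrite IH; ring.
Qed.

End GaussProduct.

(** * Polynomials modulo a power of X and the derivation X d/dX *)

Section TruncatedPolynomials.
Variables (F : fieldType) (N : nat).
Implicit Types p q : {poly F}.

Definition eq_trunc p q := forall i, (i < N)%N -> p`_i = q`_i.

Lemma eq_truncD p p' q q' :
  eq_trunc p p' -> eq_trunc q q' -> eq_trunc (p + q) (p' + q').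
Proof. by move=> h h' i iN; rewrite !coefD h// h'. Qed.

Lemma eq_truncM p p' q q' :
  eq_trunc p p' -> eq_trunc q q' -> eq_trunc (p * q) (p' * q').
Proof.
move=> h h' i iN; rewrite !coefM; apply: eq_bigr => j _.
by rewrite h ?h'// (leq_ltn_trans _ iN)// ?leq_subr// -ltnS.
Qed.

Lemma eq_trunc_refl p : eq_trunc p p. Proof. by []. Qed.

Lemma eq_trunc_sym p q : eq_trunc p q -> eq_trunc q p.
Proof. by move=> h i /h. Qed.

Lemma eq_trunc_trans q p r : eq_trunc p q -> eq_trunc q r -> eq_trunc p r.
Proof. by move=> h h' i iN; rewrite h// h'. Qed.

(** Coefficient [i] of [p * q] is [p_0 q_i] plus terms in earlier coefficients of [q], so strong
    induction recovers [q] without inverting [p]. *)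
Lemma eq_truncI p q r : p`_0 != 0 -> eq_trunc (p * q) (p * r) -> eq_trunc q r.
Proof.
move=> p0 h; elim/ltn_ind => i IH iN; move: (h i iN).
rewrite !coefM !big_ord_recl !subn0 => H.
apply: (mulfI p0); apply: (addIr (\sum_(i0 < i) p`_(lift ord0 i0) * q`_(i - lift ord0 i0))).
rewrite H; congr (_ + _); apply: eq_bigr => j _.
have ji := ltn_ord j.
by rewrite IH//=; rewrite /bump /= add1n; lia.
Qed.

(** Unlike the plain derivative, this derivation acts diagonally on coefficients and so loses no
    order of truncation. *)
Definition eulerD p := 'X * p^`().

Lemma coef_eulerD p i : (eulerD p)`_i = i%:R * p`_i.
Proof.
rewrite /eulerD coefXM coef_deriv; case: i => [|i] /=; first by rewrite mul0r.
by rewrite mulr_natl.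
Qed.

Lemma eulerDM p q : eulerD (p * q) = eulerD p * q + p * eulerD q.
Proof. by rewrite /eulerD derivM; ring. Qed.

Lemma eq_trunc_eulerD p q : eq_trunc p q -> eq_trunc (eulerD p) (eulerD q).
Proof. by move=> h i iN; rewrite !coef_eulerD h. Qed.

(** Logarithmic derivatives add up; [g k] stands for that of [f k], in a form free of division. *)
Lemma eulerD_prod (r : seq nat) (f g : nat -> {poly F}) :
  (forall k, k \in r -> eq_trunc (eulerD (f k)) (g k * f k)) ->
  eq_trunc (eulerD (\prod_(k <- r) f k)) ((\sum_(k <- r) g k) * \prod_(k <- r) f k).
Proof.
elim: r => [|k r IH] h.
  by rewrite !big_nil mul0r /eulerD derivC mulr0.
rewrite !big_cons eulerDM.
have hk := h k (mem_head _ _).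
have hr : eq_trunc (f k * eulerD (\prod_(j <- r) f j))
   (f k * ((\sum_(j <- r) g j) * \prod_(j <- r) f j)).
  apply: eq_truncM => //; apply: IH => j jr; apply: h.
  by rewrite inE jr orbT.
have hk' : eq_trunc (eulerD (f k) * (\prod_(j <- r) f j)) (g k * f k * \prod_(j <- r) f j).
  by apply: eq_truncM.
apply: (eq_trunc_trans (eq_truncD hk' hr)).
move: (\sum_(j <- r) _) (\prod_(j <- r) _) (f k) (g k) => A B f' g'.
by rewrite (_ : _ + _ = (g' + A) * (f' * B))//; ring.
Qed.

End TruncatedPolynomials.

(** * A recurrence for the coefficients of the square root of theta *)

Section SqrtThetaCoefficients.
Context {R : realType}.
Implicit Types (n i : nat).

Local Notation c := (@c_half R).

Lemma c_half0 : c 0 = 1. Proof. by []. Qed.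

Lemma theta_coef0 : @theta_coef R 0 = 1.
Proof. by rewrite /theta_coef big_geq// mulr0 addr0. Qed.

Lemma c_half_conv n : \sum_(i < n.+1) c i * c (n - i) = theta_coef n.
Proof. by apply: (fps_sqrtP _ theta_coef0); rewrite pnatr_eq0. Qed.

Lemma theta_coef_poly n i : (i <= n)%N ->
  (1 + 2 * \sum_(1 <= j < n.+1) 'X^(j ^ 2) : {poly R})`_i = theta_coef i.
Proof.
move=> ilen; rewrite /theta_coef coefD coef1; congr (_ + _).
rewrite mulr_natl coefMn [RHS]mulr_natl; congr (_ *+ _).
rewrite coef_sum (@big_cat_nat _ _ _ i.+1)//=.
rewrite [X in _ + X]big1_seq ?addr0; last first.
  move=> j /andP[_]; rewrite mem_index_iota => /andP[ij _].
  rewrite coefXn; case: eqP => // E; move: ij; rewrite E.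
  by rewrite -mulnn; case: j {E} => // j; nia.
by apply: eq_bigr => j _; rewrite coefXn eq_sym.
Qed.

Let Q n : {poly R} := \prod_(1 <= k < n.+1) (1 + (- 'X) ^+ k).
Let P n : {poly R} := \prod_(1 <= k < n.+1) (1 - (- 'X) ^+ k).

(** At [x = -X] all signs become [+], since [j + j^2] is even, and the correction terms carry
    [X^(s (n+1))] with [s >= 1], which the truncation removes. *)
Lemma theta_gauss n : eq_trunc n.+1
  (Q n * (1 + 2 * \sum_(1 <= j < n.+1) 'X^(j ^ 2))) (P n).
Proof.
move=> i iN.
have := gauss_finite_product (- 'X : {poly R}) n.
rewrite -/(Q n) -/(P n) => H.
rewrite (_ : \sum_(1 <= j < n.+1) 'X^(j ^ 2) =
    \sum_(1 <= j < n.+1) (-1) ^+ j * (- 'X) ^+ (j ^ 2)); last first.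
  apply: eq_bigr => j _; rewrite [(- _) ^+ (j ^ 2)]exprNn mulrA -exprD.
  rewrite -signr_odd oddD oddX /= addbb /= mul1r//.
rewrite H coefD mulr_natl coefMn coef_sum big1_seq ?mul0rn ?addr0//.
move=> s /andP[_]; rewrite mem_index_iota => /andP[s1 sn].
move: (_ * \prod_(1 <= k < s) _) => W.
rewrite [(- 'X) ^+ (s * _)]exprNn mulrA -mulrA mulrCA coefXnM.
by rewrite (leq_trans iN)// leq_pmull.
Qed.


Lemma sum_ord_lt (N m : nat) : (\sum_(j < N) (j < m) = minn N m)%N.
Proof. by elim: N => [|N IH]; rewrite ?big_ord0 ?min0n// big_ord_recr /= IH; lia. Qed.

(** The parameter [e] lets one computation serve both products: [1 - z 0 k] is a factor of [P] and
    [1 - z 1 k] a factor of [Q]. *)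
Let z e k : {poly R} := (-1) ^+ (e + k) *: 'X^k.

(* [1 - z] has logarithmic derivative [- k z / (1 - z)] when [z = +-X^k]. *)
Let logD n e k : {poly R} := - k%:R *: \sum_(j < n.+1) z e k ^+ j.+1.

Let zX e k j : z e k ^+ j = (-1) ^+ ((e + k) * j) *: 'X^(k * j).
Proof. by rewrite exprZn -exprM -exprM. Qed.

(** The geometric series of [1 / (1 - z)] is cut after [n+1] terms; multiplying back leaves an error
    in [z^(n+2)], of order [k (n+2) > n]. *)
Let logDP n e k : (0 < k)%N ->
  eq_trunc n.+1 (eulerD (1 - z e k)) (logD n e k * (1 - z e k)).
Proof.
move=> k0 i iN.
have -> : logD n e k * (1 - z e k) = - k%:R *: (z e k - z e k ^+ n.+2).
  rewrite /logD -scalerAl; congr (_ *: _).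
  under eq_bigr do rewrite exprS.
  rewrite -mulr_sumr -mulrA [X in _ * X]mulrC -opprB mulNr -subrX1 opprB.
  by rewrite mulrBr mulr1 -exprS.
have -> : eulerD (1 - z e k) = - k%:R *: z e k.
  apply/polyP => m; rewrite coef_eulerD coefB coefZ coef1 !coefZ coefXn.
  case: (m =P k) => [->|_]; first by rewrite (gtn_eqF k0) /=; ring.
  by case: m => [|m] /=; ring.
suff zN : (z e k ^+ n.+2)`_i = 0 by rewrite coefZ [in RHS]coefZ coefB zN subr0.
rewrite zX coefZ coefXn (_ : (i == k * n.+2)%N = false) ?mulr0//.
by apply: ltn_eqF; rewrite (leq_trans iN)//; nia.
Qed.

(** The exponent [k (j+1)] equals [m] only for [k <= m] and [j < m], with weight [k <= m]. The
    actual size is at most the divisor sum of [m]; what matters is a polynomial bound that does not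
    depend on [n]. *)
Let logD_bound n e m : `| (\sum_(1 <= k < n.+1) logD n e k)`_m | <= m%:R ^+ 3.
Proof.
have h k : (0 < k)%N -> `| (logD n e k)`_m | <= (k.-1 < m)%:R * m%:R ^+ 2.
  move=> k0; rewrite /logD coefZ coef_sum normrM normrN normr_nat.
  apply: (@le_trans _ _ ((k.-1 < m)%:R * (m%:R * \sum_(j < n.+1) (j < m)%:R))).
    rewrite mulrCA mulr_sumr (le_trans (ler_wpM2l _ (ler_norm_sum _ _ _)))//.
    rewrite !mulr_sumr ler_sum// => j _; rewrite zX coefZ normrM normrX normrN1.
    rewrite expr1n mul1r coefXn normr_nat -!natrM ler_nat.
    by case: eqP => [->|_]; rewrite ?muln0// !muln1; nia.
  rewrite ler_wpM2l// expr2 ler_wpM2l// -natr_sum ler_nat sum_ord_lt geq_minr//.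
rewrite coef_sum (le_trans (ler_norm_sum _ _ _))//.
apply: (@le_trans _ _ (\sum_(1 <= k < n.+1) (k.-1 < m)%:R * m%:R ^+ 2)).
  rewrite big_seq_cond [leRHS]big_seq_cond ler_sum// => k.
  by rewrite mem_index_iota andbT => /andP[k0 _]; exact: h.
rewrite -mulr_suml exprS ler_wpM2r ?exprn_ge0//.
rewrite big_add1 /= big_mkord -natr_sum ler_nat sum_ord_lt geq_minr//.
Qed.

(* [L] is the logarithmic derivative of Gauss's product. *)
Lemma c_half_rec n : exists L : nat -> R,
  [/\ L 0%N = 0, forall j, `|L j| <= 2 * j%:R ^+ 3 &
   forall i, (i <= n)%N -> 2 * i%:R * c i = \sum_(j < i.+1) L j * c (i - j)].
Proof.
pose G e : {poly R} := \sum_(1 <= k < n.+1) logD n e k.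
have LB e m : `|(G e)`_m| <= m%:R ^+ 3 by exact: logD_bound.
pose p : {poly R} := \poly_(i < n.+1) c i.
pose T : {poly R} := 1 + 2 * \sum_(1 <= j < n.+1) 'X^(j ^ 2).
have pT : eq_trunc n.+1 (p * p) T.
  move=> i iN; rewrite coefM theta_coef_poly// -c_half_conv.
  apply: eq_bigr => j _; rewrite !coef_poly.
  by rewrite (leq_trans (ltn_ord j))// (leq_ltn_trans (leq_subr _ _)).
have PE : P n = \prod_(1 <= k < n.+1) (1 - z 0 k).
  by apply: eq_bigr => k _; rewrite /z add0n -(scaleN1r 'X) exprZn.
have QE : Q n = \prod_(1 <= k < n.+1) (1 - z 1 k).
  apply: eq_bigr => k _.
  by rewrite /z add1n exprS mulN1r scaleNr opprK -(scaleN1r 'X) exprZn.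
have DP : eq_trunc n.+1 (eulerD (P n)) (G 0%N * P n).
  rewrite PE; apply: eulerD_prod => k; rewrite mem_index_iota => /andP[k0 _].
  exact: logDP.
have DQ : eq_trunc n.+1 (eulerD (Q n)) (G 1%N * Q n).
  rewrite QE; apply: eulerD_prod => k; rewrite mem_index_iota => /andP[k0 _].
  exact: logDP.
have QpP : eq_trunc n.+1 (Q n * (p * p)) (P n).
  apply: eq_trunc_trans (@theta_gauss n); apply: eq_truncM => //.
(* Applying [eulerD] to [Q p^2 = P] gives [G1 Q p^2 + 2 Q p (eulerD p) = G0 Q p^2]. Every term
   contains [Q p], whose constant term is nonzero, so it can be cancelled. *)
have D : eq_trunc n.+1 (Q n * p * (2 * eulerD p)) (Q n * p * ((G 0%N - G 1%N) * p)).
  move=> i iN.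
  have := eq_trunc_eulerD QpP; rewrite !eulerDM => H.
  have H1 := eq_trunc_trans H (eq_trunc_trans DP (eq_truncM (@eq_trunc_refl _ _ _) (eq_trunc_sym QpP))).
  have H2 := eq_truncM DQ (@eq_trunc_refl _ n.+1 (p * p)).
  have := H1 i iN; have := H2 i iN.
  rewrite [in X in _ -> X -> _]coefD => -> H3.
  apply: (addrI ((G 1%N * Q n * (p * p))`_i)).
  rewrite -!coefD.
  transitivity ((G 0%N * (Q n * (p * p)))`_i); last first.
    by apply: (congr1 (fun q : {poly R} => q`_i)); ring.
  by rewrite -H3 -!coefD; apply: (congr1 (fun q : {poly R} => q`_i)); ring.
have Qp0 : (Q n * p)`_0 != 0.
  rewrite coefM big_ord1 subnn coef_poly /= c_half0 mulr1 QE.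
  rewrite -horner_coef0 horner_prod big1_seq ?oner_neq0// => k /andP[_].
  rewrite mem_index_iota => /andP[k0 _]; rewrite hornerD hornerN hornerZ hornerXn.
  by rewrite hornerC expr0n (gtn_eqF k0) mulr0 subr0.
have E := eq_truncI Qp0 D.
exists (fun j => (G 0%N - G 1%N)`_j); split.
- by have := LB 0 0%N; have := LB 1%N 0%N; rewrite coefB expr0n /= !normr_le0 => /eqP -> /eqP ->; rewrite subr0.
- move=> j; rewrite coefB mulr_natl mulr2n (le_trans (ler_normB _ _))//.
  by rewrite lerD.
- move=> i iN; have := E i iN; rewrite mulr_natl coefMn coef_eulerD coefM.
  rewrite coef_poly ltnS iN => H; rewrite -mulrA mulr_natl H.
  apply: eq_bigr => j _; rewrite coef_poly.
  by rewrite (leq_ltn_trans (leq_subr _ _)).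
Qed.

End SqrtThetaCoefficients.

(** * Growth and summability of sequences *)

Section Growth.
Context {R : realType}.

Lemma sum_geo_le (s : R) N : 0 <= s -> s < 1 -> \sum_(j < N) s ^+ j <= (1 - s)^-1.
Proof.
move=> s0 s1; have s1' : 0 < 1 - s by rewrite subr_gt0.
rewrite -[leRHS]mul1r ler_pdivlMr// mulrC -opprB mulNr -subrX1 opprB.
by rewrite lerBlDr lerDl exprn_ge0.
Qed.

(** Each factor [j] costs a slight increase of the ratio: at the midpoint [t], Bernoulli's
    inequality bounds [j] by a constant times [(s/t)^j]. *)
Lemma powM_geo_le p (r s : R) : 0 < r -> r < s ->
  exists2 C, 0 < C & forall j : nat, j%:R ^+ p * r ^+ j <= C * s ^+ j.
Proof.
elim: p r s => [|p IH] r s r0 rs.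
  exists 1 => // j; rewrite expr0 !mul1r; apply: lerXn2r; rewrite ?nnegrE ?ltW//.
  exact: lt_trans rs.
pose t := (r + s) / 2.
have rt : r < t by rewrite /t; lra.
have ts : t < s by rewrite /t; lra.
have t0 := lt_trans r0 rt; have s0 := lt_trans t0 ts.
have [C C0 HC] := IH r t r0 rt.
have d0 : 0 < s / t - 1 by rewrite subr_gt0 ltr_pdivlMr// mul1r.
exists (C / (s / t - 1)); first by rewrite divr_gt0.
move=> j; rewrite exprS -mulrA.
have h : j%:R <= (s / t) ^+ j / (s / t - 1).
  rewrite ler_pdivlMr//.
  elim: j => [|j IHj]; first by rewrite mul0r.
  rewrite -natr1 mulrDl mul1r exprS.
  have h1 : 1 <= (s / t) ^+ j.
    by apply: exprn_ege1; rewrite ler_pdivlMr// mul1r ltW.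
  have : (s / t - 1) * 1 <= (s / t - 1) * (s/t) ^+ j by rewrite ler_pM2l.
  move: IHj; move: ((s/t)^+j) (s/t) (j%:R) => a b x; lra.
apply: le_trans (ler_pM (ler0n _ _) _ h (HC j)) _.
  by rewrite mulr_ge0// exprn_ge0// ltW.
rewrite [leLHS](_ : _ = C * ((s / t) ^+ j * t ^+ j) / (s / t - 1)); last by ring.
by rewrite -exprMn divfK ?gt_eqF// [leRHS]mulrAC.
Qed.

End Growth.

Section AbsSummable.
Context {R : realType}.
Implicit Types (a b : nat -> R) (N : nat).

(** After weighting by [r^i] the recurrence is a convolution with a kernel of finite total mass, at
    most [2 B]. Once [i] exceeds [B], the factor [2 i] on the left outweighs this mass, so the
    finitely many terms up to [M >= B] bound all later ones. *)
Lemma growth_of_recurrence a :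
  (forall i, exists L : nat -> R, [/\ L 0%N = 0, forall j, `|L j| <= 2 * j%:R ^+ 3 &
     2 * i%:R * a i = \sum_(j < i.+1) L j * a (i - j)%N]) ->
  forall r, 0 < r -> r < 1 -> exists K, forall i, `|a i| * r ^+ i <= K.
Proof.
move=> rec r r0 r1.
have rs : r < (r + 1) / 2 by lra.
have s0 : 0 <= (r + 1) / 2 by lra.
have s1 : (r + 1) / 2 < 1 by lra.
have [C C0 HC] := powM_geo_le 3 r0 rs.
pose B := C * (1 - (r + 1) / 2)^-1.
have B0 : 0 < B by rewrite mulr_gt0// invr_gt0; lra.
have HB N : \sum_(j < N) j%:R ^+ 3 * r ^+ j <= B.
  apply: (@le_trans _ _ (\sum_(j < N) C * ((r + 1) / 2) ^+ j)).
    by apply: ler_sum => j _; exact: HC.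
  by rewrite -mulr_sumr ler_pM2l// sum_geo_le.
pose M := (Num.truncn B).+1.
have BM : B <= M%:R by rewrite ltW// truncnS_gt.
have t0 i : 0 <= `|a i| * r ^+ i by rewrite mulr_ge0// exprn_ge0// ltW.
pose K := \sum_(i < M.+1) `|a i| * r ^+ i.
exists K; elim/ltn_ind => i IH.
have [iM|Mi] := leqP i M.
  by rewrite /K (bigD1 (Ordinal (iM : (i < M.+1)%N)))//= lerDl sumr_ge0.
have i0 : 0 < i%:R :> R by rewrite ltr0n (leq_trans _ Mi).
have K0 : 0 <= K by rewrite sumr_ge0.
have [L [L0 LB Hi]] := rec i.
rewrite -(ler_pM2l (_ : 0 < 2 * i%:R)) ?mulr_gt0//.
have -> : 2 * i%:R * (`|a i| * r ^+ i) = `|2 * i%:R * a i| * r ^+ i.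
  by rewrite normrM ger0_norm ?mulrA// mulr_ge0// ltW.
rewrite Hi; apply: (@le_trans _ _ (\sum_(j < i.+1) 2 * (j%:R ^+ 3 * r ^+ j) * K)).
  apply: (@le_trans _ _ ((\sum_(j < i.+1) `|L j * a (i - j)%N|) * r ^+ i)).
    by rewrite ler_wpM2r ?exprn_ge0 ?(ltW r0)// ler_norm_sum.
  rewrite mulr_suml; apply: ler_sum => j _.
  have [->|j0] := eqVneq (nat_of_ord j) 0%N.
    by rewrite L0 mul0r normr0 mul0r expr0n/= mul0r mulr0 mul0r.
  have ji : (j <= i)%N by rewrite -ltnS.
  have -> : r ^+ i = r ^+ j * r ^+ (i - j) by rewrite -exprD subnKC.
  rewrite normrM mulrACA ler_pM ?mulr_ge0 ?exprn_ge0 ?(ltW r0)//.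
  + by rewrite mulrA ler_wpM2r// exprn_ge0// ltW.
  + by apply: IH; lia.
rewrite -mulr_suml -mulr_sumr ler_wpM2r// ler_pM2l//.
by apply: le_trans (HB _) (le_trans BM _); rewrite ler_nat ltnW.
Qed.

Definition abs_summable a := exists B, forall N, \sum_(i < N) `|a i| <= B.

Lemma abs_summable_cvg_norm a : abs_summable a -> cvgn (series (fun i => `|a i|)).
Proof.
move=> [B HB]; apply: nondecreasing_is_cvgn.
  by apply: nondecreasing_series => i _ _; exact: normr_ge0.
by exists B => _ [N _ <-]; rewrite /series /= big_mkord.
Qed.

Lemma abs_summable_cvg a : abs_summable a -> cvgn (series a).
Proof. by move=> /abs_summable_cvg_norm h; apply: normed_cvg. Qed.

Lemma abs_summable_le a b C : (forall i, `|a i| <= C * `|b i|) ->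
  abs_summable b -> abs_summable a.
Proof.
move=> ab [B HB]; exists (`|C| * B) => N.
apply: (@le_trans _ _ (\sum_(i < N) `|C| * `|b i|)).
  apply: ler_sum => i _; apply: le_trans (ab i) _.
  by rewrite ler_wpM2r// ler_norm.
by rewrite -mulr_sumr ler_wpM2l.
Qed.

Lemma abs_summable_geo (s : R) : 0 <= s -> s < 1 -> abs_summable (fun i => s ^+ i).
Proof.
move=> s0 s1; exists (1 - s)^-1 => N.
by under eq_bigr do rewrite ger0_norm ?exprn_ge0//; exact: sum_geo_le.
Qed.

Lemma cvg_normrP (u : nat -> R) (l : R) (e : nat -> R) :
  (forall n, `|l - u n| <= e n) -> e @ \oo --> 0 -> u @ \oo --> l.
Proof.
move=> h he; apply/cvgrPdist_le => eps eps0.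
near=> n; apply: le_trans (h n) _.
have : `|0 - e n| <= eps by near: n; move/cvgrPdist_le: he; apply.
by rewrite sub0r normrN; apply: le_trans; exact: ler_norm.
Unshelve. all: by end_near. Qed.

(** * Products of series summed over growing regions *)

Section Region.
Variables (a b : nat -> R) (P : nat -> nat -> nat -> bool) (k : nat -> nat).
Hypothesis Pk : forall N i j, (i < k N)%N -> (j < k N)%N -> P N i j.
Hypothesis kN : forall N, (k N <= N)%N.
Hypothesis ky : k @ \oo --> \oo.

(** The region contains a square of side [k N], so what lies outside it is at most the difference of
    two products of partial sums with the same limit. *)
Lemma sum_outside_region_cvg0 : abs_summable a -> abs_summable b ->
  (fun N => \sum_(i < N) \sum_(j < N | ~~ P N i j) `|a i| * `|b j|) @ \oo --> 0.
Proof.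
move=> sa sb.
pose X := series (fun i => `|a i|); pose Y := series (fun i => `|b i|).
have cX : X @ \oo --> limn X by exact: abs_summable_cvg_norm.
have cY : Y @ \oo --> limn Y by exact: abs_summable_cvg_norm.
have h : (fun N => X N * Y N - X (k N) * Y (k N)) @ \oo --> 0.
  rewrite -(subrr (limn X * limn Y)); apply: cvgB; first exact: cvgM.
  apply: cvgM; first exact: (cvg_comp _ _ ky cX).
  exact: (cvg_comp _ _ ky cY).
apply: (squeeze_cvgr _ (cvg_cst 0) h); near=> N; apply/andP; split.
  by apply: sumr_ge0 => i _; apply: sumr_ge0 => j _; rewrite mulr_ge0.
have XE n : X n = \sum_(i < n) `|a i| by rewrite /X /series /= big_mkord.
have YE n : Y n = \sum_(i < n) `|b i| by rewrite /Y /series /= big_mkord.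
have subE n (f : nat -> R) : (n <= N)%N -> \sum_(i < n) f i = \sum_(i < N | (i < n)%N) f i.
  by move=> nN; rewrite (big_ord_widen _ _ nN).
rewrite !XE !YE (subE (k N) (fun i => `|a i|))// (subE (k N) (fun i => `|b i|))//.
rewrite lerBrDr !mulr_suml.
under [X in _ <= X]eq_bigr do rewrite mulr_sumr.
under [X in _ + X <= _]eq_bigr do rewrite mulr_sumr.
rewrite [X in _ + X <= _]big_mkcond -big_split /=; apply: ler_sum => i _.
rewrite [leRHS](bigID (fun j : 'I_N => P N i j)) /= addrC lerD2r.
case: ifPn => ik; last first.
  by apply: sumr_ge0 => j _; rewrite mulr_ge0.
rewrite big_mkcond [leRHS]big_mkcond; apply: ler_sum => j _ /=.
case: ifPn => jk; first by rewrite Pk.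
by case: ifP => // _; rewrite mulr_ge0.
Unshelve. all: by end_near. Qed.

(** Stated for general regions because two occur: the triangle [i + j < N] of the Cauchy product and
    the hyperbolic region [(i+1)(j+1) <= N] of the Dirichlet convolution. *)
Lemma sum_region_cvg (A B : R) : abs_summable a -> abs_summable b ->
  series a @ \oo --> A -> series b @ \oo --> B ->
  (fun N => \sum_(i < N) \sum_(j < N | P N i j) a i * b j) @ \oo --> A * B.
Proof.
move=> sa sb cA cB.
have h := sum_outside_region_cvg0 sa sb.
have hAB : (fun N => series a N * series b N) @ \oo --> A * B by exact: cvgM.
rewrite -[A * B]subr0.
rewrite (_ : (fun N : nat => _) = (fun N => series a N * series b N -
   \sum_(i < N) \sum_(j < N | ~~ P N i j) a i * b j)); last first.
  apply/funext => N; rewrite /series /= !big_mkord mulr_suml -sumrB.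
  apply: eq_bigr => i _; rewrite mulr_sumr [X in _ = X - _](bigID (fun j : 'I_N => P N i j)) /=.
  by rewrite addrK.
apply: cvgB => //; apply: cvg_normrP h => N.
rewrite sub0r normrN (le_trans (ler_norm_sum _ _ _))//; apply: ler_sum => i _.
rewrite (le_trans (ler_norm_sum _ _ _))//; apply: ler_sum => j _.
by rewrite normrM.
Qed.

End Region.

End AbsSummable.

(** * Finite trigonometric sums and a discrete Parseval inequality *)

Section TrigonometricSums.
Context {R : realType}.
Implicit Types (h d j n : nat).

Lemma natr_doubleS n : n.*2.+1%:R = 2 * n%:R + 1 :> R.
Proof. by rewrite -natr1 -mul2n natrM. Qed.

Lemma cosD2pi_nat (x : R) n : cos (x + 2 * pi * n%:R) = cos x.
Proof. by rewrite mulr_natr mulr_natl; exact: (periodicn (@cosD2pi R)). Qed.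

Lemma sin_natpi n : sin (n%:R * pi) = 0 :> R.
Proof.
elim: n => [|n IH]; first by rewrite mul0r sin0.
by rewrite -natr1 mulrDl mul1r sinDpi IH oppr0.
Qed.

Lemma dirichlet_kernel h (x : R) :
  sin x * (1 + 2 * \sum_(1 <= j < h.+1) cos (2 * j%:R * x)) = sin (h.*2.+1%:R * x).
Proof.
elim: h => [|h IH]; first by rewrite big_geq// mulr0 addr0 mulr1 mul1r.
rewrite big_nat_recr//=.
move: IH; move: (\sum_(1 <= j < h.+1) _) => S IH.
have -> : sin x * (1 + 2 * (S + cos (2 * h.+1%:R * x))) =
  sin x * (1 + 2 * S) + 2 * (sin x * cos (2 * h.+1%:R * x)) by ring.
rewrite IH.
have -> : h.*2.+1%:R * x = 2 * h.+1%:R * x - x.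
  by rewrite natr_doubleS -natr1; ring.
have -> : h.+1.*2.+1%:R * x = 2 * h.+1%:R * x + x.
  by rewrite natr_doubleS; ring.
by rewrite sinB sinD; ring.
Qed.

(** This is the sum over all roots of unity of odd order [l = 2h+1], folded by pairing conjugates.
    For a residue [r != 0] the Dirichlet kernel has numerator [sin(pi r) = 0] and denominator
    [sin(pi r / l) > 0]. *)
Lemma cos_sum_odd h d :
  1 + 2 * \sum_(1 <= j < h.+1) cos (2 * j%:R * (pi * d%:R / h.*2.+1%:R)) =
  (if (h.*2.+1 %| d)%N then h.*2.+1%:R else 0) :> R.
Proof.
set l := h.*2.+1.
have l0 : l%:R != 0 :> R by rewrite pnatr_eq0.
pose r := (d %% l)%N.
rewrite (_ : \sum_(1 <= j < h.+1) _ =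
    \sum_(1 <= j < h.+1) cos (2 * j%:R * (pi * r%:R / l%:R))); last first.
  apply: eq_bigr => j _.
  rewrite -[RHS](cosD2pi_nat _ (j * (d %/ l))) natrM; congr cos.
  rewrite [in LHS](divn_eq d l) natrD natrM -/r; field.
  by rewrite l0.
case: ifPn => [/eqP r0|rn0].
  rewrite /r r0 (eq_bigr (fun=> 1)); last by move=> j _; rewrite mulr0 mul0r mulr0 cos0.
  by rewrite sumr_const_nat subn1 /= /l natr_doubleS; ring.
have rl : (r < l)%N by rewrite ltn_mod.
have r0 : (0 < r)%N by rewrite lt0n.
have s0 : sin (pi * r%:R / l%:R) != 0 :> R.
  apply: lt0r_neq0; apply: sin_gt0_pi; apply/andP; split.
    by rewrite divr_gt0 ?mulr_gt0 ?pi_gt0 ?ltr0n.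
  by rewrite ltr_pdivrMr ?ltr0n// ltr_pM2l ?pi_gt0// ltr_nat.
apply: (mulfI s0); rewrite dirichlet_kernel mulr0 -/l.
by rewrite mulrCA divff// mulr1 mulrC sin_natpi.
Qed.

(** Averaging over the [2N+1] angles [2 pi j / l] replaces the integral. Frequencies differ by less
    than [N < l], so nothing aliases and the orthogonality is exact. *)
Lemma mean_square_le N (x : nat -> R) (E : R) :
  (forall u : R, (\sum_(m < N) x m * cos (m%:R * u)) ^+ 2 +
     (\sum_(m < N) x m * sin (m%:R * u)) ^+ 2 <= E) ->
  \sum_(m < N) x m ^+ 2 <= E.
Proof.
move=> HE; set l := N.*2.+1.
pose W (u : R) := (\sum_(m < N) x m * cos (m%:R * u)) ^+ 2 +
     (\sum_(m < N) x m * sin (m%:R * u)) ^+ 2.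
have WE u : W u = \sum_(m < N) \sum_(n < N) x m * x n * cos ((m%:R - n%:R) * u).
  rewrite /W !expr2 !mulr_suml -big_split; apply: eq_bigr => m _ /=.
  rewrite !mulr_sumr -big_split; apply: eq_bigr => n _ /=.
  by rewrite mulrBl cosB; ring.
have l0 : 0 < l%:R :> R by rewrite ltr0n.
rewrite -(ler_pM2l l0).
apply: (@le_trans _ _ (W 0 + 2 * \sum_(1 <= j < N.+1) W (2 * j%:R * (pi / l%:R)))); last first.
  have -> : l%:R * E = E + 2 * \sum_(1 <= j < N.+1) E.
    by rewrite sumr_const_nat subn1 /= /l natr_doubleS -mulr_natr; ring.
  by rewrite lerD ?HE// ler_pM2l// ler_sum// => j _; exact: HE.
rewrite le_eqVlt; apply/orP; left; apply/eqP.
under [X in _ = _ + 2 * X]eq_bigr do rewrite WE.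
rewrite WE.
rewrite [X in _ = _ + 2 * X]exchange_big /= [X in _ = _ + X]mulr_sumr -big_split mulr_sumr /=.
apply: eq_bigr => m _.
rewrite [X in _ = _ + 2 * X]exchange_big /= [X in _ = _ + X]mulr_sumr -big_split /=.
transitivity (\sum_(n < N) x m * x n * (if (n == m) then l%:R else 0)).
  by rewrite (bigD1 m)//= eqxx big1 ?addr0 => [|n /negbTE->]; rewrite ?mulr0//; ring.
apply: eq_bigr => n _; rewrite mulr0 cos0 -mulr_sumr.
have -> : \sum_(1 <= j < N.+1) cos ((m%:R - n%:R) * (2 * j%:R * (pi / l%:R))) =
   \sum_(1 <= j < N.+1) cos (2 * j%:R * (pi * (`|m - n|%N)%:R / l%:R)) :> R.
  apply: eq_bigr => j _.
  have [mn|/ltnW mn] := leqP n m.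
    by rewrite distnEl// natrB//; congr cos; ring.
  by rewrite distnEr// natrB// -cosN; congr cos; ring.
rewrite [RHS](_ : _ = x m * x n * (1 + 2 * \sum_(1 <= j < N.+1)
   cos (2 * j%:R * (pi * (`|m - n|%N)%:R / l%:R)))); last by ring.
rewrite cos_sum_odd; congr (_ * _).
have -> : (n == m) = (l %| `|m - n|)%N; last by [].
have mN := ltn_ord m; have nN := ltn_ord n.
apply/eqP/idP => [->|]; first by rewrite distnn dvdn0.
move=> /dvdnP[[|q] H].
  by apply/val_inj => /=; move: H; lia.
by move: H; rewrite /l; lia.
Qed.

End TrigonometricSums.

Lemma sum_triangle (V : nmodType) N (f : nat -> nat -> V) :
  \sum_(i < N) \sum_(j < N | (i + j < N)%N) f i j =
  \sum_(k < N) \sum_(i < k.+1) f i (k - i)%N.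
Proof.
transitivity (\sum_(i < N) \sum_(j < N - i) f i j).
  apply: eq_bigr => i _; rewrite (big_ord_widen N (f i)) ?leq_subr//.
  by apply: eq_bigl => j; lia.
elim: N => [|N IH]; first by rewrite !big_ord0.
rewrite [RHS]big_ord_recr /= -IH big_ord_recr /= subSnn big_ord1.
rewrite [X in _ = _ + X]big_ord_recr /= subnn addrA -big_split /=; congr (_ + _).
by apply: eq_bigr => i _; rewrite subSn 1?ltnW// big_ord_recr.
Qed.

(** * Polynomial growth of the coefficients *)

Section SqrtThetaGrowth.
Context {R : realType}.
Import Normc.
Local Notation c := (@c_half R).

(** At the midpoint [s] between [r] and 1 the terms are bounded, which leaves a geometric series of
    ratio [r / s]. *)
Lemma c_half_summable (r : R) : 0 <= r -> r < 1 ->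
  abs_summable (fun i => c i * r ^+ i).
Proof.
move=> r0 r1; pose s := (r + 1) / 2.
have [rs s0 s1] : [/\ r < s, 0 < s & s < 1] by rewrite /s; split; lra.
have [|K HK] := @growth_of_recurrence R c _ s s0 s1.
  by move=> i; have [L [L0 LB Li]] := @c_half_rec R i; exists L; split => //; exact: Li.
apply: (@abs_summable_le R _ (fun i => (r / s) ^+ i) K); last first.
  apply: abs_summable_geo; first by rewrite divr_ge0// ltW.
  by rewrite ltr_pdivrMr// mul1r.
move=> i; rewrite normrM (ger0_norm (exprn_ge0 _ r0)).
rewrite (ger0_norm (_ : 0 <= (r / s) ^+ i)); last by rewrite exprn_ge0// divr_ge0// ltW.
have -> : r ^+ i = s ^+ i * (r / s) ^+ i by rewrite -exprMn mulrC divfK// gt_eqF.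
by rewrite mulrA ler_wpM2r// exprn_ge0// divr_ge0// ltW.
Qed.

Lemma normc_sum I (s : seq I) (P : pred I) (f : I -> R[i]) :
  normc (\sum_(i <- s | P i) f i) <= \sum_(i <- s | P i) normc (f i).
Proof.
elim/big_ind2: _ => [|x y u v h h'|//]; first by rewrite normc0.
by rewrite (le_trans (le_normcD _ _))// lerD.
Qed.

Lemma realcM (a b : R) : (a * b)%:C = a%:C * b%:C.
Proof. exact: rmorphM. Qed.

Lemma normc_real (x : R) : normc x%:C = `|x|.
Proof. by rewrite /= expr0n /= addr0 sqrtr_sqr. Qed.

Lemma normc_ge0 (z : R[i]) : 0 <= normc z.
Proof. by case: z => a b; exact: sqrtr_ge0. Qed.

Lemma sqr_normc (z : R[i]) : normc z ^+ 2 = complex.Re z ^+ 2 + complex.Im z ^+ 2.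
Proof. by case: z => a b; rewrite /= sqr_sqrtr// addr_ge0// sqr_ge0. Qed.

Lemma theta_coef_ge0 k : 0 <= theta_coef k :> R.
Proof. by rewrite addr_ge0// mulr_ge0// sumr_ge0. Qed.

Lemma theta_coef_le k : theta_coef k <= 2 * k.+1%:R :> R.
Proof.
rewrite /theta_coef -[k.+1%:R]natr1 mulrDr mulr1 addrC lerD//.
  rewrite ler_pM2l//; apply: (@le_trans _ _ (\sum_(1 <= n < k.+1) 1)).
    by apply: ler_sum => n _; rewrite lern1; case: (_ == _).
  by rewrite sumr_const_nat subn1.
by case: (_ == _)%N; rewrite /=; lra.
Qed.

Lemma sum_theta_coef_le (r : R) N : 0 <= r -> r < 1 ->
  \sum_(k < N) theta_coef k * r ^+ k <= 2 / (1 - r) ^+ 2.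
Proof.
move=> r0 r1; have r1' : 0 < 1 - r by lra.
apply: (@le_trans _ _ (2 * \sum_(k < N) k.+1%:R * r ^+ k)).
  rewrite mulr_sumr; apply: ler_sum => k _.
  by rewrite mulrA ler_wpM2r ?exprn_ge0// theta_coef_le.
rewrite ler_pM2l// expr2 invfM ler_pdivlMr//.
apply: le_trans (sum_geo_le N r0 r1).
elim: N => [|N IH]; first by rewrite !big_ord0 mul0r.
suff H n : (\sum_(k < n) k.+1%:R * r ^+ k) * (1 - r) = \sum_(k < n) r ^+ k - n%:R * r ^+ n.
  by rewrite H lerBlDr lerDl mulr_ge0// exprn_ge0.
elim: n {IH} => [|n IH]; first by rewrite !big_ord0 mul0r mul0r subrr.
by rewrite !big_ord_recr /= mulrDl IH exprS -natr1; ring.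
Qed.

Let cis (u : R) : R[i] := cos u +i* sin u.

Let cisX u n : cis u ^+ n = cis (n%:R * u).
Proof.
elim: n => [|n IH]; first by rewrite mul0r /cis cos0 sin0.
rewrite exprSr IH -natr1 mulrDl mul1r /cis cosD sinD.
by apply/eqP; rewrite eq_complex /= eqxx /= addrC [sin _ * _]mulrC.
Qed.

Let normc_cis u : normc (cis u) = 1.
Proof. by rewrite /= cos2Dsin2 sqrtr1. Qed.

(* Parseval: [|sum c m z^m|^2] is the modulus of the theta series at [z], which
   is bounded on the circle [|z| = r]. *)
Lemma c_half_mean_square (r : R) M : 0 < r -> r < 1 ->
  \sum_(m < M) (c m * r ^+ m) ^+ 2 <= 2 / (1 - r) ^+ 2.
Proof.
move=> r0 r1; pose x m := c m * r ^+ m.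
have sx : abs_summable x by apply: c_half_summable => //; exact: ltW.
pose P N i j := (i + j < N)%N; pose k N := N./2.
pose D N := \sum_(i < N) \sum_(j < N | ~~ P N i j) `|x i| * `|x j|.
have D0 : D @ \oo --> 0.
  apply: (@sum_outside_region_cvg0 _ x x P k) => //.
  - by move=> N i j; rewrite /P /k; lia.
  - by move=> N; rewrite /k; lia.
  - apply/cvgnyPge => n; near=> N.
    have : (n.*2 <= N)%N by near: N; exact: nbhs_infty_ge.
    by rewrite /k; lia.
(* The left side grows with [N] while the error [D N] vanishes, so a bound with error for every [N]
   gives the exact bound for fixed [M]. *)
suff H N : \sum_(m < N) x m ^+ 2 <= 2 / (1 - r) ^+ 2 + D N.
  have h : (fun N => 2 / (1 - r) ^+ 2 + D N) @ \oo --> 2 / (1 - r) ^+ 2.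
    by rewrite -[X in _ --> X]addr0; apply: cvgD => //; exact: cvg_cst.
  rewrite -(cvg_lim (@Rhausdorff R) h); apply: limr_ge; first exact: cvgP h.
  near=> N; rewrite /=.
  apply: le_trans (H N).
  have MN : (M <= N)%N by near: N; exact: nbhs_infty_ge.
  rewrite (big_ord_widen N (fun m => (c m * r ^+ m) ^+ 2))// big_mkcond /=.
  by apply: ler_sum => i _; case: ifP => _ //; exact: sqr_ge0.
apply: mean_square_le => u; pose z := cis u.
pose S := \sum_(m < N) (x m)%:C * z ^+ m.
have -> : (\sum_(m < N) x m * cos (m%:R * u)) ^+ 2 +
     (\sum_(m < N) x m * sin (m%:R * u)) ^+ 2 = normc S ^+ 2.
  have -> : S = (\sum_(m < N) x m * cos (m%:R * u)) +i* (\sum_(m < N) x m * sin (m%:R * u)).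
    rewrite /S; elim/big_rec3: _ => //= i a b s _ ->.
    by rewrite /z cisX; apply/eqP; rewrite eq_complex /= !mul0r subr0 addr0 !eqxx.
  by rewrite sqr_normc.
rewrite expr2 -normcM.
(* The part of the square with [i + j < N] is a truncated theta series; the rest is bounded by [D N]
   uniformly in the angle. *)
have -> : S * S = \sum_(n < N) (theta_coef n * r ^+ n)%:C * z ^+ n +
   \sum_(i < N) \sum_(j < N | ~~ P N i j) (x i * x j)%:C * z ^+ (i + j).
  have -> : \sum_(n < N) (theta_coef n * r ^+ n)%:C * z ^+ n =
     \sum_(i < N) \sum_(j < N | P N i j) (x i * x j)%:C * z ^+ (i + j).
    rewrite /P (sum_triangle N (fun i j => (x i * x j)%:C * z ^+ (i + j))).
    apply: eq_bigr => n _; rewrite -c_half_conv !mulr_suml rmorph_sum mulr_suml.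
    apply: eq_bigr => i _; rewrite subnKC -1?ltnS//; congr (_%:C * _).
    by rewrite /x mulrACA -exprD subnKC// -ltnS.
  rewrite -big_split /S mulr_suml; apply: eq_bigr => i _ /=.
  rewrite mulr_sumr (bigID (fun j : 'I_N => P N i j)) /=.
  by congr (_ + _); apply: eq_bigr => j _; rewrite (realcM (x i)) exprD mulrACA.
apply: le_trans (le_normcD _ _) _; apply: lerD.
  apply: le_trans (sum_theta_coef_le N (ltW r0) r1).
  apply: le_trans (normc_sum _ _ _) _; apply: ler_sum => n _.
  rewrite normcM normc_real cisX normc_cis mulr1 ger0_norm//.
  by rewrite mulr_ge0 ?theta_coef_ge0// exprn_ge0// ltW.
apply: le_trans (normc_sum _ _ _) _; apply: ler_sum => i _.
apply: le_trans (normc_sum _ _ _) _; apply: ler_sum => j _.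
by rewrite normcM normc_real cisX normc_cis mulr1 normrM.
Unshelve. all: by end_near. Qed.

(** One term of the mean square is kept, at index [m+1] with [r = (m+1)/(m+2)]. Then
    [1 / (1 - r) = m+2], so [|c| r^(m+1) <= 2 (m+2)], and [r^(m+1) >= 1/e >= 1/4] yields the
    constant 8. *)
Lemma c_half_bound m : `|c m| <= 8 * m.+1%:R.
Proof.
case: m => [|m]; first by rewrite c_half0 normr1; lra.
pose r : R := m.+1%:R / m.+2%:R.
have m2 : 0 < m.+2%:R :> R by rewrite ltr0n.
have r0 : 0 < r by rewrite divr_gt0.
have r1 : r < 1 by rewrite ltr_pdivrMr// mul1r ltr_nat.
have := @c_half_mean_square r m.+2 r0 r1.
rewrite big_ord_recr /= => H.
have {H} : (c m.+1 * r ^+ m.+1) ^+ 2 <= 2 / (1 - r) ^+ 2.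
  by apply: le_trans H; rewrite lerDr sumr_ge0// => i _; exact: sqr_ge0.
have -> : 1 - r = m.+2%:R^-1.
  have m2n : m.+2%:R != 0 :> R by rewrite pnatr_eq0.
  apply: (mulIf m2n); rewrite mulrBl mul1r divfK// mulVf//.
  by rewrite -[m.+2%:R]natr1 addrC addKr.
rewrite exprVn invrK => H.
have H2 : `|c m.+1| * r ^+ m.+1 <= 2 * m.+2%:R.
  rewrite -(@ler_pXn2r _ 2)// ?nnegrE ?mulr_ge0 ?exprn_ge0 ?(ltW r0)//.
  have -> : (`|c m.+1| * r ^+ m.+1) ^+ 2 = (c m.+1 * r ^+ m.+1) ^+ 2.
    by rewrite !exprMn real_normK// num_real.
  by apply: le_trans H _; rewrite exprMn; nra.
have rm : 4^-1 <= r ^+ m.+1.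
  have : r ^+ m.+1 = (expR (- (m.+1%:R * ln (r^-1)))).
    by rewrite -mulrN expRM_natl -lnV ?posrE ?invr_gt0// invrK lnK.
  move=> ->; rewrite expRN lef_pV2 ?posrE ?expR_gt0//.
  apply: le_trans (_ : expR 1 <= _).
    rewrite ler_expR.
    have : ln r^-1 <= m.+1%:R^-1.
      have -> : r^-1 = 1 + m.+1%:R^-1.
        by rewrite /r invf_div -natr1 mulrDl divff ?pnatr_eq0// mul1r.
      by apply: le_ln1Dx; rewrite (@lt_trans _ _ 0)// ?ltrN10// invr_gt0.
    by rewrite -(ler_pM2l (_ : 0 < m.+1%:R)) ?ltr0n// divff.
  have -> : (1 : R) = 2^-1 + 2^-1 by lra.
  (* The bound [e <= 4] is obtained by squaring this one, which is [exp(-1/2) >= 1 - 1/2]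
     inverted. *)
  have h : expR (2^-1) <= 2 :> R.
    rewrite -[leRHS]invrK -[expR _]invrK lef_pV2 ?posrE ?invr_gt0 ?expR_gt0//.
    by rewrite -expRN; apply: le_trans (expR_ge1Dx _); lra.
  rewrite expRD (le_trans (ler_pM (expR_ge0 _) (expR_ge0 _) h h))//; lra.
have : 4^-1 * `|c m.+1| <= 2 * m.+2%:R.
  by apply: le_trans H2; rewrite mulrC ler_wpM2l.
lra.
Qed.

End SqrtThetaGrowth.

(** * Theta inversion *)

Section ThetaSeries.
Context {R : realType}.
Implicit Types (x : R).

Definition theta_term x n : R := expR (- pi * n.+1%:R ^+ 2 * x).

Lemma expR_nat_le x n : 0 < x -> expR (- x * n.+1%:R ^+ 2) <= expR (- x) ^+ n.
Proof.
move=> x0; rewrite -expRM_natl ler_expR mulrN mulNr lerN2 mulrC ler_pM2l// -natrX ler_nat.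
by rewrite -mulnn; nia.
Qed.

Lemma expR_sqr_summable x : 0 < x -> abs_summable (fun n => expR (- x * n.+1%:R ^+ 2)).
Proof.
move=> x0; apply: (@abs_summable_le R _ (fun n => expR (- x) ^+ n) 1); last first.
  by apply: abs_summable_geo; rewrite ?expR_ge0// expR_lt1 oppr_lt0.
move=> n; rewrite mul1r !ger0_norm ?exprn_ge0 ?expR_ge0//; exact: expR_nat_le.
Qed.

Lemma theta_termE x : theta_term x = (fun n => expR (- (pi * x) * n.+1%:R ^+ 2)).
Proof. by apply/funext => n; rewrite /theta_term; congr expR; ring. Qed.

Lemma theta_term_summable x : 0 < x -> abs_summable (theta_term x).
Proof.
by move=> x0; rewrite theta_termE; apply: expR_sqr_summable; rewrite mulr_gt0// pi_gt0.
Qed.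

Lemma thetaE x : 0 < x -> theta x = 1 + 2 * limn (series (theta_term x)).
Proof.
move=> x0; rewrite /theta; set F := fun n : int => _.
have F0 n : (0 <= F n)%E by rewrite lee_fin expR_ge0.
have cvT := abs_summable_cvg (theta_term_summable x0).
have sumT : (\sum_(i <oo) (theta_term x i)%:E = (limn (series (theta_term x)))%:E)%E.
  rewrite -EFin_lim//; apply: congr_lim; apply/funext => n /=.
  by rewrite /series /= sumEFin.
(* The integers are split by constructor: [Negz i] is [-(i+1)], so it matches [theta_term x i]
   directly, while [Posz] loses its term at 0, the constant 1. *)
rewrite (esumID (range Posz))// !setTI.
have -> : ~` range Posz = range Negz.
  apply/seteqP; split => [[n|n] nz|_ [n _ <-] [m _ //]]; last by exists n.
  by case: nz; exists n.
rewrite !esum_image; [|by move=> ? ? _ _ []|by move=> ? ? _ _ []].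
rewrite -!nneseries_esumT//.
have -> : (\sum_(i <oo) F (Negz i) = \sum_(i <oo) (theta_term x i)%:E)%E.
  apply: eq_eseriesr => i _; rewrite /F /theta_term NegzE mulrNz sqrrN.
  by congr (expR (_ * _ ^+ 2 * _))%:E.
rewrite nneseries_recl//.
have -> : (\sum_(1 <= k <oo) F (Posz k) = \sum_(i <oo) (theta_term x i)%:E)%E.
  rewrite -(@nneseries_addn _ (fun i => F (Posz i)) 1)//.
  by apply: eq_eseriesr => i _; rewrite /F /theta_term addn1.
rewrite sumT /F mulr0z expr0n /= mulr0 mul0r expR0; ring.
Qed.

Lemma theta_ge1 x : 0 < x -> 1 <= theta x.
Proof.
move=> x0; rewrite thetaE// lerDl mulr_ge0//.
apply: limr_ge; first exact: abs_summable_cvg (theta_term_summable x0).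
by near=> N; apply: sumr_ge0 => i _; exact: expR_ge0.
Unshelve. all: by end_near. Qed.

End ThetaSeries.

(** * Tannery's theorem *)

Section Tannery.
Context {R : realType}.

(** Dominated convergence for sums whose length [m l] also grows. It serves both sides of Polya's
    identity and the power series of theta. *)
Lemma tannery (f : nat -> nat -> R) (F g : nat -> R) (m : nat -> nat) :
  abs_summable g -> m @ \oo --> \oo ->
  (\forall l \near \oo, forall k, `|f l k| <= g k) ->
  (forall k, f ^~ k @ \oo --> F k) ->
  (fun l => series (f l) (m l)) @ \oo --> limn (series F).
Proof.
move=> sg my fg fF.
have g0 k : 0 <= g k by have [l _ /(_ l (leqnn l) k)] := fg; apply: le_trans.
have Fg k : `|F k| <= g k.
  have h : (fun l => `|f l k|) @ \oo --> `|F k| by apply: cvg_norm; exact: fF.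
  rewrite -(cvg_lim (@Rhausdorff R) h); apply: limr_le; first exact: cvgP h.
  by near=> l; near: l; apply: filterS fg => l; apply.
have sF : abs_summable F.
  by apply: (@abs_summable_le R F g 1) => // k; rewrite mul1r (ger0_norm (g0 k)).
have cF : series F @ \oo --> limn (series F) by exact: abs_summable_cvg.
have cg : cvgn (series g) by exact: abs_summable_cvg.
have tail K l : (K <= l)%N -> forall u : nat -> R, (forall k, `|u k| <= g k) ->
    `|series u l - series u K| <= limn (series g) - series g K.
  move=> Kl u ug; rewrite sub_series_geq//.
  apply: (@le_trans _ _ (series g l - series g K)).
    rewrite [leRHS]sub_series_geq// (le_trans (ler_norm_sum _ _ _))//.
    by apply: ler_sum => k _; exact: ug.
  rewrite lerB//; apply: nondecreasing_cvgn_le => //.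
  by apply: nondecreasing_series => i _ _; exact: g0.
apply/cvgrPdist_le => eps eps0.
have e3 : 0 < eps / 3 by rewrite divr_gt0.
have [K HK] : exists K, limn (series g) - series g K <= eps / 3.
  have /cvgrPdist_le/(_ _ e3)[K _ /(_ K (leqnn K))] : series g @ \oo --> limn (series g) by [].
  by exists K; apply: le_trans (ler_norm _) _.
have hK : (fun l => series (f l) K) @ \oo --> series F K.
  elim: (K) => [|k IH].
    by rewrite /series /= big_geq//; under eq_fun do rewrite big_geq//; exact: cvg_cst.
  by rewrite seriesSr; under eq_fun do rewrite seriesSr; apply: cvgD => //; exact: fF.
near=> l.
have Kml : (K <= m l)%N by near: l; move/cvgnyPge: my; apply.
have flg : forall k, `|f l k| <= g k by near: l.
have h1 : `|series (f l) (m l) - series (f l) K| <= eps / 3.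
  by apply: le_trans HK; exact: tail.
have h2 : `|series F K - series (f l) K| <= eps / 3.
  by near: l; move/cvgrPdist_le: hK; apply.
have h3 : `|limn (series F) - series F K| <= eps / 3.
  apply: le_trans HK.
  have h : (fun n => `|series F n - series F K|) @ \oo --> `|limn (series F) - series F K|.
    by apply: cvg_norm; apply: cvgB => //; exact: cvg_cst.
  rewrite -(cvg_lim (@Rhausdorff R) h); apply: limr_le; first exact: cvgP h.
  by near=> n; apply: tail => //; near: n; exact: nbhs_infty_ge.
have -> : limn (series F) - series (f l) (m l) = (limn (series F) - series F K)
  + (series F K - series (f l) K) - (series (f l) (m l) - series (f l) K) by ring.
rewrite (le_trans (ler_normB _ _))// (le_trans (lerD (ler_normD _ _) (lexx _)))//.
by move: h1 h2 h3; lra.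
Unshelve. all: by end_near. Qed.

End Tannery.

(** * Powers of the cosine and central binomial coefficients *)

Section CentralBinomial.
Context {R : realType}.
Implicit Types (m j k n : nat).

(** The real form of expanding [(e^(iu) + e^(-iu))^n]; multiplying by [2 cos u] shifts frequencies
    by one either way, which is Pascal's rule. *)
Lemma cos_pow n (u : R) :
  (2 * cos u) ^+ n = \sum_(i < n.+1) 'C(n, i)%:R * cos ((n%:R - 2 * i%:R) * u).
Proof.
elim: n => [|n IH].
  by rewrite big_ord1 bin0 mulr0 subrr mul0r cos0 mulr1.
rewrite exprS IH mulr_sumr.
pose f (i : nat) := cos ((n%:R - 1 - 2 * i%:R) * u).
have f0 : cos (n.+1%:R * u) = cos ((n%:R + 1) * u) by rewrite natr1.
transitivity (\sum_(i < n.+1) 'C(n, i)%:R * cos ((n.+1%:R - 2 * i%:R) * u)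
   + \sum_(i < n.+1) 'C(n, i)%:R * f i).
  rewrite -big_split; apply: eq_bigr => i _ /=.
  have -> : (n.+1%:R - 2 * i%:R) * u = (n%:R - 2 * i%:R) * u + u by rewrite -natr1; ring.
  have -> : f i = cos ((n%:R - 2 * i%:R) * u - u) by rewrite /f; congr cos; ring.
  by rewrite cosD cosB; ring.
rewrite [RHS]big_ord_recl [X in X + _ = _]big_ord_recl /= !bin0 mulr0 subr0 mul1r.
rewrite -addrA; congr (_ + _).
have -> : \sum_(i < n) 'C(n, bump 0 i)%:R * cos ((n.+1%:R - 2 * (bump 0 i)%:R) * u) =
   \sum_(i < n.+1) 'C(n, i.+1)%:R * f i.
  rewrite [RHS]big_ord_recr /= bin_small// mul0r addr0; apply: eq_bigr => i _.
  rewrite /bump add1n; congr (_ * cos _); rewrite -[n.+1%:R]natr1 -[i.+1%:R]natr1; ring.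
rewrite -big_split; apply: eq_bigr => i _ /=.
rewrite /bump add1n binS natrD mulrDl /f.
have -> : (n.+1%:R - 2 * i.+1%:R) * u = (n%:R - 1 - 2 * i%:R) * u.
  by rewrite -[n.+1%:R]natr1 -[i.+1%:R]natr1; ring.
by [].
Qed.

(** Normalised to 1 at the centre; for [j] of order [sqrt m] it is close to [exp(-j^2/m)], and this
    Gaussian shape produces the dual theta series. *)
Definition binr m j : R := 'C(m.*2, m + j)%:R / 'C(m.*2, m)%:R.

Lemma binr_small m j : (m < j)%N -> binr m j = 0.
Proof. by move=> mj; rewrite /binr bin_small ?mul0r//; lia. Qed.

Lemma central_gt0 m : 0 < 'C(m.*2, m)%:R :> R.
Proof. by rewrite ltr0n bin_gt0 -addnn leq_addr. Qed.

Lemma sum_multiples (g : nat -> R) l M :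
  \sum_(0 <= d < M * l.+1) (if (l.+1 %| d)%N then g d else 0) =
  \sum_(0 <= k < M) g (k * l.+1)%N.
Proof.
elim: M => [|M IH]; first by rewrite mul0n !big_geq.
rewrite [RHS]big_nat_recr// [LHS](@big_cat_nat _ _ _ (M * l.+1))//; last first.
  by rewrite mulSn leq_addl.
rewrite /= [X in X + _ = _]IH; congr (_ + _); rewrite big_ltn; last by rewrite mulSn addSn ltnS leq_addl.
rewrite dvdn_mull// big1_seq ?addr0// => d /andP[_].
rewrite mem_index_iota => /andP[d1 d2]; case: ifPn => // /dvdnP[q E].
by move: d1 d2; rewrite E !ltn_pmul2r// ltnS; lia.
Qed.

Lemma sum_symmetric (F : nat -> R) m k : (k <= m)%N ->
  \sum_(m - k <= i < (m + k).+1) F i =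
  F m + \sum_(1 <= d < k.+1) (F (m - d)%N + F (m + d)%N).
Proof.
elim: k => [|k IH] km; first by rewrite subn0 addn0 big_nat1 big_geq// addr0.
rewrite [in RHS]big_nat_recr// addrA -[X in _ = X + _]IH; last exact: ltnW.
rewrite addnS big_nat_recr /=; last by lia.
rewrite big_ltn; last by lia.
by rewrite subnSK//; ring.
Qed.

(* Averaging [cos^(2m)] over the multiples of [pi/l] keeps only the binomial
   coefficients at distance a multiple of [l] from the centre. *)
Lemma cos_pow_sum h m : let l := h.*2.+1 in
  1 + 2 * \sum_(1 <= j < h.+1) (cos (pi * j%:R / l%:R) ^+ 2) ^+ m =
  l%:R * ('C(m.*2, m)%:R / 4 ^+ m) * (1 + 2 * \sum_(1 <= k < m.+1) binr m (k * l)) :> R.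
Proof.
move=> l; have m4 : 4 ^+ m != 0 :> R by rewrite expf_neq0.
apply: (mulfI m4).
have pw (v : R) : 4 ^+ m * (v ^+ 2) ^+ m = (2 * v) ^+ m.*2.
  by rewrite -exprMn -[m.*2]mul2n exprM; congr (_ ^+ m); ring.
pose Cn i : R := 'C(m.*2, i)%:R.
have m4E : 4 ^+ m = \sum_(i < m.*2.+1) Cn i.
  have := pw (cos 0); rewrite cos_pow cos0 !expr1n mulr1 => ->.
  by apply: eq_bigr => i _; rewrite mulr0 cos0 mulr1.
have -> : 4 ^+ m * (1 + 2 * \sum_(1 <= j < h.+1) (cos (pi * j%:R / l%:R) ^+ 2) ^+ m) =
   \sum_(i < m.*2.+1) Cn i *
     (1 + 2 * \sum_(1 <= j < h.+1) cos (2 * j%:R * (pi * (`|m - i|%N)%:R / l%:R))).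
  rewrite mulrDr mulr1 mulrCA mulr_sumr {1}m4E.
  under [RHS]eq_bigr do rewrite mulrDr mulr1 mulrCA mulr_sumr.
  rewrite big_split /=; congr (_ + _).
  rewrite -[RHS]mulr_sumr [in RHS]exchange_big /=; congr (_ * _); apply: eq_bigr => j _.
  rewrite pw cos_pow; apply: eq_bigr => i _; congr (_ * _).
  rewrite (_ : m.*2%:R = 2 * m%:R); last by rewrite -mul2n natrM.
  have [im|/ltnW mi] := leqP i m.
    by rewrite distnEl// natrB//; congr cos; ring.
  by rewrite distnEr// natrB// -cosN; congr cos; ring.
under eq_bigr do rewrite cos_sum_odd.
rewrite -/l -(big_mkord xpredT (fun i => Cn i * if (l %| `|m - i|)%N then l%:R else 0)).
have := @sum_symmetric (fun i => Cn i * if (l %| `|m - i|)%N then l%:R else 0) m m (leqnn m).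
rewrite subnn addnn => ->; rewrite distnn dvdn0.
pose G d : R := if (l %| d)%N then Cn (m + d)%N else 0.
rewrite (eq_big_nat _ _ (F2 := fun d => 2 * l%:R * G d)); last first.
  move=> d /andP[d0 dm]; rewrite /G.
  have -> : (`|m - (m - d)| = d)%N by lia.
  have -> : (`|m - (m + d)| = d)%N by lia.
  have -> : Cn (m - d)%N = Cn (m + d)%N.
    rewrite /Cn -[in RHS]bin_sub; last by lia.
    by congr ('C(_, _))%:R; lia.
  by case: ifP => _; ring.
rewrite -mulr_sumr.
have C0 : Cn m != 0 by rewrite gt_eqF// central_gt0.
suff -> : \sum_(1 <= d < m.+1) G d = Cn m * \sum_(1 <= k < m.+1) binr m (k * l).
  by rewrite -/(Cn m); field.
have HH : Cn m * \sum_(1 <= k < m.+1) binr m (k * l) = \sum_(1 <= k < m.+1) Cn (m + k * l)%N.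
  by rewrite mulr_sumr; apply: eq_bigr => k _; rewrite /binr -/(Cn m) mulrC divfK.
rewrite HH; have := sum_multiples (fun d => Cn (m + d)%N) h.*2 m.+1; rewrite -/l.
rewrite [in X in _ = X -> _]big_ltn// mul0n.
(* The multiples were collected over a range reaching past [m], where the binomial coefficients
   vanish. *)
rewrite (@big_cat_nat _ _ _ m.+1) //=; last by rewrite /l; nia.
rewrite [X in _ + X]big1_seq ?addr0; last first.
  move=> d /andP[_]; rewrite mem_index_iota => /andP[md _]; case: ifP => // _.
  by rewrite /Cn bin_small//; lia.
by rewrite big_ltn// dvdn0 => /addrI.
Qed.

Lemma binr_ratio m j : (j < m)%N -> binr m j.+1 = binr m j * ((m - j)%:R / (m + j).+1%:R).
Proof.
move=> jm; rewrite /binr mulrAC; congr (_ / _).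
have n0 : (m + j).+1%:R != 0 :> R by rewrite pnatr_eq0.
apply: (mulIf n0); rewrite -!mulrA mulVf// mulr1 -!natrM; congr _%:R.
have := mul_bin_left m.*2 (m + j).
have -> : (m.*2 - (m + j))%N = (m - j)%N by lia.
by rewrite -addnS [LHS]mulnC => ->; rewrite mulnC.
Qed.

Lemma binr0 m : binr m 0 = 1.
Proof. by rewrite /binr addn0 divff// gt_eqF// central_gt0. Qed.

Lemma binr_ge0 m j : 0 <= binr m j. Proof. by rewrite divr_ge0. Qed.

(** Successive ratios are [1 - (2i+1)/(m+i+1) <= exp(-(2i+1)/(m+j))] for [i < j], and the odd
    numbers add up to [j^2]. The denominator is frozen at [m+j] so that the induction on [i] goes
    through. *)
Lemma binr_le m j : (j <= m)%N -> binr m j <= expR (- (j%:R ^+ 2 / (m + j)%:R)).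
Proof.
move=> jm; have [->|j0] := posnP j.
  by rewrite binr0 expr0n /= mul0r oppr0 expR0.
have mj0 : 0 < (m + j)%:R :> R by rewrite ltr0n; lia.
suff h i : (i <= j)%N -> binr m i <= expR (- (i%:R ^+ 2 / (m + j)%:R)) by exact: h.
elim: i => [|i IH] ij; first by rewrite binr0 expr0n /= mul0r oppr0 expR0.
rewrite binr_ratio; last by lia.
have -> : - (i.+1%:R ^+ 2 / (m + j)%:R) =
   - (i%:R ^+ 2 / (m + j)%:R) + - ((2 * i%:R + 1) / (m + j)%:R) :> R.
  by rewrite -natr1; ring.
rewrite expRD ler_pM ?binr_ge0 ?divr_ge0//; first by apply: IH; lia.
have mi0 : 0 < (m + i).+1%:R :> R by rewrite ltr0n.
apply: (@le_trans _ _ (1 + - ((2 * i%:R + 1) / (m + i).+1%:R))).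
  rewrite natrB; last by lia.
  rewrite le_eqVlt; apply/orP; left; apply/eqP.
  rewrite -natr1 natrD; field; rewrite -natrD natr1; exact: lt0r_neq0.
apply: le_trans (expR_ge1Dx _) _; rewrite ler_expR lerN2.
by rewrite ler_wpM2l// ?addr_ge0// lef_pV2 ?posrE// ler_nat; lia.
Qed.

(** The inverse ratios are [1 + (2i+1)/(m-i) <= exp((2i+1)/(m-j))], so the odd numbers telescope as
    in the upper bound. *)
Lemma binr_ge m j : (j < m)%N -> expR (- (j%:R ^+ 2 / (m - j)%:R)) <= binr m j.
Proof.
move=> jm; have mj0 : 0 < (m - j)%:R :> R by rewrite ltr0n; lia.
suff h i : (i <= j)%N -> expR (- (i%:R ^+ 2 / (m - j)%:R)) <= binr m i by exact: h.
elim: i => [|i IH] ij; first by rewrite binr0 expr0n /= mul0r oppr0 expR0.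
rewrite binr_ratio; last by lia.
have -> : - (i.+1%:R ^+ 2 / (m - j)%:R) =
   - (i%:R ^+ 2 / (m - j)%:R) + - ((2 * i%:R + 1) / (m - j)%:R) :> R.
  by rewrite -natr1; ring.
rewrite expRD ler_pM ?expR_ge0//; first by apply: IH; lia.
have mi0 : 0 < (m - i)%:R :> R by rewrite ltr0n; lia.
rewrite expRN -[leRHS]invrK lef_pV2 ?posrE ?expR_gt0 ?invr_gt0 ?divr_gt0//.
rewrite invf_div.
apply: (@le_trans _ _ (1 + (2 * i%:R + 1) / (m - i)%:R)).
  rewrite le_eqVlt; apply/orP; left; apply/eqP.
  have -> : (m + i).+1%:R = (m - i)%:R + (2 * i%:R + 1) :> R.
    by rewrite -natr1 natrB 1?natrD; [ring|lia].
  by rewrite mulrDl divff// gt_eqF.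
apply: le_trans (expR_ge1Dx _) _; rewrite ler_expR.
by rewrite ler_wpM2l// ?addr_ge0// lef_pV2 ?posrE// ler_nat; lia.
Qed.

End CentralBinomial.

(** * Bounds for sine and cosine *)

Section TrigonometricBounds.
Context {R : realType}.

Lemma sin_le_id (u : R) : 0 <= u -> sin u <= u.
Proof.
rewrite le_eqVlt => /predU1P[<-|u0]; first by rewrite sin0.
have cs : {within `[0, u], continuous (@sin R)}.
  by apply: continuous_subspaceT => x; exact: continuous_sin.
have [c _] := @MVT R (@sin R) (@cos R) 0 u u0 (fun x _ => is_derive_sin x) cs.
by rewrite sin0 !subr0 => ->; rewrite -[leRHS]mul1r ler_wpM2r ?(ltW u0)// cos_le1.
Qed.

Lemma sin_ge_cos (u : R) : 0 <= u -> u <= pi / 2 -> u * cos u <= sin u.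
Proof.
rewrite le_eqVlt => /predU1P[<-|u0] upi; first by rewrite sin0 mul0r.
have cs : {within `[0, u], continuous (@sin R)}.
  by apply: continuous_subspaceT => x; exact: continuous_sin.
have [c] := @MVT R (@sin R) (@cos R) 0 u u0 (fun x _ => is_derive_sin x) cs.
rewrite in_itv /= => /andP[c0 cu]; rewrite sin0 !subr0 mulrC => ->.
rewrite ler_wpM2l ?(ltW u0)//; have pi0 := @pi_gt0 R.
apply: ltW; rewrite ltr_cos ?in_itv//=; lra.
Qed.

Lemma cos_ge_sqr (u : R) : 0 <= u -> 1 - u ^+ 2 / 2 <= cos u.
Proof.
move=> u0; pose v := u / 2; have v0 : 0 <= v by rewrite divr_ge0.
have uv : u = v *+ 2 by rewrite mulr2n /v; lra.
have -> : cos u = 1 - 2 * sin v ^+ 2 by rewrite uv cos_mulr2n cos2sin2 mulr2n; ring.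
have -> : u ^+ 2 / 2 = 2 * v ^+ 2 by rewrite /v; field.
rewrite lerD2l lerN2 ler_pM2l//.
have [v1|v1] := leP v (pi / 2).
  have s0 : 0 <= sin v by apply: sin_ge0_pi; have := @pi_gt0 R; lra.
  by rewrite lerXn2r ?nnegrE// sin_le_id.
have : sin v ^+ 2 <= 1 by rewrite sin2cos2 lerBlDr lerDl sqr_ge0.
by have := @pi_ge2 R; move: (sin v) => s; nra.
Qed.

(** A weak form of Jordan's inequality; it serves for domination, where any positive constant would
    do. *)
Lemma sin_ge_quarter (u : R) : 0 <= u -> u <= pi / 2 -> u / 4 <= sin u.
Proof.
move=> u0 upi; have [u1|u1] := leP u 1.
  apply: le_trans (sin_ge_cos u0 upi).
  have := cos_ge_sqr u0; nra.
have h1 : sin 1 <= sin u :> R.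
  have := @pihalf_ge1 R => p1.
  by rewrite le_eqVlt; apply/orP; right; rewrite ltr_sin ?in_itv//=; lra.
have h2 : 1 / 2 <= sin 1 :> R.
  apply: le_trans (sin_ge_cos ler01 (@pihalf_ge1 R)).
  by have := cos_ge_sqr (@ler01 R); lra.
have := @pihalf_lt2 R; lra.
Qed.

Lemma sin_ge0_pihalf (u : R) : 0 <= u -> u <= pi / 2 -> 0 <= sin u.
Proof. by move=> u0 upi; apply: sin_ge0_pi; have := @pi_gt0 R; lra. Qed.

Lemma cos_gt0_pos_pihalf (u : R) : 0 < u -> u < pi / 2 -> 0 < cos u.
Proof. by move=> u0 upi; apply: cos_gt0_pihalf; have := @pi_gt0 R; lra. Qed.

Lemma cos2_le (u : R) m : cos u ^+ 2 ^+ m <= expR (- (m%:R * sin u ^+ 2)).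
Proof.
rewrite -mulrN expRM_natl; apply: lerXn2r; rewrite ?nnegrE ?sqr_ge0 ?expR_ge0//.
by rewrite cos2sin2; exact: expR_ge1Dx.
Qed.

(** This is [1 / cos^2 = 1 + tan^2 <= exp(tan^2)], the counterpart of [1 - sin^2 <= exp(-sin^2)]. *)
Lemma cos2_ge (u : R) m : 0 < cos u ->
  expR (- (m%:R * (sin u ^+ 2 / cos u ^+ 2))) <= cos u ^+ 2 ^+ m.
Proof.
move=> c0; have c20 : 0 < cos u ^+ 2 by rewrite exprn_gt0.
rewrite -mulrN expRM_natl; apply: lerXn2r; rewrite ?nnegrE ?sqr_ge0 ?expR_ge0//.
rewrite expRN -[leRHS]invrK lef_pV2 ?posrE ?expR_gt0 ?invr_gt0//.
apply: le_trans (expR_ge1Dx _); rewrite le_eqVlt; apply/orP; left; apply/eqP.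
apply: (mulIf (lt0r_neq0 c20)); rewrite mulVf ?lt0r_neq0// mulrDl mul1r.
by rewrite divfK ?lt0r_neq0// cos2Dsin2.
Qed.

End TrigonometricBounds.

(** * The sequence of Wallis' product *)

Section ThetaFunctionalEquation.
Context {R : realType}.
Implicit Types (m h k : nat) (tau : R).

(** The prefactor of the averaged cosine powers, rescaled to be independent of [l]; by Wallis it
    tends to [pi^(-1/2)]. *)
Definition kappa m : R := Num.sqrt m%:R * ('C(m.*2, m)%:R / 4 ^+ m).

(** It comes down to [4 m (m+1) <= (2m+1)^2]. Monotonicity forces the limits along all sequences of
    indices tending to infinity to agree, which is how different values of [tau] get compared. *)
Lemma kappa_nondecreasing : nondecreasing_seq kappa.
Proof.
apply/nondecreasing_seqP => m; rewrite /kappa.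
have m10 : m.+1%:R != 0 :> R by rewrite pnatr_eq0.
have CE : 'C(m.+1.*2, m.+1)%:R = 'C(m.*2, m)%:R * (2 * (2 * m%:R + 1) / m.+1%:R) :> R.
  apply: (mulIf m10); rewrite mulrA divfK//.
  apply: (mulIf m10).
  have e1 := mul_bin_diag m.*2.+2 m; have e2 := mul_bin_down m.*2.+1 m.
  rewrite /= in e1 e2.
  have e3 : (m.*2.+1 - m = m.+1)%N by lia.
  rewrite e3 in e2.
  have E1 : m.+1%:R * 'C(m.+1.*2, m.+1)%:R = (2 * m.+1%:R) * 'C(m.*2.+1, m)%:R :> R.
    by rewrite -natrM doubleS -e1 natrM -doubleS -mul2n natrM.
  have E2 : (2 * m%:R + 1) * 'C(m.*2, m)%:R = m.+1%:R * 'C(m.*2.+1, m)%:R :> R.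
    by rewrite -natr_doubleS -!natrM e2.
  move: E1 E2; move: ('C(m.+1.*2, m.+1)%:R) ('C(m.*2.+1, m)%:R) ('C(m.*2, m)%:R) => a b c E1 E2.
  transitivity (m.+1%:R * (m.+1%:R * a)); first by ring.
  transitivity (2 * m.+1%:R * ((2 * m%:R + 1) * c)); last by ring.
  by rewrite E1 E2; ring.
set C : R := 'C(m.*2, m)%:R in CE *.
have C0 : 0 < C by exact: central_gt0.
have p0 : 0 < 4 ^+ m :> R by rewrite exprn_gt0.
rewrite -(@ler_pXn2r _ 2)// ?nnegrE ?mulr_ge0 ?sqrtr_ge0 ?divr_ge0 ?(ltW C0) ?(ltW p0) ?exprn_ge0//.
rewrite exprMn [leRHS]exprMn !sqr_sqrtr ?ler0n// CE [4 ^+ m.+1]exprS.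
have FE (a p b d : R) : d != 0 -> p != 0 ->
   d * (a * (2 * (2 * b + 1) / d) / (4 * p)) ^+ 2 =
   ((2 * b + 1) ^+ 2 / (4 * d)) * (a / p) ^+ 2.
  by move=> d0 p1; field; rewrite d0 p1.
rewrite FE ?gt_eqF//.
rewrite ler_wpM2r ?sqr_ge0//.
rewrite ler_pdivlMr ?mulr_gt0 ?ltr0n// -natr1.
by have := ler0n R m; nra.
Qed.

End ThetaFunctionalEquation.

(** * Polya's limit *)

Section ThetaInversion.
Context {R : realType}.
Implicit Types (tau : R) (h k : nat).

Definition polya_l h : R := h.*2.+1%:R.
(** At this scale [m (pi k / l)^2] tends to [pi^2 k^2 / tau] and [(k l)^2 / m] to [tau k^2]: the
    exponents of the two theta series. *)
Definition polya_m tau h : nat := Num.truncn (polya_l h ^+ 2 / tau).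
Definition polya_w tau h : R := (polya_m tau h)%:R / polya_l h ^+ 2.

Local Notation l := polya_l.
Local Notation q := (fun h : nat => (l h)^-1).

Lemma polya_l_gt0 h : 0 < l h. Proof. by rewrite ltr0n. Qed.
Lemma polya_l_ge1 h : 1 <= l h. Proof. by rewrite ler1n. Qed.
#[local] Hint Resolve polya_l_gt0 polya_l_ge1 : core.

Lemma cvgn_expR_comp (u : nat -> R) (a : R) :
  u @ \oo --> a -> (fun n => expR (u n)) @ \oo --> expR a.
Proof. by move=> ua; apply: (cvg_comp _ _ ua); exact: continuous_expR. Qed.

Lemma polya_q_cvg : q @ \oo --> 0.
Proof.
apply: (squeeze_cvgr _ (cvg_cst 0) (@cvg_harmonic R)); near=> h; apply/andP; split.
  by rewrite invr_ge0 ltW.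
by rewrite lef_pV2 ?posrE ?polya_l_gt0 ?ltr0n// ler_nat; lia.
Unshelve. all: by end_near. Qed.

Lemma polya_m_le tau h : 0 < tau -> (polya_m tau h)%:R <= l h ^+ 2 / tau.
Proof. by move=> tau0; rewrite truncn_le// divr_ge0 ?sqr_ge0// ltW. Qed.

Lemma polya_m_gt tau h : l h ^+ 2 / tau < (polya_m tau h).+1%:R.
Proof. by rewrite truncnS_gt. Qed.

Lemma polya_w_cvg tau : 0 < tau -> polya_w tau @ \oo --> tau^-1.
Proof.
move=> tau0.
apply: cvg_normrP polya_q_cvg => h.
have l2 : 0 < l h ^+ 2 by rewrite exprn_gt0.
have E : tau^-1 - polya_w tau h = (l h ^+ 2 / tau - (polya_m tau h)%:R) / l h ^+ 2.
  by rewrite /polya_w; field; rewrite !gt_eqF.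
rewrite E ger0_norm; last by rewrite divr_ge0 ?subr_ge0 ?polya_m_le// ltW.
apply: (@le_trans _ _ ((l h ^+ 2)^-1)).
  rewrite -[leRHS]mul1r ler_wpM2r ?invr_ge0 ?(ltW l2)//.
  by rewrite lerBlDl natr1 ltW// polya_m_gt.
by rewrite lef_pV2 ?posrE// expr2 ler_peMl// ltW.
Qed.

Lemma polya_m_cvg tau : 0 < tau -> polya_m tau @ \oo --> \oo.
Proof.
move=> tau0.
apply/cvgnyPge => n; near=> h.
have hh : (Num.truncn (tau * n%:R) < h)%N by near: h; exact: nbhs_infty_gt.
rewrite /polya_m truncn_ge_nat; last by rewrite divr_ge0 ?sqr_ge0// ltW.
rewrite ler_pdivlMr// mulrC; apply: (@le_trans _ _ h%:R).
  apply: ltW; apply: lt_le_trans (truncnS_gt _) _.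
  by rewrite ler_nat.
apply: (@le_trans _ _ (l h)); first by rewrite ler_nat; lia.
by rewrite expr2 ler_peMl// ltW.
Unshelve. all: by end_near. Qed.

Lemma polya_w_ge tau : 0 < tau -> \forall h \near \oo, (2 * tau)^-1 <= polya_w tau h.
Proof.
move=> tau0.
apply: (cvgr_ge _ (polya_w_cvg tau0)).
by rewrite ltf_pV2 ?posrE ?mulr_gt0//; move: tau0; lra.
Qed.

Definition polya_f tau h k : R :=
  if (k < h)%N then cos (pi * k.+1%:R / l h) ^+ 2 ^+ polya_m tau h else 0.
Definition polya_b tau h k : R := binr (polya_m tau h) (k.+1 * h.*2.+1).

Lemma polya_f_cvg tau : 0 < tau -> (fun h => series (polya_f tau h) h) @ \oo --> limn (series (theta_term (pi / tau))).
Proof.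
move=> tau0.
(* In the majorant, 32 is 2 times 16: [polya_w] is eventually at least half its limit [1/tau], and
   [sin u >= u/4] enters squared. *)
apply: (@tannery R (polya_f tau) (theta_term (pi / tau))
  (fun k => expR (- (pi ^+ 2 / (32 * tau)) * k.+1%:R ^+ 2)) id).
- apply: expR_sqr_summable; rewrite divr_gt0 ?exprn_gt0 ?pi_gt0//.
  by rewrite mulr_gt0.
- exact: cvg_id.
- near=> h => k.
  have wge : (2 * tau)^-1 <= polya_w tau h by near: h; exact: polya_w_ge.
  rewrite /polya_f; case: ifPn => kh; last by rewrite normr0 expR_ge0.
  rewrite ger0_norm; last by apply: exprn_ge0; exact: sqr_ge0.
  set u := pi * k.+1%:R / l h.
  have u0 : 0 <= u by rewrite divr_ge0 ?mulr_ge0 ?pi_ge0// ltW.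
  have u1 : u <= pi / 2.
    rewrite /u ler_pdivrMr// -mulrA ler_pM2l ?pi_gt0// mulrC ler_pdivlMr//.
    by rewrite -natrM ler_nat; lia.
  apply: le_trans (cos2_le _ _) _; rewrite ler_expR mulNr lerN2.
  apply: (@le_trans _ _ ((polya_m tau h)%:R * (u / 4) ^+ 2)); last first.
    have s0 : 0 <= sin u by exact: sin_ge0_pihalf.
    have su := sin_ge_quarter u0 u1.
    by rewrite ler_wpM2l// lerXn2r ?nnegrE// divr_ge0.
  have -> : (polya_m tau h)%:R * (u / 4) ^+ 2 = polya_w tau h * (pi ^+ 2 * k.+1%:R ^+ 2 / 16).
    by rewrite /u /polya_w; field; rewrite gt_eqF.
  have -> : pi ^+ 2 / (32 * tau) * k.+1%:R ^+ 2 = (2 * tau)^-1 * (pi ^+ 2 * k.+1%:R ^+ 2 / 16).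
    by field; rewrite gt_eqF.
  apply: ler_wpM2r => //; apply: divr_ge0 => //; apply: mulr_ge0; exact: sqr_ge0.
move=> k.
pose u h := pi * k.+1%:R / l h.
have u_cvg : u @ \oo --> 0.
  rewrite -(mulr0 (pi * k.+1%:R)).
  by apply: cvgM; [exact: cvg_cst|exact: polya_q_cvg].
have wc := polya_w_cvg tau0.
have c_cvg : (fun h => cos (u h) ^+ 2) @ \oo --> (1 : R).
  rewrite -(expr1n _ 2) -(@cos0 R).
  under eq_fun do rewrite expr2.
  rewrite expr2.
  by apply: cvgM; apply: (cvg_comp _ _ u_cvg); exact: continuous_cos.
pose P : R := pi ^+ 2 * k.+1%:R ^+ 2.
have T : theta_term (pi / tau) k = expR (- (tau^-1 * P)).
  by rewrite /theta_term /P; congr expR; field; rewrite gt_eqF.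
have wPc : (fun h => polya_w tau h * P) @ \oo --> tau^-1 * P.
  by apply: cvgM => //; exact: cvg_cst.
have up : (fun h => expR (- (polya_w tau h * P * cos (u h) ^+ 2))) @ \oo --> theta_term (pi / tau) k.
  rewrite T; apply: cvgn_expR_comp.
  by apply: cvgN; rewrite -[tau^-1 * P]mulr1; exact: cvgM.
have dn : (fun h => expR (- (polya_w tau h * P / cos (u h) ^+ 2))) @ \oo --> theta_term (pi / tau) k.
  rewrite T; apply: cvgn_expR_comp.
  have c'_cvg : (fun h => (cos (u h) ^+ 2)^-1) @ \oo --> (1 : R)^-1.
    by apply: cvgV => //; exact: oner_neq0.
  by apply: cvgN; rewrite -[tau^-1 * P]mulr1 -[X in _ * X]invr1; exact: cvgM.
(* With [m u^2 = w P], the inequalities [u cos u <= sin u <= u] leave two exponents that differ from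
   [w P] by factors [cos^2 u] and [1 / cos^2 u], both tending to 1. *)
apply: (squeeze_cvgr _ dn up); near=> h.
rewrite /polya_f ifT; last by near: h; exact: nbhs_infty_gt.
have kh : (k < h)%N by near: h; exact: nbhs_infty_gt.
rewrite -/(u h).
have u0 : 0 < u h by rewrite divr_gt0 ?mulr_gt0 ?pi_gt0 ?ltr0n.
have u1 : u h < pi / 2.
  rewrite /u ltr_pdivrMr// -mulrA ltr_pM2l ?pi_gt0// mulrC ltr_pdivlMr//.
  by rewrite -natrM ltr_nat; lia.
have wP : polya_w tau h * P = (polya_m tau h)%:R * u h ^+ 2.
  by rewrite /u /polya_w /P; field; rewrite gt_eqF.
have c0 : 0 < cos (u h) by exact: cos_gt0_pos_pihalf.
have s0 : 0 <= sin (u h) by exact: (sin_ge0_pihalf (ltW u0) (ltW u1)).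
apply/andP; split.
  apply: le_trans (cos2_ge _ c0); rewrite ler_expR lerN2 wP -mulrA.
  rewrite ler_wpM2l// ler_pM2r ?invr_gt0 ?exprn_gt0//.
  by rewrite lerXn2r ?nnegrE ?(ltW u0)// sin_le_id// ltW.
apply: le_trans (cos2_le _ _) _; rewrite ler_expR lerN2 wP -mulrA.
have su := sin_ge_cos (ltW u0) (ltW u1).
by rewrite ler_wpM2l// -exprMn lerXn2r ?nnegrE// mulr_ge0// ltW.
Unshelve. all: by end_near. Qed.

Lemma polya_b_cvg tau : 0 < tau -> (fun h => series (polya_b tau h) (polya_m tau h)) @ \oo --> limn (series (theta_term (tau / pi))).
Proof.
move=> tau0.
(* For [J <= m] the exponent [J^2/(m+J)] is at least [J^2/(2m)], and [m <= l^2/tau] makes this at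
   least [tau (k+1)^2 / 2]. *)
apply: (@tannery R (polya_b tau) (theta_term (tau / pi))
  (fun k => expR (- (tau / 2) * k.+1%:R ^+ 2)) (polya_m tau)).
- by apply: expR_sqr_summable; rewrite divr_gt0.
- exact: (polya_m_cvg tau0).
- near=> h => k; rewrite ger0_norm ?binr_ge0// /polya_b.
  set J := (k.+1 * h.*2.+1)%N.
  have [mJ|Jm] := ltnP (polya_m tau h) J; first by rewrite binr_small// expR_ge0.
  apply: le_trans (binr_le Jm) _; rewrite ler_expR mulNr lerN2.
  have m0 : 0 < (polya_m tau h)%:R :> R by rewrite ltr0n (leq_trans _ Jm).
  apply: (@le_trans _ _ (J%:R ^+ 2 / (2 * (polya_m tau h)%:R))); last first.
    rewrite ler_wpM2l ?sqr_ge0// lef_pV2 ?posrE ?mulr_gt0//; last first.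
      by rewrite ltr0n addn_gt0 (leq_trans _ Jm).
    by rewrite -natrM ler_nat; lia.
  rewrite ler_pdivlMr ?mulr_gt0// /J natrM -/(l h).
  have := polya_m_le h tau0; rewrite ler_pdivlMr// => hm.
  rewrite exprMn [leLHS](_ : _ = k.+1%:R ^+ 2 * ((polya_m tau h)%:R * tau)); last by field.
  by rewrite ler_wpM2l ?sqr_ge0.
move=> k.
have wc := polya_w_cvg tau0.
(* Here [e = J / l^2], so that [J^2 / (m + J)] and [J^2 / (m - J)] become [(k+1)^2 / (w + e)] and
   [(k+1)^2 / (w - e)]. *)
pose e h : R := k.+1%:R * q h.
have e_cvg : e @ \oo --> 0.
  rewrite -(mulr0 (k.+1%:R : R)).
  by apply: cvgM; [exact: cvg_cst|exact: polya_q_cvg].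
have T : theta_term (tau / pi) k = expR (- (k.+1%:R ^+ 2 / tau^-1)).
  rewrite /theta_term invrK; congr expR; have := @pi_gt0 R.
  by move: (pi : R) (k.+1%:R : R) => p a p0; field; rewrite gt_eqF.
have ti0 : tau^-1 != 0 by rewrite invr_eq0 gt_eqF.
have up : (fun h => expR (- (k.+1%:R ^+ 2 / (polya_w tau h + e h)))) @ \oo --> theta_term (tau / pi) k.
  rewrite T; apply: cvgn_expR_comp.
  apply: cvgN; apply: cvgM; first exact: cvg_cst.
  by apply: cvgV => //; rewrite -[X in _ --> X]addr0; exact: cvgD.
have dn : (fun h => expR (- (k.+1%:R ^+ 2 / (polya_w tau h - e h)))) @ \oo --> theta_term (tau / pi) k.
  rewrite T; apply: cvgn_expR_comp.
  apply: cvgN; apply: cvgM; first exact: cvg_cst.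
  by apply: cvgV => //; rewrite -[X in _ --> X]subr0; exact: cvgB.
apply: (squeeze_cvgr _ dn up); near=> h.
have ew : e h < polya_w tau h.
  have : 0 < polya_w tau h - e h.
    near: h; apply: (cvgr_gt tau^-1); last by rewrite invr_gt0.
    by rewrite -[X in _ --> X]subr0; exact: cvgB.
  by rewrite subr_gt0.
rewrite /polya_b; set J := (k.+1 * h.*2.+1)%N.
have JE : J%:R = e h * l h ^+ 2.
  by rewrite /J natrM -/(l h) /e; field; rewrite gt_eqF.
have mE : (polya_m tau h)%:R = polya_w tau h * l h ^+ 2 by rewrite /polya_w divfK// gt_eqF// exprn_gt0.
have l20 : l h ^+ 2 != 0 by rewrite gt_eqF// exprn_gt0.
have l0 : l h != 0 by rewrite gt_eqF.
have Jm : (J < polya_m tau h)%N by rewrite -(ltr_nat R) JE mE ltr_pM2r// exprn_gt0.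
have w0 : 0 <= polya_w tau h by rewrite divr_ge0// sqr_ge0.
have e0 : 0 < e h by rewrite mulr_gt0 ?ltr0n// invr_gt0.
have JJ : J%:R ^+ 2 = k.+1%:R ^+ 2 * l h ^+ 2 by rewrite /J natrM -/(l h) exprMn.
apply/andP; split.
  apply: le_trans (binr_ge Jm); rewrite natrB 1?ltnW// JJ JE mE.
  rewrite -mulrBl le_eqVlt; apply/orP; left; apply/eqP; congr (expR (- _)).
  by rewrite -mulf_div divff// mulr1.
apply: le_trans (binr_le (ltnW Jm)) _; rewrite natrD JJ JE mE.
rewrite -mulrDl le_eqVlt; apply/orP; left; apply/eqP; congr (expR (- _)).
by rewrite -mulf_div divff// mulr1.
Unshelve. all: by end_near. Qed.

(** The averaged identity solved for its prefactor, using [sqrt m = l sqrt w]; the two remaining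
    sums tend to theta values. *)
Lemma kappa_cvg tau : 0 < tau -> (fun h => kappa (polya_m tau h)) @ \oo -->
  theta (pi / tau) / theta (tau / pi) / Num.sqrt tau.
Proof.
move=> tau0.
have pt : 0 < pi / tau by rewrite divr_gt0 ?pi_gt0.
have tp : 0 < tau / pi by rewrite divr_gt0 ?pi_gt0.
have L : (fun h => 1 + 2 * series (polya_f tau h) h) @ \oo --> theta (pi / tau).
  rewrite thetaE//; apply: cvgD; first exact: cvg_cst.
  by apply: cvgM; [exact: cvg_cst|exact: polya_f_cvg].
have B : (fun h => 1 + 2 * series (polya_b tau h) (polya_m tau h)) @ \oo --> theta (tau / pi).
  rewrite thetaE//; apply: cvgD; first exact: cvg_cst.
  by apply: cvgM; [exact: cvg_cst|exact: polya_b_cvg].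
have S : (fun h => Num.sqrt (polya_w tau h)) @ \oo --> (Num.sqrt tau)^-1.
  rewrite -sqrtrV ?(ltW tau0)//.
  by apply: (cvg_comp _ _ (polya_w_cvg tau0)); exact: sqrt_continuous.
rewrite (_ : (fun h => kappa (polya_m tau h)) = fun h =>
  (1 + 2 * series (polya_f tau h) h) / (1 + 2 * series (polya_b tau h) (polya_m tau h)) * Num.sqrt (polya_w tau h)).
  apply: cvgM => //; apply: cvgM => //; apply: cvgV => //.
  by rewrite gt_eqF// (lt_le_trans ltr01)// theta_ge1.
apply/funext => h.
have b0 : 0 < 1 + 2 * series (polya_b tau h) (polya_m tau h).
  by rewrite ltr_pwDl// mulr_ge0// sumr_ge0// => k _; exact: binr_ge0.
have E := @cos_pow_sum R h (polya_m tau h); rewrite /= -/(l h) in E.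
have -> : series (polya_f tau h) h = \sum_(1 <= j < h.+1) (cos (pi * j%:R / l h) ^+ 2) ^+ polya_m tau h.
  rewrite big_add1 /series /=; apply: eq_big_nat => k /andP[_ kh].
  by rewrite /polya_f kh.
rewrite E.
have -> : \sum_(1 <= k < (polya_m tau h).+1) binr (polya_m tau h) (k * h.*2.+1) = series (polya_b tau h) (polya_m tau h) :> R.
  by rewrite big_add1.
rewrite mulfK ?gt_eqF// /kappa /polya_w.
rewrite sqrtrM ?ler0n// sqrtrV ?sqr_ge0// sqrtr_sqr ger0_norm ?(ltW (polya_l_gt0 _))//.
move: (_ / 4 ^+ _) (Num.sqrt _) (l h) (polya_l_gt0 h) => C r d d0.
by field; rewrite gt_eqF.
Qed.

(** Together with [lim_le_kappa] this makes the limit the least upper bound of [kappa], an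
    expression in which [tau] no longer occurs. *)
Lemma kappa_le_lim tau k : 0 < tau -> kappa k <= theta (pi / tau) / theta (tau / pi) / Num.sqrt tau.
Proof.
move=> tau0.
rewrite -(cvg_lim (@Rhausdorff R) (kappa_cvg tau0)); apply: limr_ge.
  exact: cvgP (kappa_cvg tau0).
near=> h; apply: kappa_nondecreasing.
by near: h; move/cvgnyPge: (polya_m_cvg tau0); apply.
Unshelve. all: by end_near. Qed.

Lemma lim_le_kappa tau (B : R) : 0 < tau -> (forall k, kappa k <= B) ->
  theta (pi / tau) / theta (tau / pi) / Num.sqrt tau <= B.
Proof.
move=> tau0.
move=> kB; rewrite -(cvg_lim (@Rhausdorff R) (kappa_cvg tau0)); apply: limr_le.
  exact: cvgP (kappa_cvg tau0).
by near=> h; exact: kB.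
Unshelve. all: by end_near. Qed.

End ThetaInversion.

(* [kappa_cvg] gives one limit for all [tau], and the two theta values cancel
   at [tau = pi]; this replaces Wallis' formula. *)
Lemma theta_inversion {R : realType} (x : R) : 0 < x ->
  theta (x^-1) = Num.sqrt x * theta x.
Proof.
move=> x0; have p0 := @pi_gt0 R.
have xp : 0 < x * pi by rewrite mulr_gt0.
have h1 := lim_le_kappa xp (fun k => kappa_le_lim k p0).
have h2 := lim_le_kappa p0 (fun k => kappa_le_lim k xp).
have E : theta (pi / (x * pi)) / theta (x * pi / pi) / Num.sqrt (x * pi) =
   theta (pi / pi) / theta (pi / pi) / Num.sqrt (pi : R).
  by apply/eqP; rewrite eq_le h1 h2.
move: E; rewrite mulfK ?gt_eqF// invfM mulrCA divff ?gt_eqF// mulr1.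
have t0 y : 0 < y -> theta y != 0 :> R.
  by move=> y0; rewrite gt_eqF// (lt_le_trans ltr01)// theta_ge1.
rewrite divff ?t0// mul1r sqrtrM ?(ltW x0)// invfM mulrA.
have sp : (Num.sqrt (pi : R))^-1 != 0 by rewrite invr_eq0 gt_eqF// sqrtr_gt0.
move=> /(congr1 (fun z => z / (Num.sqrt (pi : R))^-1)); rewrite mulfK// divff//.
move=> /(congr1 (fun z => z * (Num.sqrt x * theta x))) E.
rewrite mul1r in E; rewrite -E.
by field; rewrite t0//= gt_eqF// sqrtr_gt0.
Qed.

(** * The square root of theta *)

Section SqrtThetaSeries.
Context {R : realType}.
Implicit Types (x q t : R).
Local Notation c := (@c_half R).

(** The shape [(m+3)^3] fits the generating series and its first two derivatives alike: the
    coefficients of the second are at most [8 (m+1)(m+2)(m+3)]. *)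
Lemma abs_summable_poly_geo (a : nat -> R) K q : 0 < q -> q < 1 ->
  (forall m : nat, `|a m| <= K * (m.+3)%:R ^+ 3) -> abs_summable (fun m => a m * q ^+ m).
Proof.
move=> q0 q1 aK; pose s := (q + 1) / 2.
have [qs s0 s1] : [/\ q < s, 0 < s & s < 1] by rewrite /s; split; lra.
have [C C0 HC] := powM_geo_le 3 q0 qs.
have K0 : 0 <= K.
  by have := aK 0%N; rewrite -(pmulr_lge0 _ (_ : 0 < 3%:R ^+ 3)) ?exprn_gt0//; apply: le_trans.
apply: (@abs_summable_le R _ (fun m => s ^+ m) (K * q ^- 3 * C * s ^+ 3)); last first.
  by apply: abs_summable_geo => //; exact: ltW.
move=> m; rewrite normrM !(ger0_norm (exprn_ge0 _ _)) ?(ltW q0) ?(ltW s0)//.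
have h := HC m.+3.
apply: (@le_trans _ _ (K * (m.+3)%:R ^+ 3 * q ^+ m)).
  by rewrite ler_wpM2r// exprn_ge0// ltW.
have -> : K * m.+3%:R ^+ 3 * q ^+ m = K * q ^- 3 * (m.+3%:R ^+ 3 * q ^+ m.+3).
  rewrite -[in q ^+ m.+3]addn3 exprD.
  have q3 : q ^+ 3 != 0 by rewrite gt_eqF// exprn_gt0.
  by move: (m.+3%:R ^+ 3) (q ^+ m) (q ^+ 3) q3 => a1 a2 a3 a30; field.
have -> : K * q ^- 3 * C * s ^+ 3 * s ^+ m = K * q ^- 3 * (C * s ^+ m.+3).
  by rewrite -[m.+3]addn3 exprD; ring.
by rewrite ler_wpM2l// mulr_ge0// invr_ge0 exprn_ge0// ltW.
Qed.

Definition c_half_gf q := limn (pseries c q).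
Local Notation C := c_half_gf.

(** Continuity is deduced from termwise differentiability, which asks the series and its first two
    formal derivatives to converge at some [K > q]. *)
Lemma c_half_pseries_continuous q : 0 <= q -> q < 1 -> {for q, continuous C}.
Proof.
move=> q0 q1; pose K := (q + 1) / 2.
have [qK K0 K1] : [/\ q < K, 0 < K & K < 1] by rewrite /K; split; lra.
have cb (m : nat) : `|c m| <= 8 * m.+1%:R by exact: c_half_bound.
have cv (a : nat -> R) B : (forall m : nat, `|a m| <= B * (m.+3)%:R ^+ 3) ->
    cvgn (pseries a K).
  by move=> aB; apply: abs_summable_cvg; exact: abs_summable_poly_geo aB.
have e1 (m : nat) : m.+1%:R <= m.+3%:R :> R by rewrite ler_nat; lia.
have e2 (m : nat) : m.+2%:R <= m.+3%:R :> R by rewrite ler_nat; lia.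
have e3 (m : nat) : 1 <= m.+3%:R :> R by rewrite ler1n.
have d1 : cvgn (pseries c K).
  apply: (cv _ 8) => m; apply: le_trans (cb m) _.
  have := e1 m; have := e3 m; move: (m.+1%:R) (m.+3%:R) => u v; nra.
have d2 : cvgn (pseries (pseries_diffs c) K).
  apply: (cv _ 8) => m; rewrite /pseries_diffs normrM normr_nat.
  apply: le_trans (ler_wpM2l (ler0n _ _) (cb m.+1)) _.
  have := ler0n R m.+1; have := ler0n R m.+2.
  have := e1 m; have := e2 m; have := e3 m.
  move: (m.+1%:R) (m.+2%:R) (m.+3%:R) => u v w w1 vw uw v0 u0.
  have h : u * v <= w * w by apply: ler_pM.
  have : w * w * 1 <= w * w * w by apply: ler_wpM2l => //; rewrite mulr_ge0//; lra.
  lra.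
have d3 : cvgn (pseries (pseries_diffs (pseries_diffs c)) K).
  apply: (cv _ 8) => m; rewrite /pseries_diffs !normrM !normr_nat.
  apply: le_trans (ler_wpM2l (ler0n _ _) (ler_wpM2l (ler0n _ _) (cb m.+2))) _.
  have := ler0n R m.+1; have := ler0n R m.+2.
  have := e1 m; have := e2 m; have := e3 m.
  move: (m.+1%:R) (m.+2%:R) (m.+3%:R) => u v w w1 vw uw v0 u0.
  have h : u * v <= w * w by apply: ler_pM.
  have : u * v * w <= w * w * w by apply: ler_wpM2r => //; lra.
  lra.
have qK' : `|q| < `|K| by rewrite !ger0_norm// ltW.
have [D _] := pseries_snd_diffs d1 d2 d3 qK'.
by apply: differentiable_continuous; exact/derivable1_diffP.
Qed.

Lemma sum_theta_coefE q N :
  \sum_(k < N.+1) theta_coef k * q ^+ k =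
  1 + 2 * \sum_(n < N.+1) (if (n.+1 ^ 2 < N.+1)%N then q ^+ (n.+1 ^ 2) else 0).
Proof.
transitivity (1 + 2 * \sum_(k < N.+1) \sum_(n < N.+1)
    (if (n.+1 ^ 2 == k)%N then q ^+ k else 0)).
  rewrite big_ord_recl /= {1}/theta_coef eqxx big_geq// mulr0 addr0 mul1r expr0.
  rewrite [in RHS]big_ord_recl /=; congr (_ + _).
  rewrite [X in 2 * (X + _)]big1 ?add0r//.
  rewrite mulr_sumr; apply: eq_bigr => k _; rewrite /bump add1n /theta_coef add0r.
  rewrite -mulrA mulr_suml; congr (_ * _).
  rewrite big_add1 /= (big_mkord xpredT (fun n => ((n.+1 ^ 2 == k.+1)%N)%:R * q ^+ k.+1)).
  rewrite (big_ord_widen N.+1 (fun n => ((n.+1 ^ 2 == k.+1)%N)%:R * q ^+ k.+1)) /=; last first.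
    by rewrite ltnS ltnW.
  rewrite big_mkcond /=; apply: eq_bigr => n _.
  case: ifPn => nk; first by case: eqP => _; rewrite ?mul1r ?mul0r.
  case: eqP => // E; exfalso; move: nk; rewrite -leqNgt.
  by move: E; rewrite -mulnn; move: (nat_of_ord n) => n'; nia.
congr (_ + _ * _); rewrite exchange_big /=; apply: eq_bigr => n _.
case: ifPn => nN.
  rewrite (bigD1 (Ordinal nN)) //= eqxx big1 ?addr0// => k kN.
  by case: eqP => // E; move: kN; rewrite -val_eqE /= E eqxx.
rewrite big1// => k _; case: eqP => // E.
by move: nN; rewrite E ltn_ord.
Qed.

Lemma theta_coef_series x : 0 < x ->
  (fun N => \sum_(k < N) theta_coef k * expR (- (pi * x)) ^+ k) @ \oo --> theta x.
Proof.
move=> x0; set q := expR _.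
have qE (n : nat) : q ^+ (n ^ 2) = expR (- pi * n%:R ^+ 2 * x).
  by rewrite /q -expRM_natl natrX; congr expR; ring.
rewrite -cvg_shiftS /=.
under eq_fun do rewrite sum_theta_coefE.
rewrite thetaE//; apply: cvgD; first exact: cvg_cst.
apply: cvgM; first exact: cvg_cst.
have := @tannery R (fun N n => if (n.+1 ^ 2 < N.+1)%N then q ^+ (n.+1 ^ 2) else 0)
  (theta_term x) (theta_term x) succn (theta_term_summable x0).
rewrite (_ : (fun l => series _ _) = (fun N => \sum_(n < N.+1)
   (if (n.+1 ^ 2 < N.+1)%N then q ^+ (n.+1 ^ 2) else 0))); last first.
  by apply/funext => N; rewrite /series /= big_mkord.
apply.
- apply/cvgnyPge => n; near=> N; apply: leqW; near: N; exact: nbhs_infty_ge.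
- near=> N => k; case: ifP => _; last by rewrite normr0 expR_ge0.
  by rewrite qE /theta_term ger0_norm ?expR_ge0.
- move=> k; apply: cvg_near_cst; near=> N; rewrite ifT ?qE//.
  by rewrite ltnS; near: N; exact: nbhs_infty_ge.
Unshelve. all: by end_near. Qed.

Lemma sqrt_theta_sqr x : 0 < x -> C (expR (- (pi * x))) ^+ 2 = theta x.
Proof.
move=> x0; set q := expR _.
have px : 0 < pi * x by rewrite mulr_gt0// pi_gt0.
have q0 : 0 <= q by exact: expR_ge0.
have q1 : q < 1 by rewrite expR_lt1 oppr_lt0.
have sc := c_half_summable q0 q1.
have cC : series (fun i => c i * q ^+ i) @ \oo --> C q by exact: abs_summable_cvg.
have := @sum_region_cvg R _ _ (fun N i j => (i + j < N)%N) (fun N => N./2) _ _ _ _ _ sc sc cC cC.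
move=> /(_ _ _ _)/cvg_lim h; rewrite expr2 -h//.
- apply/cvg_lim => //.
  have := theta_coef_series x0; rewrite -/q.
  apply: cvg_trans; apply: near_eq_cvg; near=> N.
  rewrite (sum_triangle N (fun i j => c i * q ^+ i * (c j * q ^+ j))).
  apply: eq_bigr => k _; rewrite -c_half_conv mulr_suml; apply: eq_bigr => i _.
  by rewrite mulrACA -exprD subnKC// -ltnS.
- by move=> N i j; lia.
- by move=> N; lia.
- apply/cvgnyPge => n; near=> N.
  have : (n.*2 <= N)%N by near: N; exact: nbhs_infty_ge.
  by lia.
Unshelve. all: by end_near. Qed.

End SqrtThetaSeries.

Section SqrtThetaKernel.
Context {R : realType}.
Implicit Types (x q t : R).
Local Notation c := (@c_half R).

(** The squared identity leaves the sign open. The generating function is 1 at 0 and continuous, and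
    its square is at least 1, so the intermediate value theorem excludes a negative value. *)
Lemma sqrt_thetaE x : 0 < x ->
  Num.sqrt (theta x) = c_half_gf (expR (- (pi * x))).
Proof.
move=> x0; rewrite -sqrt_theta_sqr// sqrtr_sqr; apply/ger0_norm.
set q := expR _; rewrite leNgt; apply/negP => Cq.
have px : 0 < pi * x by rewrite mulr_gt0// pi_gt0.
have q0 : 0 < q by exact: expR_gt0.
have q1 : q < 1 by rewrite expR_lt1 oppr_lt0.
have C0 : c_half_gf 0 = 1 :> R.
  rewrite /c_half_gf; apply/cvg_lim => //; apply: cvg_near_cst; near=> n.
  have n0 : (0 < n)%N by near: n; exact: nbhs_infty_gt.
  rewrite /pseries /series /= big_ltn// c_half0 expr0 mulr1 big1_seq ?addr0// => i /andP[_].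
  by rewrite mem_index_iota => /andP[i0 _]; rewrite expr0n gtn_eqF// mulr0.
have [| |r] := @IVT R (@c_half_gf R) 0 q 0 (ltW q0).
- apply: continuous_in_subspaceT => y /[!inE]/=; rewrite in_itv /= => /andP[y0 yq].
  by apply: c_half_pseries_continuous => //; exact: le_lt_trans q1.
- by rewrite C0 ge_min le_max ler01 (ltW Cq) orbT.
rewrite in_itv /= => /andP[r0 rq] Cr.
have [r00|rn0] := eqVneq r 0.
  by move: Cr; rewrite r00 C0 => /eqP; rewrite oner_eq0.
have r0' : 0 < r by rewrite lt_neqAle eq_sym rn0.
have y0 : 0 < - ln r / pi.
  by rewrite divr_gt0 ?pi_gt0// oppr_gt0 ln_lt0// r0' (le_lt_trans rq).
have := sqrt_theta_sqr y0; have -> : expR (- (pi * (- ln r / pi))) = r.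
  by rewrite mulrCA divff ?gt_eqF ?pi_gt0// mulr1 opprK lnK.
rewrite Cr expr0n /= => th0.
by have := theta_ge1 y0; rewrite -th0 ler10.
Unshelve. all: by end_near. Qed.

Definition sqrt_theta1 t := Num.sqrt (theta (t ^+ 2)) - 1 : R.
Local Notation A := sqrt_theta1.

Definition gaussq t : R := expR (- (pi * t ^+ 2)).
(** From [|c(m+1)| <= 8 (m+2) <= 16 (m+1)], then [sum (m+1) q^m <= (1-q)^(-2)] with [q = gaussq t],
    and [1/(1-q) <= 1 + 1/(pi t^2)]. *)
Definition majorant t : R := 16 * gaussq t * (1 + (pi * t ^+ 2)^-1) ^+ 2.

Lemma gaussq_lt1 t : 0 < t -> gaussq t < 1.
Proof. by move=> t0; rewrite expR_lt1 oppr_lt0 mulr_gt0 ?pi_gt0 ?exprn_gt0. Qed.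

Lemma sum_norm_le_majorant t N : 0 < t ->
  \sum_(m < N) `|c m.+1 * gaussq t ^+ m.+1| <= majorant t.
Proof.
move=> t0; set q := gaussq t.
have q0 : 0 < q by exact: expR_gt0.
have q1 : q < 1 by exact: gaussq_lt1.
have p0 : 0 < pi * t ^+ 2 by rewrite mulr_gt0 ?pi_gt0 ?exprn_gt0.
have H : \sum_(m < N) m.+1%:R * q ^+ m <= 1 / (1 - q) ^+ 2.
  have q1' : 0 < 1 - q by rewrite subr_gt0.
  rewrite expr2 invfM mulrA ler_pdivlMr// mul1r.
  apply: le_trans (sum_geo_le N (ltW q0) q1).
  have Hn n : (\sum_(k < n) k.+1%:R * q ^+ k) * (1 - q) = \sum_(k < n) q ^+ k - n%:R * q ^+ n.
    elim: n => [|n IH]; first by rewrite !big_ord0 mul0r mul0r subrr.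
    by rewrite !big_ord_recr /= mulrDl IH exprS -natr1; ring.
  by rewrite Hn lerBlDr lerDl mulr_ge0// exprn_ge0// ltW.
apply: (@le_trans _ _ (16 * q * \sum_(m < N) m.+1%:R * q ^+ m)).
  rewrite mulr_sumr; apply: ler_sum => m _.
  rewrite normrM (ger0_norm (exprn_ge0 _ (ltW q0))) exprS.
  have -> : 16 * q * (m.+1%:R * q ^+ m) = (16 * m.+1%:R) * (q * q ^+ m) by ring.
  rewrite ler_wpM2r ?mulr_ge0 ?exprn_ge0 ?(ltW q0)//.
  apply: le_trans (c_half_bound _) _.
  by rewrite -[m.+2%:R]natr1; have := ler0n R m; rewrite -[m.+1%:R]natr1; lra.
rewrite /majorant ler_wpM2l ?mulr_ge0 ?(ltW q0)//.
apply: le_trans H _; rewrite div1r -exprVn.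
have q1' : 0 < 1 - q by rewrite subr_gt0.
have p1 : 0 < 1 + (pi * t ^+ 2)^-1 by rewrite addr_gt0 ?invr_gt0.
suff K : (1 - q)^-1 <= 1 + (pi * t ^+ 2)^-1.
  by rewrite lerXn2r ?nnegrE ?invr_ge0 ?(ltW q1') ?(ltW p1).
rewrite -[leRHS]invrK lef_pV2 ?posrE ?invr_gt0//.
have -> : (1 + (pi * t ^+ 2)^-1)^-1 = 1 - (1 + pi * t ^+ 2)^-1.
  move: (pi * t ^+ 2) p0 => p p0; field; rewrite !gt_eqF//=; lra.
rewrite lerD2l lerN2 /q /gaussq expRN lef_pV2 ?posrE ?expR_gt0//; last by lra.
exact: expR_ge1Dx.
Qed.

Lemma sqrt_theta1_summable t : 0 < t ->
  abs_summable (fun m => c m.+1 * gaussq t ^+ m.+1).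
Proof. by move=> t0; exists (majorant t) => N; exact: sum_norm_le_majorant. Qed.

Lemma sqrt_theta1_series t : 0 < t ->
  series (fun m => c m.+1 * gaussq t ^+ m.+1) @ \oo --> A t.
Proof.
move=> t0; have s := abs_summable_cvg (c_half_summable (ltW (expR_gt0 _)) (gaussq_lt1 t0)).
have t20 : 0 < t ^+ 2 by rewrite exprn_gt0.
have h : series (fun m => c m * gaussq t ^+ m) @ \oo --> Num.sqrt (theta (t ^+ 2)).
  by rewrite sqrt_thetaE//; exact: s.
rewrite -cvg_shiftS in h.
rewrite /A (_ : series _ = (fun N => series (fun m => c m * gaussq t ^+ m) N.+1 - 1)).
  by apply: cvgB => //; exact: cvg_cst.
apply/funext => N; rewrite /series /= [in RHS]big_nat_recl//=.
by rewrite c_half0 expr0 mulr1 addrC addKr.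
Qed.

Lemma sqrt_theta1_ge0 t : 0 < t -> 0 <= A t.
Proof.
by move=> t0; rewrite subr_ge0 -[leLHS]sqrtr1 ler_wsqrtr// theta_ge1// exprn_gt0.
Qed.

Lemma sqrt_theta1_le t : 0 < t -> A t <= majorant t.
Proof.
move=> t0; have h := sqrt_theta1_series t0.
rewrite -(cvg_lim (@Rhausdorff R) h); apply: limr_le; first exact: cvgP h.
near=> N; rewrite /series /= big_mkord.
apply: le_trans (ler_norm _) _; apply: le_trans (ler_norm_sum _ _ _) _.
exact: sum_norm_le_majorant.
Unshelve. all: by end_near. Qed.

Lemma majorant_ge0 t : 0 <= majorant t.
Proof. by rewrite mulr_ge0 ?sqr_ge0// mulr_ge0// expR_ge0. Qed.

(** The power [t^4] compensates the singularity at 0; the remaining [t^(2k)] measures the decay at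
    infinity. *)
Lemma majorant_decay k : exists2 K, 0 < K &
  forall t, 0 < t -> majorant t * t ^+ (4 + k.*2) <= K.
Proof.
(* After bounding by [(1 + t^2)^(k+2) exp(-pi t^2)], the estimate [x^n <= n! exp x] at [x = 1 + t^2]
   leaves [(k+2)! e], because [pi >= 1]. *)
exists (16 * (k.+2`!%:R * expR 1)).
  by rewrite !mulr_gt0// ?ltr0n ?fact_gt0// expR_gt0.
move=> t t0; rewrite /majorant.
have t20 : 0 < t ^+ 2 by rewrite exprn_gt0.
have p1 : 1 <= pi :> R by have := @pi_ge2 R; lra.
have e0 : 0 < gaussq t by exact: expR_gt0.
set v := 1 + (pi * t ^+ 2)^-1; set T := t ^+ (4 + _).
have -> : 16 * gaussq t * v ^+ 2 * T = 16 * (gaussq t * (v ^+ 2 * T)) by ring.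
rewrite ler_pM2l// /v /T.
apply: (@le_trans _ _ (gaussq t * (1 + t ^+ 2) ^+ k.+2)).
  have -> : t ^+ (4 + k.*2) = (t ^+ 2) ^+ 2 * (t ^+ 2) ^+ k.
    by rewrite -!exprM -exprD; congr (_ ^+ _); lia.
  rewrite ler_pM2l// mulrA -exprMn.
  rewrite -[k.+2]add2n exprD; apply: ler_pM.
  - exact: sqr_ge0.
  - by rewrite exprn_ge0// ltW.
  - have p0 : 0 <= (pi * t ^+ 2)^-1 by rewrite invr_ge0 mulr_ge0 ?pi_ge0// ltW.
    apply: lerXn2r.
    + by rewrite nnegrE mulr_ge0 ?addr_ge0// ltW.
    + by rewrite nnegrE addr_ge0// ltW.
    rewrite mulrDl mul1r addrC lerD2r invfM -mulrA mulVf ?gt_eqF// mulr1.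
    by rewrite invf_le1// pi_gt0.
  - by rewrite lerXn2r ?nnegrE ?addr_ge0 ?(ltW t20)// lerDr.
rewrite mulrC /gaussq expRN ler_pdivrMr ?expR_gt0// -mulrA -expRD.
have h := expR_ge1Dxn k.+1 (_ : 0 <= 1 + t ^+ 2).
apply: (@le_trans _ _ (k.+2`!%:R * expR (1 + t ^+ 2))).
  rewrite -ler_pdivrMl ?ltr0n ?fact_gt0// mulrC.
  by apply: le_trans (h _); rewrite ?lerDr// addr_ge0// ltW.
by rewrite ler_pM2l ?ltr0n ?fact_gt0// ler_expR lerD2l ler_peMl// ltW.
Qed.

Lemma sqrt_theta_inversion t : 0 < t ->
  Num.sqrt (theta ((t^-1) ^+ 2)) = Num.sqrt t * Num.sqrt (theta (t ^+ 2)).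
Proof.
move=> t0; rewrite exprVn theta_inversion ?exprn_gt0// sqrtr_sqr ger0_norm ?(ltW t0)//.
by rewrite sqrtrM// ltW.
Qed.

Lemma measurable_sqrt_theta1 : measurable_fun (`]0, +oo[ : set R) A.
Proof.
apply: (@measurable_fun_cvg _ _ _ _ (fun N t => \sum_(0 <= m < N) c m.+1 * gaussq t ^+ m.+1)).
  move=> N; apply: measurable_funTS; apply: measurable_sum => m.
  apply: measurable_funM => //; apply: measurable_funX.
  apply: measurableT_comp => //; apply: measurableT_comp => //.
  by apply: measurable_funM => //; exact: measurable_funX.
move=> t; rewrite /= in_itv /= andbT; exact: sqrt_theta1_series.
Qed.

End SqrtThetaKernel.

(** * Complex integrals and Mellin transforms *)

Section DensityMeasure.
Context d (T : measurableType d) {R : realType} (mu : {measure set T -> \bar R}).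
Variable g : T -> R.
Hypothesis g0 : forall x, 0 <= g x.
Hypothesis mg : measurable_fun setT g.
Local Open Scope ereal_scope.

(** The two anonymous arguments record the proofs that make this a measure, so that the structure
    can be inferred from the term itself. *)
Definition density_measure of (forall x, (0 <= g x)%R) & measurable_fun setT g :=
  fun A : set T => \int[mu]_(x in A) (g x)%:E.

Local Notation nu := (density_measure g0 mg).

Let mgE (A : set T) : measurable_fun A (EFin \o g).
Proof. by apply/measurable_EFinP; exact: measurable_funTS. Qed.

Let nu0 : nu set0 = 0.
Proof. by rewrite /density_measure integral_set0. Qed.

Let nu_ge0 A : 0 <= nu A.
Proof. by apply: integral_ge0 => x _; rewrite lee_fin. Qed.

Let nu_sigma_additive : semi_sigma_additive nu.
Proof.
move=> F mF tF mUF; rewrite /density_measure ge0_integral_bigcup//=; last first.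
  by move=> x _; rewrite lee_fin.
apply: is_cvg_ereal_nneg_natsum_cond => n _ _.
by apply: integral_ge0 => x _; rewrite lee_fin.
Qed.

HB.instance Definition _ := isMeasure.Build _ _ _ nu nu0 nu_ge0 nu_sigma_additive.

Import HBNNSimple.

(** Both sides are limits over increasing simple functions, which reduces the claim to indicators,
    where it is the definition of the measure. *)
Lemma ge0_integral_density (f : T -> \bar R) :
  (forall x, 0 <= f x) -> measurable_fun setT f ->
  \int[nu]_x f x = \int[mu]_x (f x * (g x)%:E).
Proof.
move=> f0 mf; pose h := nnsfun_approx measurableT mf.
have -> : \int[nu]_x f x = limn (fun n => \int[nu]_x (EFin \o h n) x).
  have fE x : f x = limn (EFin \o h ^~ x).
    by apply/esym/cvg_lim => //; exact: cvg_nnsfun_approx.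
  under eq_integral do rewrite fE.
  apply: monotone_convergence => //.
  - by move=> n; apply/measurable_EFinP; exact/measurable_funP.
  - by move=> n x _ //=; rewrite lee_fin.
  - by move=> x _ a b ab; rewrite lee_fin; exact/lefP/nd_nnsfun_approx.
have -> : \int[mu]_x (f x * (g x)%:E) =
    limn (fun n => \int[mu]_x ((h n x)%:E * (g x)%:E)).
  have fE x : f x * (g x)%:E = limn (fun n => (h n x)%:E * (g x)%:E).
    apply/esym/cvg_lim => //; apply: cvgeZr => //.
    by have := cvg_nnsfun_approx measurableT mf (fun x _ => f0 x) (I : setT x).
  under eq_integral do rewrite fE.
  apply: monotone_convergence => //.
  - move=> n; apply/emeasurable_funM => //.
    by apply/measurable_EFinP; exact/measurable_funP.
  - by move=> n x _ /=; rewrite mule_ge0 ?lee_fin.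
  - move=> x _ a b ab /=; rewrite lee_wpmul2r ?lee_fin//.
    exact/lefP/nd_nnsfun_approx.
suff suf n : \int[mu]_x ((h n x)%:E * (g x)%:E) = \int[nu]_x (EFin \o h n) x.
  by under eq_fun do rewrite -suf.
transitivity (\int[nu]_x (\sum_(y \in range (h n)) (y * \1_(h n @^-1` [set y]) x)%:E)); last first.
  by apply: eq_integral => t _; rewrite /= fimfunE -fsumEFin.
have indich r : measurable_fun setT (fun x => (r * \1_(h n @^-1` [set r]) x)%:E).
  by apply: (measurable_comp measurableT) => //; exact: measurable_funM.
rewrite ge0_integral_fsum//; last by move=> y x _; exact: nnfun_muleindic_ge0.
transitivity (\int[mu]_x (\sum_(y \in range (h n))
    (y * \1_(h n @^-1` [set y]) x)%:E * (g x)%:E)).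
  under [RHS]eq_integral => x _.
    rewrite -ge0_mule_fsuml => [|y]; last exact: nnfun_muleindic_ge0.
    rewrite fsumEFin // -(fimfunE _ x); over.
  by [].
rewrite ge0_integral_fsum//; last 2 first.
  - by move=> y; exact: emeasurable_funM.
  - by move=> y x _; apply: mule_ge0; [exact: nnfun_muleindic_ge0|rewrite lee_fin].
apply: eq_fsbigr => r rhn.
have [y _ hr] := set_mem rhn.
have r0 : (0 <= r)%R by rewrite -hr.
under eq_integral do rewrite EFinM -muleA.
rewrite ge0_integralZl//; last 2 first.
  - by apply: emeasurable_funM => //; exact/measurable_EFinP.
  - by move=> x _; rewrite mule_ge0 ?lee_fin.
under [RHS]eq_integral do rewrite EFinM.
rewrite [RHS]ge0_integralZl//.
  congr (_ * _); rewrite integral_indic// setIT /density_measure.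
  rewrite [RHS]integral_mkcond; apply: eq_integral => x xT.
  by rewrite patchE indicE; case: (_ \in _); rewrite ?mul1e ?mul0e.
exact/measurable_EFinP.
Qed.

End DensityMeasure.

(** * Change of variables for the measure dt/t *)

Section MultiplicativeMeasure.
Context {R : realType}.
Local Notation mu := (@lebesgue_measure R).
Local Notation pos := (`]0, +oo[%classic : set R).

(** The density [1/t] on the half line; in this form its measurability follows from that of [ln] and
    [expR]. *)
Let g (t : R) : R := expR (- ln t) * \1_pos t.

Let g0 t : 0 <= g t.
Proof. by rewrite mulr_ge0 ?expR_ge0. Qed.

Let mg : measurable_fun setT g.
Proof.
apply: measurable_funM => //; apply: measurableT_comp => //.
by apply: measurableT_comp => //; exact: measurable_ln.
Qed.

Lemma measurable_inv_pos : measurable_fun pos (fun t : R => t^-1).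
Proof.
apply: open_continuous_measurable_fun; first exact: interval_open.
move=> t; rewrite inE /= in_itv /= andbT => t0.
by apply: inv_continuous; rewrite gt_eqF.
Qed.

Lemma integral_inv_ln (a b : R) : a < b ->
  (\int[mu]_(t in `[expR a, expR b]) (t^-1)%:E = (b - a)%:E)%E.
Proof.
move=> ab; have eab : expR a < expR b by rewrite ltr_expR.
have ea0 := expR_gt0 a.
have pos_of x : x \in `[expR a, expR b] -> 0 < x.
  by rewrite in_itv /= => /andP[ax _]; exact: lt_le_trans ax.
rewrite (@continuous_FTC2 _ _ (@ln R))//.
- by rewrite !expRK EFinB.
- apply: continuous_in_subspaceT => x /[!inE] xab.
  by apply: inv_continuous; rewrite gt_eqF// pos_of.
- split.
  + move=> x; rewrite in_itv /= => /andP[ax _].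
    by apply: ex_derive; apply: is_derive1_ln; exact: lt_trans ax.
  + by apply: cvg_at_right_filter; apply: continuous_ln.
  + by apply: cvg_at_left_filter; apply: continuous_ln; exact: expR_gt0.
- move=> x; rewrite in_itv /= => /andP[ax _]; rewrite derive1E.
  by have [_ ->] := is_derive1_ln (lt_trans ea0 ax).
Qed.

(** The image of [dt/t] under [ln] gives []a, b]] the mass [b - a], hence is Lebesgue measure by
    uniqueness. *)
Lemma ge0_integral_ln_sub (f : R -> \bar R) :
  (forall x, 0 <= f x)%E -> measurable_fun setT f ->
  (\int[mu]_x f x = \int[mu]_(t in pos) (f (ln t) * (t^-1)%:E))%E.
Proof.
move=> f0 mf.
have mln : measurable_fun setT (@ln R : R -> measurableTypeR R) by exact: measurable_ln.
pose m := density_measure mu g0 mg.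
have E A : measurable A -> mu A = pushforward m (@ln R : R -> measurableTypeR R) A.
  apply: lebesgue_measure_unique => _ [[a b] /= ab <-].
  rewrite lebesgue_measure_itv /= lte_fin; case: ifPn => [{}ab|nab]; last first.
    by rewrite set_itv_ge ?bnd_simp// /pushforward preimage_set0 measure0.
  rewrite /pushforward /m /density_measure.
  have -> : (\int[mu]_(x in (@ln R) @^-1` `]a, b]%classic) (g x)%:E =
      \int[mu]_(t in `]expR a, expR b]) (t^-1)%:E)%E.
    rewrite [LHS]integral_mkcond [RHS]integral_mkcond; apply: eq_integral => t _.
    have tpE : (t \in pos) = (0 < t) by apply/idP/idP; rewrite inE /= in_itv /= andbT.
    have tabE : (t \in `]expR a, expR b]%classic) = (expR a < t <= expR b).
      by apply/idP/idP; rewrite inE /= in_itv.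
    have tlnE : (t \in (@ln R) @^-1` `]a, b]%classic) = (a < ln t <= b).
      by apply/idP/idP; rewrite inE /= in_itv.
    rewrite !patchE /g indicE tpE tabE tlnE; have [t0|t0] := ltP 0 t; last first.
      rewrite mulr0 [X in _ = if X then _ else _](_ : _ = false); first by case: ifP.
      by apply/negbTE; rewrite negb_and -leNgt (le_trans t0 (expR_ge0 _)).
    rewrite mulr1 expRN lnK//.
    by rewrite -[in RHS](lnK t0) ltr_expR ler_expR lnK.
  rewrite integral_itv_obnd_cbnd; last first.
    apply/measurable_EFinP; apply: (measurable_funS _ _ measurable_inv_pos) => //.
    move=> t /=; rewrite !in_itv /= andbT => /andP[h _].
    exact: lt_trans (expR_gt0 a) h.
  by rewrite integral_inv_ln// EFinB.
transitivity (\int[pushforward m (@ln R : R -> measurableTypeR R)]_x f x)%E.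
  by apply: eq_measure_integral => A mA _; exact: E.
rewrite ge0_integral_pushforward//= preimage_setT ge0_integral_density//; last first.
  exact: measurableT_comp.
rewrite [RHS]integral_mkcond; apply: eq_integral => t _.
rewrite patchE /g indicE; case: ifPn => tp.
  by rewrite mulr1 expRN lnK//; move: tp; rewrite inE /= in_itv /= andbT.
by rewrite mulr0 mule0.
Qed.

(** Again uniqueness, applied to the image measure multiplied by [|a|]; for [a < 0] the preimage of
    a half-open interval is half-open at the other end. *)
Lemma ge0_integral_affine_sub (f : R -> \bar R) (a b : R) : a != 0 ->
  (forall x, 0 <= f x)%E -> measurable_fun setT f ->
  (\int[mu]_x f (a * x + b)%R = `|a|^-1%:E * \int[mu]_x f x)%E.
Proof.
move=> a0 f0 mf; have na0 : 0 < `|a| by rewrite normr_gt0.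
pose phi (x : R) : measurableTypeR R := a * x + b.
have mphi : measurable_fun setT phi.
  by apply: measurable_funD => //; exact: measurable_funM.
have E A : measurable A -> mu A = mscale (NngNum (normr_ge0 a)) (pushforward mu phi) A.
  apply: lebesgue_measure_unique => _ [[c d] /= _ <-].
  have [cd|dc] := ltP c d; last first.
    rewrite set_itv_ge ?bnd_simp -?leNgt// measure0.
    by rewrite /mscale /= /pushforward preimage_set0 measure0 mule0.
  rewrite /mscale /= /pushforward.
  have -> : mu (phi @^-1` `]c, d]%classic) = (`|a|^-1 * (d - c))%:E.
    have [ap|an] := ltP 0 a.
      rewrite (_ : _ @^-1` _ = `](c - b) / a, (d - b) / a]%classic).
        rewrite lebesgue_measure_itv /= lte_fin ltr_pM2r ?invr_gt0// ltrD2r.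
        rewrite ger0_norm ?(ltW ap)// cd.
        by rewrite -EFinB -mulrBl opprB addrA subrK mulrC.
      apply/seteqP; split => x; rewrite /= !in_itv /= /phi => /andP[h1 h2]; apply/andP; split.
      + by rewrite ltr_pdivrMr// ltrBlDr mulrC.
      + by rewrite ler_pdivlMr// lerBrDr mulrC.
      + by move: h1; rewrite ltr_pdivrMr// ltrBlDr mulrC.
      + by move: h2; rewrite ler_pdivlMr// lerBrDr mulrC.
    have {}an : a < 0 by rewrite lt_neqAle a0.
    rewrite (_ : _ @^-1` _ = `[(d - b) / a, (c - b) / a[%classic).
      rewrite lebesgue_measure_itv /= lte_fin ltr_nM2r ?invr_lt0// ltrD2r.
      rewrite ler0_norm ?(ltW an)// cd.
      by rewrite -EFinB -mulrBl opprB addrA subrK invrN mulNr mulrC -mulrN opprB.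
    apply/seteqP; split => x; rewrite /= !in_itv /= /phi => /andP[h1 h2]; apply/andP; split.
    + by rewrite ler_ndivrMr// lerBrDr mulrC.
    + by rewrite ltr_ndivlMr// ltrBlDr mulrC.
    + by move: h2; rewrite ltr_ndivlMr// ltrBlDr mulrC.
    + by move: h1; rewrite ler_ndivrMr// lerBrDr mulrC.
  rewrite lebesgue_measure_itv /= -EFinM mulrA divff ?gt_eqF// mul1r lte_fin.
  by rewrite cd -EFinB.
rewrite [X in (_ = _ * X)%E](_ : _ = \int[mscale (NngNum (normr_ge0 a)) (pushforward mu phi)]_x f x)%E;
  last by apply: eq_measure_integral => A mA _; exact: E.
rewrite ge0_integral_mscale//= ge0_integral_pushforward//= preimage_setT.
by rewrite muleA -EFinM mulVf ?gt_eqF// mul1e.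
Qed.

(** The substitution [t -> e^q t^p] is affine in [ln t]. It covers dilation, inversion, the square
    root needed for the Bessel integral, and real powers. *)
Lemma ge0_integral_pow_sub (f : R -> \bar R) (p q : R) : p != 0 ->
  (forall t : R, (0 < t)%R -> 0 <= f t)%E -> measurable_fun pos f ->
  (\int[mu]_(t in pos) (f (expR (p * ln t + q)%R) * (t^-1)%:E) =
   `|p|^-1%:E * \int[mu]_(t in pos) (f t * (t^-1)%:E))%E.
Proof.
move=> p0 f0 mf; pose F x := f (expR x).
have F0 x : (0 <= F x)%E by apply: f0; exact: expR_gt0.
have mF : measurable_fun setT F.
  apply: (measurable_comp _ _ mf) => //.
  by move=> _ [x _ <-]; rewrite /= in_itv /= andbT expR_gt0.
transitivity (\int[mu]_(t in pos) (F (p * ln t + q)%R * (t^-1)%:E))%E => //.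
rewrite -(@ge0_integral_ln_sub (fun x => F (p * x + q)))//; last first.
  apply: (measurableT_comp mF).
  by apply: measurable_funD => //; exact: measurable_funM.
rewrite ge0_integral_affine_sub// ge0_integral_ln_sub//; congr (_ * _)%E.
apply: eq_integral => t; rewrite inE /= in_itv /= andbT => t0.
by rewrite /F lnK.
Qed.

End MultiplicativeMeasure.

(** * The complex exponential and powers *)

Section ComplexExponential.
Context {R : realType}.
Import Normc.
Implicit Types (z w s : R[i]) (t u : R).

Lemma cexpD z w : cexp (z + w) = cexp z * cexp w.
Proof.
case: z w => [a b] [c d]; rewrite /cexp /= expRD cosD sinD.
by apply/eqP; rewrite eq_complex /=; apply/andP; split; apply/eqP; ring.
Qed.

Lemma cexp_real (a : R) : cexp a%:C = (expR a)%:C.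
Proof.
rewrite /cexp /= cos0 sin0.
by apply/eqP; rewrite eq_complex /=; apply/andP; split; apply/eqP; ring.
Qed.

Lemma cexp0 : cexp (0 : R[i]) = 1.
Proof. by rewrite -[0]/((0 : R)%:C) cexp_real expR0. Qed.

Lemma normc_cexp z : normc (cexp z) = expR (complex.Re z).
Proof.
rewrite /cexp normcM normc_real ger0_norm ?expR_ge0//=.
by rewrite cos2Dsin2 sqrtr1 mulr1.
Qed.

Lemma cpowD t s w : cpow t (s + w) = cpow t s * cpow t w.
Proof. by rewrite /cpow mulrDl cexpD. Qed.

Lemma cpow_real t (a : R) : cpow t a%:C = (expR (a * ln t))%:C.
Proof. by rewrite /cpow -realcM cexp_real. Qed.

Lemma cpow_expR (x : R) s : cpow (expR x) s = cexp (s * x%:C).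
Proof. by rewrite /cpow expRK. Qed.

Lemma cpow1l s : cpow 1 s = 1 :> R[i].
Proof. by rewrite /cpow ln1 mulr0 cexp0. Qed.

Lemma cpow0 t : cpow t 0 = 1 :> R[i].
Proof. by rewrite /cpow mul0r cexp0. Qed.

Lemma cpow_inv t s : 0 < t -> cpow t^-1 s = cpow t (- s).
Proof. by move=> t0; rewrite /cpow lnV// rmorphN mulrN mulNr. Qed.

Lemma Re_mulr_real z (a : R) : complex.Re (z * a%:C) = complex.Re z * a.
Proof. by case: z => b d /=; rewrite mulr0 subr0. Qed.

Lemma Im_mulr_real z (a : R) : complex.Im (z * a%:C) = complex.Im z * a.
Proof. by case: z => b d /=; rewrite mulr0 add0r. Qed.

Lemma normc_cpow t s : normc (cpow t s) = expR (complex.Re s * ln t).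
Proof. by rewrite /cpow normc_cexp Re_mulr_real. Qed.

Lemma norm_expRB1 (x : R) : `|expR x - 1| <= `|x| * expR `|x|.
Proof.
have [x0|x0] := leP 0 x.
  rewrite !ger0_norm//; last by rewrite subr_ge0 -[leLHS]expR0 ler_expR.
  have := expR_ge1Dx (- x); rewrite expRN => h.
  have e0 := expR_gt0 x.
  by rewrite -(ler_pM2l (_ : 0 < (expR x)^-1)) ?invr_gt0// mulrBr mulrCA mulVf ?gt_eqF// !mulr1; lra.
rewrite !ltr0_norm//; last by rewrite subr_lt0 expR_lt1.
rewrite opprB lerBlDr; have := expR_ge1Dx x => h.
have : 1 <= expR (- x) by rewrite -[leLHS]expR0 ler_expR; lra.
by move: (expR x) (expR (- x)) h => a b; nra.
Qed.

Lemma norm_expRB1Bx (x : R) : `|expR x - 1 - x| <= x ^+ 2 * expR `|x|.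
Proof.
have h0 : 0 <= expR x - 1 - x by have := expR_ge1Dx x; lra.
rewrite ger0_norm//.
have h1 := expR_ge1Dx (- x); rewrite expRN in h1.
have e0 := expR_gt0 x.
have h2 : expR x * (1 - x) <= 1.
  by rewrite mulrC -ler_pdivlMr// mul1r; lra.
have [x0|x0] := leP 0 x.
  rewrite ger0_norm//; move: (norm_expRB1 x); rewrite !ger0_norm//; last by lra.
  move: (expR x) e0 h0 h1 h2 => a; nra.
have -> : `|x| = - x by rewrite ltr0_norm.
have : 1 <= expR (- x) by rewrite -[leLHS]expR0 ler_expR; lra.
move: (expR x) (expR (- x)) e0 h0 h1 h2 => a b a0 h0 h1 h2 b1.
have h3 : a - 1 - x <= x ^+ 2 by nra.
by apply: le_trans h3 _; rewrite ler_peMr// sqr_ge0.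
Qed.

Lemma cos_ge_sqrN (u : R) : 1 - u ^+ 2 / 2 <= cos u.
Proof.
have [u0|u0] := leP 0 u; first exact: cos_ge_sqr.
by rewrite -cosN -sqrrN; apply: cos_ge_sqr; rewrite oppr_ge0 ltW.
Qed.

Lemma norm_sinBx (u : R) : `|sin u - u| <= u ^+ 2.
Proof.
wlog u0 : u / 0 < u.
  move=> H; have [u0|u0|->] := ltgtP u 0; last by rewrite sin0 subr0 normr0 expr0n.
    have -> : sin u - u = - (sin (- u) - - u) by rewrite sinN; ring.
    by rewrite normrN -sqrrN H// oppr_gt0.
  exact: H.
have cs : {within `[0, u], continuous (fun x : R => sin x - x)}.
  apply: continuous_subspaceT => x.
  by apply: cvgB; [exact: continuous_sin|exact: cvg_id].
have D (x : R) : x \in `]0, u[%R -> is_derive x 1 (fun x => sin x - x) (cos x - 1).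
  by move=> _; exact: is_deriveB.
have [c] := @MVT R (fun x => sin x - x) (fun x => cos x - 1) 0 u u0 D cs.
rewrite in_itv /= => /andP[c0 cu]; rewrite sin0 !subr0 => ->.
rewrite normrM (gtr0_norm u0) expr2 ler_pM2r//.
rewrite distrC ger0_norm; last by rewrite subr_ge0 cos_le1.
have := cos_ge_sqrN c; have := cos_geN1 c.
move: (cos c) => v; nra.
Qed.

Lemma normc_le z : normc z <= `|complex.Re z| + `|complex.Im z|.
Proof.
rewrite -(@ler_pXn2r _ 2)// ?nnegrE ?addr_ge0 ?normc_ge0//.
rewrite sqr_normc -[complex.Re z ^+ 2]real_normK ?num_real//.
rewrite -[complex.Im z ^+ 2]real_normK ?num_real//.
by have := normr_ge0 (complex.Re z); have := normr_ge0 (complex.Im z); nra.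
Qed.

Lemma Re_le_normc z : `|complex.Re z| <= normc z.
Proof.
rewrite -(@ler_pXn2r _ 2)// ?nnegrE ?normc_ge0//.
by rewrite sqr_normc real_normK ?num_real// lerDl sqr_ge0.
Qed.

Lemma Im_le_normc z : `|complex.Im z| <= normc z.
Proof.
rewrite -(@ler_pXn2r _ 2)// ?nnegrE ?normc_ge0//.
by rewrite sqr_normc real_normK ?num_real// lerDr sqr_ge0.
Qed.

(** The source of complex differentiability throughout: both powers and Mellin transforms inherit
    their quadratic remainder from this one. *)
Lemma cexp_second_order w : normc (cexp w - 1 - w) <= 4 * normc w ^+ 2 * expR (normc w).
Proof.
case: w => x y; set w := x +i* y.
have xw : `|x| <= normc w := Re_le_normc w.
apply: le_trans (normc_le _) _.
rewrite sqr_normc /= !mul0r subr0 addr0 oppr0 addr0.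
set E := expR `|x|; have E1 : 1 <= E by rewrite -[leLHS]expR0 ler_expR.
have EW : E <= expR (normc w) by rewrite ler_expR.
apply: (@le_trans _ _ (4 * (x ^+ 2 + y ^+ 2) * E)); last first.
  by rewrite ler_wpM2l// mulr_ge0// addr_ge0// sqr_ge0.
have ex : expR x <= E by rewrite ler_expR ler_norm.
have ex0 := expR_gt0 x.
have h1 : `|expR x * cos y - 1 - x| <= x ^+ 2 * E + E * (y ^+ 2 / 2).
  have -> : expR x * cos y - 1 - x = (expR x - 1 - x) - expR x * (1 - cos y) by ring.
  apply: le_trans (ler_normB _ _) _; apply: lerD; first exact: norm_expRB1Bx.
  rewrite normrM (gtr0_norm ex0) ger0_norm ?subr_ge0 ?cos_le1//.
  apply: ler_pM; rewrite ?expR_ge0 ?subr_ge0 ?cos_le1//.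
  by have := cos_ge_sqrN y; lra.
have sy : `|sin y| <= `|y|.
  rewrite -(@ler_pXn2r _ 2)// ?nnegrE// !real_normK ?num_real// sin2cos2.
  by have := cos_ge_sqrN y; have := sqr_ge0 (1 - cos y); move: (cos y) => v; lra.
have h2 : `|expR x * sin y - y| <= `|x| * E * `|y| + y ^+ 2.
  have -> : expR x * sin y - y = (expR x - 1) * sin y + (sin y - y) by ring.
  apply: le_trans (ler_normD _ _) _; apply: lerD; last exact: norm_sinBx.
  by rewrite normrM ler_pM// norm_expRB1.
have xy : `|x| * `|y| <= (x ^+ 2 + y ^+ 2) / 2.
  rewrite -[x ^+ 2]real_normK ?num_real// -[y ^+ 2]real_normK ?num_real//.
  by have := sqr_ge0 (`|x| - `|y|); lra.
have x20 := sqr_ge0 x; have y20 := sqr_ge0 y.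
have h3 : E * (`|x| * `|y|) <= E * ((x ^+ 2 + y ^+ 2) / 2) by rewrite ler_wpM2l// expR_ge0.
have h4 : y ^+ 2 <= E * y ^+ 2 by rewrite ler_peMl.
have h5 : 0 <= E * x ^+ 2 by rewrite mulr_ge0// expR_ge0.
have h6 : 0 <= E * y ^+ 2 by rewrite mulr_ge0// expR_ge0.
apply: le_trans (lerD h1 h2) _.
move: (`|x|) (`|y|) h3 => a b h3; move: h3 h4 h5 h6; move: (x ^+ 2) (y ^+ 2) => X Y.
lra.
Qed.

End ComplexExponential.

(** * Integrals of complex-valued functions over the half line *)

Section ComplexIntegral.
Context {R : realType}.
Import Normc.
Local Notation mu := (@lebesgue_measure R).
Local Notation pos := (`]0, +oo[%classic : set R).
Implicit Types (f g : R -> R[i]) (z s k : R[i]) (t : R).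

Definition cmeasurable f : Prop :=
  measurable_fun pos (fun t => complex.Re (f t)) /\
  measurable_fun pos (fun t => complex.Im (f t)).

Lemma posP t : pos t <-> 0 < t.
Proof. by rewrite /= in_itv /= andbT. Qed.

Lemma in_posE t : (t \in pos) = (0 < t).
Proof. by apply/idP/idP; rewrite inE => /posP. Qed.

Lemma mpos : measurable pos. Proof. exact: measurable_itv. Qed.

(* [lebesgue_measure] does not live on the default measurable structure of [R]. *)
Lemma mposL :
  measurable (pos : set (g_sigma_algebraType (R.-ocitv.-measurable))).
Proof. exact: measurable_itv. Qed.
Hint Resolve mpos mposL : core.

Lemma cmeasurableD f g : cmeasurable f -> cmeasurable g ->
  cmeasurable (fun t => f t + g t).
Proof.
move=> [f1 f2] [g1 g2]; split.
  apply: (eq_measurable_fun (fun t => complex.Re (f t) + complex.Re (g t))).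
    by move=> t _; case: (f t) (g t) => ? ? [? ?].
  exact: measurable_funD.
apply: (eq_measurable_fun (fun t => complex.Im (f t) + complex.Im (g t))).
  by move=> t _; case: (f t) (g t) => ? ? [? ?].
exact: measurable_funD.
Qed.

Lemma cmeasurableM f g : cmeasurable f -> cmeasurable g ->
  cmeasurable (fun t => f t * g t).
Proof.
move=> [f1 f2] [g1 g2]; split.
  apply: (eq_measurable_fun (fun t => complex.Re (f t) * complex.Re (g t) -
      complex.Im (f t) * complex.Im (g t))).
    by move=> t _; case: (f t) (g t) => ? ? [? ?].
  by apply: measurable_funB; exact: measurable_funM.
apply: (eq_measurable_fun (fun t => complex.Re (f t) * complex.Im (g t) +
      complex.Im (f t) * complex.Re (g t))).
  by move=> t _; case: (f t) (g t) => ? ? [? ?].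
by apply: measurable_funD; exact: measurable_funM.
Qed.

Lemma cmeasurable_real (h : R -> R) : measurable_fun pos h ->
  cmeasurable (fun t => (h t)%:C).
Proof. by move=> mh; split => //=; exact: measurable_cst. Qed.

Lemma cmeasurable_cst k : cmeasurable (fun=> k).
Proof. by split; exact: measurable_cst. Qed.

Lemma eq_cmeasurable f g : (forall t, 0 < t -> f t = g t) -> cmeasurable f -> cmeasurable g.
Proof.
move=> fg [m1 m2]; split.
  by apply: eq_measurable_fun m1 => t; rewrite in_posE => /fg ->.
by apply: eq_measurable_fun m2 => t; rewrite in_posE => /fg ->.
Qed.

Lemma measurable_lnZ (a : R) : measurable_fun pos (fun t => a * ln t).
Proof.
by apply: measurable_funTS; apply: measurable_funM => //; exact: measurable_ln.
Qed.

Lemma cmeasurable_cpow s : cmeasurable (fun t => cpow t s).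
Proof.
have E t : cpow t s = (expR (complex.Re s * ln t))%:C *
    (cos (complex.Im s * ln t) +i* sin (complex.Im s * ln t)).
  by rewrite /cpow /cexp Re_mulr_real Im_mulr_real.
apply: (@eq_cmeasurable (fun t => (expR (complex.Re s * ln t))%:C *
    (cos (complex.Im s * ln t) +i* sin (complex.Im s * ln t)))).
  by move=> t _; rewrite E.
apply: cmeasurableM.
  by apply: cmeasurable_real; apply: measurableT_comp => //; exact: measurable_lnZ.
split => /=.
  apply: measurableT_comp; last exact: measurable_lnZ.
  by apply: continuous_measurable_fun; exact: continuous_cos.
apply: measurableT_comp; last exact: measurable_lnZ.
by apply: continuous_measurable_fun; exact: continuous_sin.
Qed.

Lemma realcV (a : R) : (a^-1)%:C = (a%:C)^-1.
Proof. exact: fmorphV. Qed.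

Lemma cmeasurable_inv : cmeasurable (fun t => (t%:C)^-1).
Proof.
apply: (@eq_cmeasurable (fun t => (t^-1)%:C)); first by move=> t _; rewrite realcV.
by apply: cmeasurable_real; exact: measurable_inv_pos.
Qed.

Lemma eq_cintegral f g : (forall t, 0 < t -> f t = g t) ->
  cintegral0y f = cintegral0y g.
Proof.
by move=> fg; congr (_ +i* _); apply: eq_Rintegral => t; rewrite in_posE => /fg ->.
Qed.

Lemma eq_cintegrable f g : (forall t, 0 < t -> f t = g t) ->
  cintegrable0y f -> cintegrable0y g.
Proof.
move=> fg [i1 i2]; split.
  by apply: eq_integrable i1 => // t; rewrite in_posE => /fg ->.
by apply: eq_integrable i2 => // t; rewrite in_posE => /fg ->.
Qed.

Lemma cintegrableD f g : cintegrable0y f -> cintegrable0y g ->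
  cintegrable0y (fun t => f t + g t).
Proof.
move=> [f1 f2] [g1 g2]; split.
  have := integrableD mposL f1 g1.
  by apply: eq_integrable => // t _; case: (f t) (g t) => ? ? [? ?].
have := integrableD mposL f2 g2.
by apply: eq_integrable => // t _; case: (f t) (g t) => ? ? [? ?].
Qed.

Lemma cintegralD f g : cintegrable0y f -> cintegrable0y g ->
  cintegral0y (fun t => f t + g t) = cintegral0y f + cintegral0y g.
Proof.
move=> [f1 f2] [g1 g2]; rewrite /cintegral0y.
apply/eqP; rewrite eq_complex /=; apply/andP; split; apply/eqP.
  rewrite -RintegralD//; apply: eq_Rintegral => t _.
  by case: (f t) (g t) => ? ? [? ?].
rewrite -RintegralD//; apply: eq_Rintegral => t _.
by case: (f t) (g t) => ? ? [? ?].
Qed.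

Lemma cintegrableZ k f : cintegrable0y f -> cintegrable0y (fun t => k * f t).
Proof.
move=> [f1 f2]; split.
  have := integrableB mposL (integrableZl mposL (complex.Re k) f1)
    (integrableZl mposL (complex.Im k) f2).
  by apply: eq_integrable => // t _; case: (f t) k => ? ? [? ?] /=; rewrite -!EFinM -EFinB.
have := integrableD mposL (integrableZl mposL (complex.Re k) f2)
  (integrableZl mposL (complex.Im k) f1).
by apply: eq_integrable => // t _; case: (f t) k => ? ? [? ?] /=; rewrite -!EFinM -EFinD.
Qed.

Lemma cintegralZ k f : cintegrable0y f ->
  cintegral0y (fun t => k * f t) = k * cintegral0y f.
Proof.
move=> [f1 f2]; rewrite /cintegral0y.
have Z (a : R) (h : R -> R) : mu.-integrable pos (EFin \o h) ->
    mu.-integrable pos (EFin \o (fun t => a * h t)).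
  by move=> ih; apply: eq_integrable (integrableZl mposL a ih).
apply/eqP; rewrite eq_complex /=; case: k => a b /=; apply/andP; split; apply/eqP.
  rewrite -!RintegralZl// -RintegralB//; [|exact: Z|exact: Z].
  by apply: eq_Rintegral => t _; case: (f t).
rewrite -!RintegralZl// -RintegralD//; [|exact: Z|exact: Z].
by apply: eq_Rintegral => t _; case: (f t).
Qed.

Lemma cintegrable_le f (h : R -> R) : cmeasurable f ->
  mu.-integrable pos (EFin \o h) ->
  (forall t, 0 < t -> normc (f t) <= h t) -> cintegrable0y f.
Proof.
move=> [m1 m2] ih fh; split.
  apply: (le_integrable _ _ _ ih) => //; first exact/measurable_EFinP.
  move=> t /posP t0 /=; rewrite lee_fin; apply: le_trans (Re_le_normc _) _.
  by apply: le_trans (fh t t0) _; exact: ler_norm.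
apply: (le_integrable _ _ _ ih) => //; first exact/measurable_EFinP.
move=> t /posP t0 /=; rewrite lee_fin; apply: le_trans (Im_le_normc _) _.
by apply: le_trans (fh t t0) _; exact: ler_norm.
Qed.

(** The factor 2 comes from estimating real and imaginary parts separately; the bound enters
    remainder estimates, where the constant does not matter. *)
Lemma normc_cintegral_le f (h : R -> R) : cintegrable0y f ->
  mu.-integrable pos (EFin \o h) ->
  (forall t, 0 < t -> normc (f t) <= h t) ->
  normc (cintegral0y f) <= 2 * (\int[mu]_(t in pos) h t).
Proof.
move=> [f1 f2] ih fh; apply: le_trans (normc_le _) _.
have N (u : R -> R) : mu.-integrable pos (EFin \o u) ->
    mu.-integrable pos (EFin \o (fun t => `|u t|)).
  by move=> iu; apply: eq_integrable (integrable_abse iu).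
rewrite /= mulr_natl mulr2n; apply: lerD.
  apply: le_trans (le_normr_Rintegral _ f1) _ => //.
  apply: le_Rintegral => //; first exact: N.
  by move=> t /posP t0; apply: le_trans (Re_le_normc _) _; exact: fh.
apply: le_trans (le_normr_Rintegral _ f2) _ => //.
apply: le_Rintegral => //; first exact: N.
by move=> t /posP t0; apply: le_trans (Im_le_normc _) _; exact: fh.
Qed.

Lemma integrable_pos_sub (h : R -> R) (p q : R) : p != 0 ->
  measurable_fun pos h ->
  mu.-integrable pos (fun t => (h t / t)%:E) ->
  mu.-integrable pos (fun t => (h (expR (p * ln t + q)) / t)%:E) /\
  \int[mu]_(t in pos) (h (expR (p * ln t + q)) / t) =
  `|p|^-1 * \int[mu]_(t in pos) (h t / t).
Proof.
move=> p0 mh ih.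
pose phi t : R := expR (p * ln t + q).
have mphi : measurable_fun pos phi.
  apply: measurableT_comp => //; apply: measurable_funD => //.
  exact: measurable_lnZ.
have mhphi : measurable_fun pos (h \o phi).
  apply: (measurable_comp _ _ mh) => //.
  by move=> _ [x _ <-]; apply/posP; exact: expR_gt0.
have mq (u : R -> R) : measurable_fun pos u -> measurable_fun pos (fun t => (u t / t)%:E).
  by move=> mu_; apply/measurable_EFinP; apply: measurable_funM => //; exact: measurable_inv_pos.
have S (u : R -> \bar R) : (forall t : R, (0 < t)%R -> 0 <= u t)%E -> measurable_fun pos u ->
  (\int[mu]_(t in pos) (u (phi t) * (t^-1)%:E) =
   `|p|^-1%:E * \int[mu]_(t in pos) (u t * (t^-1)%:E))%E.
  by move=> u0 mu_; exact: ge0_integral_pow_sub.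
have iphi : mu.-integrable pos (fun t => (h (phi t) / t)%:E).
  apply/integrableP; split; first exact: mq.
  have /integrableP[_] := ih.
  have E (u : R -> R) : (\int[mu]_(t in pos) `|(u t / t)%:E| =
      \int[mu]_(t in pos) ((`|u t|)%:E * (t^-1)%:E))%E.
    apply: eq_integral => t; rewrite in_posE => t0.
    by rewrite /= normrM EFinM (gtr0_norm (_ : 0 < t^-1)) ?invr_gt0.
  rewrite E (E (h \o phi)) (S (fun t => (`|h t|)%:E)).
  - by move=> lt; rewrite lte_mul_pinfty// ?lee_fin// invr_ge0.
  - by move=> t t0; rewrite lee_fin.
  - by apply/measurable_EFinP; exact: measurableT_comp.
split => //.
(* The substitution rule is known for nonnegative functions, so it is applied to the positive and
   negative parts, both dominated by [|h|]. *)
pose hp t := Order.max (h t) 0; pose hn t := Order.max (- h t) 0.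
have hE t : h t = hp t - hn t.
  rewrite /hp /hn; case: (leP (h t) 0) => h1; case: (leP (- h t) 0) => h2; lra.
have mhp : measurable_fun pos hp by apply: measurable_maxr.
have mhn : measurable_fun pos hn by apply: measurable_maxr => //; exact: measurableT_comp.
have bnd (u : R -> R) : (forall t, 0 <= u t <= `|h t|) -> measurable_fun pos u ->
   mu.-integrable pos (EFin \o (fun t => u t / t)) /\
   mu.-integrable pos (EFin \o (fun t => u (phi t) / t)).
  move=> ub mu_; split.
    apply: (le_integrable _ _ _ ih) => //; first exact: mq.
    move=> t /posP t0 /=; rewrite lee_fin !normrM ler_wpM2r//.
    by have /andP[u0 u1] := ub t; rewrite ger0_norm.
  apply: (le_integrable _ _ _ iphi) => //.
    apply: mq; apply: (measurable_comp _ _ mu_) => //.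
    by move=> _ [x _ <-]; apply/posP; exact: expR_gt0.
  move=> t /posP t0 /=; rewrite lee_fin !normrM ler_wpM2r//.
  by have /andP[u0 u1] := ub (phi t); rewrite ger0_norm.
have RS (u : R -> R) : (forall t, 0 <= u t <= `|h t|) -> measurable_fun pos u ->
    \int[mu]_(t in pos) (u (phi t) / t) = `|p|^-1 * \int[mu]_(t in pos) (u t / t).
  move=> ub mu_; have [i1 i2] := bnd u ub mu_.
  have := S (fun t => (u t)%:E).
  have -> : (\int[mu]_(t in pos) ((u (phi t))%:E * (t^-1)%:E) =
     (\int[mu]_(t in pos) (u (phi t) / t))%R%:E)%E.
    rewrite /Rintegral fineK; last exact: integrable_fin_num.
    by apply: eq_integral => t _; rewrite EFinM.
  have -> : (\int[mu]_(t in pos) ((u t)%:E * (t^-1)%:E) =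
     (\int[mu]_(t in pos) (u t / t))%R%:E)%E.
    rewrite /Rintegral fineK; last exact: integrable_fin_num.
    by apply: eq_integral => t _; rewrite EFinM.
  rewrite -EFinM => H; apply/EFin_inj; apply: H.
    by move=> t _; have /andP[] := ub t; rewrite lee_fin.
  exact/measurable_EFinP.
have hp_b t : 0 <= hp t <= `|h t|.
  by rewrite /hp le_max lexx orbT ge_max normr_ge0 ler_norm.
have hn_b t : 0 <= hn t <= `|h t|.
  by rewrite /hn le_max lexx orbT ge_max normr_ge0 -normrN ler_norm.
have [p1 p2] := bnd _ hp_b mhp; have [n1 n2] := bnd _ hn_b mhn.
transitivity (\int[mu]_(t in pos) (hp (phi t) / t - hn (phi t) / t)).
  by apply: eq_Rintegral => t _; rewrite hE mulrBl.
rewrite RintegralB// RS// RS// -mulrBr -RintegralB//.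
by congr (_ * _); apply: eq_Rintegral => t _; rewrite hE mulrBl.
Qed.

Lemma cintegral_pos_sub f (p q : R) : p != 0 -> cmeasurable f ->
  cintegrable0y (fun t => f t / t%:C) ->
  cintegrable0y (fun t => f (expR (p * ln t + q)) / t%:C) /\
  cintegral0y (fun t => f (expR (p * ln t + q)) / t%:C) =
  (`|p|^-1)%:C * cintegral0y (fun t => f t / t%:C).
Proof.
move=> p0 [m1 m2] [i1 i2].
have RE z t : complex.Re (z / t%:C) = complex.Re z / t by rewrite -realcV Re_mulr_real.
have IE z t : complex.Im (z / t%:C) = complex.Im z / t by rewrite -realcV Im_mulr_real.
have [|j1 e1] := integrable_pos_sub q p0 m1.
  by apply: eq_integrable i1 => // t _; rewrite RE.
have [|j2 e2] := integrable_pos_sub q p0 m2.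
  by apply: eq_integrable i2 => // t _; rewrite IE.
split.
  split; first by apply: eq_integrable j1 => // t _; rewrite RE.
  by apply: eq_integrable j2 => // t _; rewrite IE.
rewrite /cintegral0y; apply/eqP; rewrite eq_complex /= !mul0r subr0 addr0.
apply/andP; split; apply/eqP.
  under eq_Rintegral do rewrite RE; under [in RHS]eq_Rintegral do rewrite RE.
  by rewrite e1.
under eq_Rintegral do rewrite IE; under [in RHS]eq_Rintegral do rewrite IE.
by rewrite e2.
Qed.

End ComplexIntegral.

(** * Mellin transforms of rapidly decreasing functions *)

Section MellinEntire.
Context {R : realType}.
Import Normc.
Local Notation mu := (@lebesgue_measure R).
Local Notation pos := (`]0, +oo[%classic : set R).
Implicit Types (g : R -> R) (z s h : R[i]) (t a b : R).
Hint Resolve mpos mposL : core.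

(* [max(t, 1/t)^a] *)
Definition expln a t : R := expR (a * `|ln t|).

Lemma expln_gt0 a t : 0 < expln a t. Proof. exact: expR_gt0. Qed.

Lemma explnD a b t : expln (a + b) t = expln a t * expln b t.
Proof. by rewrite /expln mulrDl expRD. Qed.

Lemma normc_cpow_le t s b : normc s <= b -> normc (cpow t s) <= expln b t.
Proof.
move=> sb; rewrite normc_cpow ler_expR; apply: le_trans (ler_norm _) _.
by rewrite normrM ler_wpM2r//; apply: le_trans (Re_le_normc _) sb.
Qed.

(** The left side is 1 up to [t = 1] and [t^(-2)] afterwards; comparison with the derivative of the
    arctangent yields its integrability. *)
Lemma expln_dom t : 0 < t -> expln (-1) t / t <= 2 / (1 + t ^+ 2).
Proof.
move=> t0; have p1 : 0 < 1 + t ^+ 2 by rewrite ltr_wpDr// sqr_ge0.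
rewrite ler_pdivrMr// mulrAC ler_pdivlMr// /expln mulN1r.
have [t1|t1] := leP t 1.
  rewrite ler0_norm ?ln_le0// opprK lnK//.
  have h : t ^+ 2 <= 1 by rewrite expr_le1// ltW.
  by nra.
rewrite ger0_norm; last by rewrite ln_ge0// ltW.
rewrite expRN lnK//.
rewrite -(ler_pM2l t0) mulrA mulfV ?gt_eqF// mul1r.
have h : 1 <= t ^+ 2 by rewrite expr_ge1// ltW.
by nra.
Qed.

Lemma measurable_expln a : measurable_fun pos (expln a).
Proof.
apply: measurableT_comp => //; apply: measurable_funM => //.
apply: measurableT_comp => //.
by apply: measurable_funTS; exact: measurable_ln.
Qed.

Lemma integrable_expln : mu.-integrable pos (fun t => (expln (-1) t / t)%:E).
Proof.
have i1 : mu.-integrable (`[0, +oo[%classic : set R) (fun t => ((oneDsqr t)^-1)%:E).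
  apply/integrableP; split.
    apply/measurable_EFinP; apply: measurable_funTS.
    by apply: continuous_measurable_fun; exact: continuous_oneDsqrV.
  under eq_integral => t _ do rewrite gee0_abs ?lee_fin ?invr_ge0 ?oneDsqr_ge0//.
  by rewrite integral0y_oneDsqr ltry.
have i2 : mu.-integrable pos (fun t => ((oneDsqr t)^-1)%:E).
  apply: integrableS i1 => //.
  by move=> t /=; rewrite !in_itv /= !andbT => /ltW.
apply: (le_integrable _ _ _ (integrableZl mposL 2 i2)) => //.
  apply/measurable_EFinP; apply: measurable_funM; first exact: measurable_expln.
  exact: measurable_inv_pos.
move=> t /posP t0 /=; rewrite lee_fin ger0_norm; last first.
  by apply: divr_ge0; rewrite ltW// expln_gt0.
by apply: le_trans (expln_dom t0) _; exact: ler_norm.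
Qed.

(* Decay faster than any power of [t] at [0] and at [+oo]. *)
Definition rapid g : Prop := measurable_fun pos g /\
  forall a, exists C, forall t, 0 < t -> `|g t| * expln a t <= C.

Lemma cmeasurable_mellin g (f : R -> R[i]) : measurable_fun pos g ->
  cmeasurable f -> cmeasurable (fun t => (g t)%:C * f t / t%:C).
Proof.
move=> mg mf; apply: cmeasurableM; last exact: cmeasurable_inv.
by apply: cmeasurableM => //; exact: cmeasurable_real.
Qed.

Lemma normc_mellin_term t a z : 0 < t -> normc (a%:C * z / t%:C) = `|a| * normc z / t.
Proof.
move=> t0; rewrite -realcV !normcM !normc_real [X in _ * X]gtr0_norm//.
by rewrite invr_gt0.
Qed.

(** Decay is requested at exponent [a + 1]: the spare power becomes the integrable factor
    [expln (-1) t / t]. *)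
Lemma rapid_dom g (f : R -> R[i]) a (B : R) : rapid g -> cmeasurable f -> 0 <= B ->
  (forall t, 0 < t -> normc (f t) <= B * expln a t) ->
  exists2 C, 0 <= C &
  (forall t, 0 < t -> normc ((g t)%:C * f t / t%:C) <= B * C * (expln (-1) t / t)).
Proof.
move=> [mg rg] mf B0 fB; have [C HC] := rg (a + 1).
have C0 : 0 <= C.
  by apply: le_trans (HC 1 ltr01); rewrite mulr_ge0// ltW// expln_gt0.
exists C => // t t0; have ti : 0 <= t^-1 by rewrite invr_ge0 ltW.
rewrite normc_mellin_term// mulrA ler_wpM2r//.
have := HC t t0; rewrite explnD => h.
have e : expln 1 t * expln (-1) t = 1 by rewrite -explnD subrr /expln mul0r expR0.
have p1 := expln_gt0 (-1) t.
have h2 : `|g t| * expln a t <= C * expln (-1) t.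
  rewrite -[leLHS]mulr1 -[X in _ * X <= _]e mulrA ler_pM2r//.
  by rewrite -mulrA.
apply: (@le_trans _ _ (B * (`|g t| * expln a t))); last by rewrite -mulrA ler_wpM2l.
by rewrite mulrCA ler_wpM2l// fB.
Qed.

Lemma integrable_explnZ (k : R) :
  mu.-integrable pos (EFin \o (fun t => k * (expln (-1) t / t))).
Proof.
by apply: eq_integrable (integrableZl mposL k integrable_expln).
Qed.

Lemma rapid_cintegrable g (f : R -> R[i]) a (B : R) : rapid g -> cmeasurable f ->
  0 <= B -> (forall t, 0 < t -> normc (f t) <= B * expln a t) ->
  cintegrable0y (fun t => (g t)%:C * f t / t%:C).
Proof.
move=> rg mf B0 fB; have [C C0 H] := rapid_dom rg mf B0 fB.
apply: cintegrable_le H; last exact: integrable_explnZ.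
by apply: cmeasurable_mellin => //; case: rg.
Qed.

Lemma rapid_mellin_integrable g s : rapid g -> mellin_integrable g s.
Proof.
move=> rg; apply: (@rapid_cintegrable g _ (normc s) 1) => //.
  exact: cmeasurable_cpow.
by move=> t _; rewrite mul1r; exact: normc_cpow_le.
Qed.

(** The 3 is 2 + 1: [|ln t|^2] is at most [expln 2 t], and the exponential in the remainder at most
    [expln 1 t] as [|h| <= 1]. *)
Lemma cpow_second_order t s h : normc h <= 1 ->
  normc (cpow t (s + h) - cpow t s - (ln t)%:C * cpow t s * h) <=
  4 * normc h ^+ 2 * expln (normc s + 3) t.
Proof.
move=> h1.
have -> : cpow t (s + h) - cpow t s - (ln t)%:C * cpow t s * h =
    cpow t s * (cexp (h * (ln t)%:C) - 1 - h * (ln t)%:C).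
  by rewrite cpowD /cpow; ring.
rewrite normcM [leRHS](_ : _ = expln (normc s) t * (4 * normc h ^+ 2 * expln 3 t)); last first.
  by rewrite explnD; ring.
apply: ler_pM; rewrite ?normc_ge0//; first exact: normc_cpow_le.
apply: le_trans (cexp_second_order _) _; rewrite normcM normc_real.
rewrite [leLHS](_ : _ = 4 * normc h ^+ 2 * (`|ln t| ^+ 2 * expR (normc h * `|ln t|))); last by ring.
apply: ler_wpM2l; first by rewrite mulr_ge0// sqr_ge0.
have -> : 3 = 2 + 1 :> R by ring.
rewrite explnD; apply: ler_pM; rewrite ?sqr_ge0 ?expR_ge0//.
  rewrite /expln expRM_natl ler_pXn2r ?nnegrE ?expR_ge0//.
  by apply: le_trans (expR_ge1Dx _); rewrite lerDr.
by rewrite ler_expR ler_wpM2r.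
Qed.

(** Differentiation under the integral sign with explicit remainder. The candidate derivative [L] is
    the transform with [ln t] inserted, and rapid decay absorbs the growth of the remainder of
    [t^s]. *)
Lemma mellin_second_order g s : rapid g ->
  exists L (K : R), forall h, normc h <= 1 ->
  normc (mellin g (s + h) - mellin g s - L * h) <= K * normc h ^+ 2.
Proof.
move=> rg; exists (cintegral0y (fun t => (g t)%:C * ((ln t)%:C * cpow t s) / t%:C)).
have mln : cmeasurable (fun t => (ln t)%:C * cpow t s).
  apply: cmeasurableM; last exact: cmeasurable_cpow.
  by apply: cmeasurable_real; apply: measurable_funTS; exact: measurable_ln.
have iln : cintegrable0y (fun t => (g t)%:C * ((ln t)%:C * cpow t s) / t%:C).
  apply: (@rapid_cintegrable g _ (1 + normc s) 1) => // t t0.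
  rewrite mul1r explnD normcM normc_real ler_pM ?normc_ge0//; last exact: normc_cpow_le.
  by rewrite /expln mul1r; apply: le_trans (expR_ge1Dx _); rewrite lerDr.
have [mg _] := rg.
have [C HC] := (rg.2 (normc s + 3 + 1)).
exists (2 * \int[mu]_(t in pos) (4 * C * (expln (-1) t / t))) => h h1.
have mrem : cmeasurable (fun t => cpow t (s + h) - cpow t s - (ln t)%:C * cpow t s * h).
  apply: (@eq_cmeasurable _ (fun t => cpow t (s + h) + (-1) * cpow t s
      + (- h) * ((ln t)%:C * cpow t s))).
    by move=> t _; ring.
  apply: cmeasurableD; first apply: cmeasurableD; try exact: cmeasurable_cpow.
    by apply: cmeasurableM; [exact: cmeasurable_cst|exact: cmeasurable_cpow].
  by apply: cmeasurableM => //; exact: cmeasurable_cst.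
have i1 := rapid_mellin_integrable (s + h) rg.
have i2 := rapid_mellin_integrable s rg.
rewrite /mellin.
have -> : cintegral0y (mellin_integrand g (s + h)) - cintegral0y (mellin_integrand g s)
   - cintegral0y (fun t => (g t)%:C * ((ln t)%:C * cpow t s) / t%:C) * h =
   cintegral0y (fun t => (g t)%:C *
     (cpow t (s + h) - cpow t s - (ln t)%:C * cpow t s * h) / t%:C).
  rewrite -[X in _ + X - _]mulN1r -cintegralZ// -cintegralD//; last exact: cintegrableZ.
  rewrite -mulrN mulrC -cintegralZ// -cintegralD//; last exact: cintegrableZ.
    by apply: eq_cintegral => t _; rewrite /mellin_integrand; ring.
  by apply: cintegrableD => //; exact: cintegrableZ.
have ff t : 0 < t -> normc (cpow t (s + h) - cpow t s - (ln t)%:C * cpow t s * h) <=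
    4 * normc h ^+ 2 * expln (normc s + 3) t.
  by move=> _; exact: cpow_second_order.
have B0 : 0 <= 4 * normc h ^+ 2 by rewrite mulr_ge0// sqr_ge0.
apply: le_trans (@normc_cintegral_le _ _
  (fun t => normc h ^+ 2 * (4 * C * (expln (-1) t / t))) _ _ _) _.
- exact: (rapid_cintegrable rg mrem B0 ff).
- apply: eq_integrable (integrable_explnZ (normc h ^+ 2 * (4 * C))) => // t _ /=.
  by rewrite -!mulrA.
- move=> t t0; rewrite normc_mellin_term//.
  have e : expln 1 t * expln (-1) t = 1 by rewrite -explnD subrr /expln mul0r expR0.
  have p1 := expln_gt0 (-1) t; have := HC t t0; rewrite explnD => hC.
  have ti : 0 <= t^-1 by rewrite invr_ge0 ltW.
  rewrite [leRHS](_ : _ = 4 * normc h ^+ 2 * C * expln (-1) t / t); last by ring.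
  apply: ler_wpM2r => //.
  apply: (@le_trans _ _ (`|g t| * (4 * normc h ^+ 2 * expln (normc s + 3) t))).
    by apply: ler_wpM2l => //; exact: ff.
  have -> : `|g t| * (4 * normc h ^+ 2 * expln (normc s + 3) t) =
     4 * normc h ^+ 2 * (`|g t| * (expln (normc s + 3) t * expln 1 t)) * expln (-1) t.
    by rewrite -[LHS]mulr1 -[X in _ * X = _]e; ring.
  by rewrite ler_pM2r//; exact: ler_wpM2l.
rewrite RintegralZl//; last exact: integrable_explnZ.
by rewrite mulrCA mulrC.
Qed.

End MellinEntire.

(** * Complex derivatives *)

Section ComplexDerivative.
Context {R : realType}.
Import Normc.
Implicit Types (f g : R[i] -> R[i]) (z s w h : R[i]).

Definition cdiff f z : Prop := derivable (f : R[i]^o -> R[i]^o) z 1.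

Lemma normCE (z : R[i]^o) : `|z| = (normc z)%:C.
Proof. by []. Qed.

Lemma cdiff_second_order f z L (K : R) :
  (forall h, normc h <= 1 -> normc (f (z + h) - f z - L * h) <= K * normc h ^+ 2) ->
  cdiff f z.
Proof.
move=> H; apply: (cvgP (L : R[i]^o)); apply/cvgrPdist_le => e e0.
have [k k0 ek] : exists2 k : R, 0 < k & e = k%:C.
  case: e e0 => a b; rewrite ltcE /= => /andP[/eqP -> a0]; by exists a.
have K0 : 0 <= K.
  by have := H 1; rewrite normc1 expr1n !mulr1 => /(_ (lexx _)); exact: le_trans (normc_ge0 _).
(* Dividing by [K + 1] rather than [K] covers the case [K = 0]. *)
pose d := Num.min 1 (k / (K + 1)).
have K1 : 0 < K + 1 by rewrite ltr_wpDl.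
have d0 : 0 < d by rewrite /d lt_min ltr01 divr_gt0.
have dC0 : (0 : R[i]) < d%:C by rewrite ltcR.
near=> h.
have hn0 : h != 0 by near: h; exact: nbhs_dnbhs_neq.
have hd : `|h| <= d%:C by near: h; exact: dnbhs0_le.
rewrite normCE lecR in hd.
have [h1 hk] : normc h <= 1 /\ normc h <= k / (K + 1).
  by move: hd; rewrite /d le_min => /andP[].
rewrite normCE ek lecR /= scaler1.
have -> : L - h^-1 *: (f (h + z) - f z) = - (h^-1 * (f (z + h) - f z - L * h)).
  by rewrite [h + z]addrC [L * h]mulrC mulrBr opprB mulKf.
have np : 0 < normc h.
  by rewrite lt_neqAle normc_ge0 andbT eq_sym; apply: contra hn0 => /eqP/eq0_normc ->.
rewrite normcN normcM normcV mulrC ler_pdivrMr//.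
apply: le_trans (H h h1) _; rewrite expr2 mulrA ler_pM2r//.
apply: (@le_trans _ _ ((K + 1) * normc h)); first by rewrite ler_pM2r// lerDl.
by rewrite mulrC -ler_pdivlMr.
Unshelve. all: by end_near. Qed.

Lemma cdiffD f g z : cdiff f z -> cdiff g z -> cdiff (fun w => f w + g w) z.
Proof. exact: (@derivableD _ R[i]^o R[i]^o (f : R[i]^o -> R[i]^o) g z 1). Qed.

Lemma cdiffM f g z : cdiff f z -> cdiff g z -> cdiff (fun w => f w * g w) z.
Proof. exact: (@derivableM _ R[i]^o (f : R[i]^o -> R[i]^o) g z 1). Qed.

Lemma cdiff_cst k z : cdiff (fun=> k) z.
Proof. exact: derivable_cst. Qed.

Lemma cdiff_id z : cdiff id z.
Proof. exact: derivable_id. Qed.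

Lemma cdiffV f z : f z != 0 -> cdiff f z -> cdiff (fun w => (f w)^-1) z.
Proof. exact: (@derivableV _ R[i]^o (f : R[i]^o -> R[i]^o) z 1). Qed.

Lemma cdiff_comp f g z : cdiff f z -> cdiff g (f z) -> cdiff (g \o f) z.
Proof.
move=> /(@derivable1_diffP _ R[i]^o) df /(@derivable1_diffP _ R[i]^o) dg.
apply/(@derivable1_diffP _ R[i]^o).
exact: (@differentiable_comp _ R[i]^o R[i]^o R[i]^o f g z df dg).
Qed.

Lemma cdiff_affine f a b z : cdiff f (a * z + b) -> cdiff (fun w => f (a * w + b)) z.
Proof.
move=> df; apply: (@cdiff_comp (fun w => a * w + b) f z _ df).
exact: (cdiffD (cdiffM (@cdiff_cst a z) (@cdiff_id z)) (@cdiff_cst b z)).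
Qed.

Lemma eq_cdiff f g z : (forall w, f w = g w) -> cdiff f z -> cdiff g z.
Proof. by move=> /funext ->. Qed.

Lemma near_neq z k : z != k -> \forall w \near (z : R[i]^o), w != k.
Proof.
move=> zk; have d0 : 0 < `|z - k : R[i]^o| by rewrite normr_gt0 subr_eq0.
exists (`|z - k : R[i]^o|) => //= w /=; apply: contraL => /eqP ->.
by rewrite ltxx.
Qed.

Lemma cdiff_cpow (t : R) z : cdiff (fun s => cpow t s) z.
Proof.
apply: (@cdiff_second_order _ _ ((ln t)%:C * cpow t z) (4 * expln (normc z + 3) t)) => h h1.
apply: le_trans (cpow_second_order t z h1) _.
by rewrite mulrAC.
Qed.

Lemma cdiff_mellin (g : R -> R) z : rapid g -> cdiff (mellin g) z.
Proof.
by move=> /(@mellin_second_order _ _ z) [L [K H]]; exact: cdiff_second_order H.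
Qed.

End ComplexDerivative.

(** * The Mellin transform of the indicator of a segment *)

Section MellinSegment.
Context {R : realType}.
Import Normc.
Local Notation mu := (@lebesgue_measure R).
Local Notation pos := (`]0, +oo[%classic : set R).
Implicit Types (z s w : R[i]) (t : R).
Hint Resolve mpos mposL : core.

(** The function is the real part of a constant times [t^(p+iq)]. Keeping both [a] and [b] makes the
    family stable under differentiation, so one formula yields both parts of the integral. *)
Lemma is_derive_cpow_primitive (p q a b t : R) : 0 < t ->
  is_derive t 1 (fun t => expR (p * ln t) * (a * cos (q * ln t) + b * sin (q * ln t)))
   (t^-1 * (expR (p * ln t) * ((p * a + q * b) * cos (q * ln t) +
     (p * b - q * a) * sin (q * ln t)))).
Proof.
move=> t0; have D := is_derive1_ln t0.
have D1 (k : R) : is_derive t 1 (fun t => k * ln t) (k * t^-1).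
  by apply: is_deriveZ.
have E : is_derive t 1 (fun t => expR (p * ln t)) (expR (p * ln t) * (p * t^-1)).
  exact: (is_derive1_comp (is_derive_expR _) (D1 p)).
have C : is_derive t 1 (fun t => cos (q * ln t)) (- sin (q * ln t) * (q * t^-1)).
  exact: (is_derive1_comp (is_derive_cos _) (D1 q)).
have S : is_derive t 1 (fun t => sin (q * ln t)) (cos (q * ln t) * (q * t^-1)).
  exact: (is_derive1_comp (is_derive_sin _) (D1 q)).
have C1 : is_derive t 1 (fun t => a * cos (q * ln t)) (a * (- sin (q * ln t) * (q * t^-1))).
  by apply: is_deriveZ.
have S1 : is_derive t 1 (fun t => b * sin (q * ln t)) (b * (cos (q * ln t) * (q * t^-1))).
  by apply: is_deriveZ.
apply: (is_derive_eq (is_deriveM E (is_deriveD C1 S1))).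
by rewrite !fctE /= /GRing.scale /=; ring.
Qed.

Lemma Rintegral_cpow_segment (p q a b u v : R) : 0 < u -> u < v ->
  \int[mu]_(t in `[u, v]) (t^-1 * (expR (p * ln t) *
    ((p * a + q * b) * cos (q * ln t) + (p * b - q * a) * sin (q * ln t)))) =
  expR (p * ln v) * (a * cos (q * ln v) + b * sin (q * ln v)) -
  expR (p * ln u) * (a * cos (q * ln u) + b * sin (q * ln u)).
Proof.
move=> u0 uv.
pose F a b t := expR (p * ln t) * (a * cos (q * ln t) + b * sin (q * ln t)).
have DF a1 b1 t : 0 < t -> derivable (F a1 b1) t 1.
  by move=> t0; apply: ex_derive; exact: is_derive_cpow_primitive.
have CF a1 b1 t : 0 < t -> {for t, continuous (F a1 b1)}.
  by move=> t0; apply: differentiable_continuous; apply/derivable1_diffP; exact: DF.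
have pv t : u <= t -> 0 < t by exact: lt_le_trans.
rewrite /Rintegral (@continuous_FTC2 _ _ (F a b))//.
- apply: continuous_in_subspaceT => t /[!inE]; rewrite /= in_itv /= => /andP[/pv t0 _].
  apply: (@cvgM _ _ _ _ (fun t => t^-1) (F (p * a + q * b) (p * b - q * a))).
    by apply: inv_continuous; rewrite gt_eqF.
  exact: CF.
- split.
  + by move=> t; rewrite in_itv /= => /andP[/ltW/pv t0 _]; exact: DF.
  + by apply: cvg_at_right_filter; exact: CF.
  + by apply: cvg_at_left_filter; apply: CF; exact: lt_trans uv.
- move=> t; rewrite in_itv /= => /andP[/ltW/pv t0 _]; rewrite derive1E.
  by have [_ ->] := is_derive_cpow_primitive p q a b t0.
Qed.

Lemma Rintegral_indic (A : set R) (h : R -> R) : A `<=` pos ->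
  \int[mu]_(t in pos) (\1_A t * h t) = \int[mu]_(t in A) h t.
Proof.
move=> Ap; rewrite -(setIidr Ap) [RHS]Rintegral_mkcondr; apply: eq_Rintegral => t _.
by rewrite patchE indicE setIidr//; case: (t \in A); rewrite ?mul1r ?mul0r.
Qed.

Lemma mellin_indicE (A : set R) s : mellin \1_A s =
  (\int[mu]_(t in pos) (\1_A t * (t^-1 * (expR (complex.Re s * ln t) *
     cos (complex.Im s * ln t))))) +i*
  (\int[mu]_(t in pos) (\1_A t * (t^-1 * (expR (complex.Re s * ln t) *
     sin (complex.Im s * ln t))))).
Proof.
rewrite /mellin /cintegral0y; congr (_ +i* _); apply: eq_Rintegral => t _;
  rewrite /mellin_integrand -realcV /cpow /cexp !Re_mulr_real !Im_mulr_real;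
  by move: (\1_A t) (t^-1) => x y; rewrite /=; ring.
Qed.

Lemma rapid_segment (u v : R) : 0 < u -> rapid (\1_`[u, v] : R -> R).
Proof.
move=> u0; split; first exact: measurable_indic.
move=> a; exists (expR (`|a| * (`|ln u| + `|ln v|))) => t t0.
rewrite indicE; have [|_] := boolP (t \in _); last by rewrite normr0 mul0r expR_ge0.
rewrite inE /= in_itv /= => /andP[ut tv]; rewrite normr1 mul1r ler_expR.
apply: le_trans (ler_norm _) _; rewrite normrM normr_id ler_wpM2l//.
have v0 : 0 < v by exact: lt_le_trans tv.
have l1 : ln u <= ln t by rewrite ler_ln.
have l2 : ln t <= ln v by rewrite ler_ln.
rewrite ler_norml; have := ler_norm (ln v); have := ler_norm (- ln u); rewrite normrN.
by have := normr_ge0 (ln v); have := normr_ge0 (ln u); lra.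
Qed.

Lemma mellin_segment (u v : R) s : 0 < u -> u <= v -> s != 0 ->
  mellin \1_`[u, v] s = (cpow v s - cpow u s) / s.
Proof.
rewrite le_eqVlt => u0 /orP[/eqP <-|uv] s0.
  rewrite subrr mul0r mellin_indicE !Rintegral_indic ?set_itv1.
  - by rewrite /Rintegral !integral_set1.
  - by move=> _ ->; exact/posP.
  - by move=> _ ->; exact/posP.
have sub : `[u, v]%classic `<=` pos.
  by move=> t /=; rewrite !in_itv /= andbT => /andP[ut _]; exact: lt_le_trans ut.
rewrite mellin_indicE !Rintegral_indic//.
case: s s0 => p q s0.
have N0 : p ^+ 2 + q ^+ 2 != 0.
  apply: contra s0; rewrite paddr_eq0 ?sqr_ge0// !sqrf_eq0 => /andP[/eqP -> /eqP ->].
  by [].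
apply: (mulIf s0); rewrite mulfVK//.
(* The coefficients are the real and imaginary parts of [1/s] up to sign; this choice leaves the
   pure cosine, the next one the pure sine. *)
have := Rintegral_cpow_segment p q (p / (p ^+ 2 + q ^+ 2)) (q / (p ^+ 2 + q ^+ 2)) u0 uv.
have -> : p * (p / (p ^+ 2 + q ^+ 2)) + q * (q / (p ^+ 2 + q ^+ 2)) = 1 by field.
have -> : p * (q / (p ^+ 2 + q ^+ 2)) - q * (p / (p ^+ 2 + q ^+ 2)) = 0 by field.
under eq_Rintegral do rewrite mul1r mul0r addr0.
have := Rintegral_cpow_segment p q (- q / (p ^+ 2 + q ^+ 2)) (p / (p ^+ 2 + q ^+ 2)) u0 uv.
have -> : p * (- q / (p ^+ 2 + q ^+ 2)) + q * (p / (p ^+ 2 + q ^+ 2)) = 0 by field.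
have -> : p * (p / (p ^+ 2 + q ^+ 2)) - q * (- q / (p ^+ 2 + q ^+ 2)) = 1 by field.
under eq_Rintegral do rewrite mul1r mul0r add0r.
rewrite /= => -> ->; rewrite /cpow /cexp !Re_mulr_real !Im_mulr_real /=.
by apply/eqP; rewrite eq_complex /=; apply/andP; split; apply/eqP; field.
Qed.

End MellinSegment.

(** * Rules for Mellin transforms *)

Section MellinCalculus.
Context {R : realType}.
Import Normc.
Local Notation mu := (@lebesgue_measure R).
Local Notation pos := (`]0, +oo[%classic : set R).
Implicit Types (g h : R -> R) (z s w : R[i]) (t : R).
Hint Resolve mpos mposL : core.

Lemma eq_mellin g h s : (forall t, 0 < t -> g t = h t) -> mellin g s = mellin h s.
Proof. by move=> gh; apply: eq_cintegral => t t0; rewrite /mellin_integrand gh. Qed.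

Lemma eq_mellin_integrable g h s : (forall t, 0 < t -> g t = h t) ->
  mellin_integrable g s -> mellin_integrable h s.
Proof.
by move=> gh; apply: eq_cintegrable => t t0; rewrite /mellin_integrand gh.
Qed.

Lemma mellin_integrandD g h s t :
  mellin_integrand (fun t => g t + h t) s t = mellin_integrand g s t + mellin_integrand h s t.
Proof. by rewrite /mellin_integrand raddfD /= !mulrDl. Qed.

Lemma mellin_integrableD g h s : mellin_integrable g s -> mellin_integrable h s ->
  mellin_integrable (fun t => g t + h t) s.
Proof.
move=> ig ih; apply: eq_cintegrable (cintegrableD ig ih) => t _.
by rewrite mellin_integrandD.
Qed.

Lemma mellinD g h s : mellin_integrable g s -> mellin_integrable h s ->
  mellin (fun t => g t + h t) s = mellin g s + mellin h s.
Proof.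
move=> ig ih; rewrite -[RHS]cintegralD//.
by apply: eq_cintegral => t _; rewrite mellin_integrandD.
Qed.

Lemma mellin_integrandZ g k s t :
  mellin_integrand (fun t => k * g t) s t = k%:C * mellin_integrand g s t.
Proof. by rewrite /mellin_integrand realcM -!mulrA. Qed.

Lemma mellin_integrableZ g (k : R) s : mellin_integrable g s ->
  mellin_integrable (fun t => k * g t) s.
Proof.
move=> ig; apply: eq_cintegrable (cintegrableZ k%:C ig) => t _.
by rewrite mellin_integrandZ.
Qed.

Lemma mellinZ g (k : R) s : mellin_integrable g s ->
  mellin (fun t => k * g t) s = k%:C * mellin g s.
Proof.
move=> ig; rewrite -[RHS]cintegralZ//.
by apply: eq_cintegral => t _; rewrite mellin_integrandZ.
Qed.

Lemma mellin_integrand_shift g (a : R) s t :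
  mellin_integrand (fun t => expR (a * ln t) * g t) s t = mellin_integrand g (s + a%:C) t.
Proof. by rewrite /mellin_integrand cpowD cpow_real realcM; ring. Qed.

Lemma mellin_integrable_shift g (a : R) s : mellin_integrable g (s + a%:C) ->
  mellin_integrable (fun t => expR (a * ln t) * g t) s.
Proof. by apply: eq_cintegrable => t _; rewrite mellin_integrand_shift. Qed.

Lemma mellin_shift g (a : R) s :
  mellin (fun t => expR (a * ln t) * g t) s = mellin g (s + a%:C).
Proof. by apply: eq_cintegral => t _; rewrite mellin_integrand_shift. Qed.

Lemma mellin_pow_sub g (p q : R) s : p != 0 -> measurable_fun pos g ->
  mellin_integrable g (s / p%:C) ->
  mellin_integrable (fun t => g (expR (p * ln t + q))) s /\
  mellin (fun t => g (expR (p * ln t + q))) s =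
  (`|p|^-1)%:C * cexp (- (s * (q / p)%:C)) * mellin g (s / p%:C).
Proof.
move=> p0 mg ig; set k := cexp _.
have pC : p%:C != 0 by rewrite eq_complex /= eqxx andbT.
(* The constant [k] is put inside so that the substitution turns [f] exactly into the integrand at
   [s]. *)
pose f t := k * ((g t)%:C * cpow t (s / p%:C)).
have mf : cmeasurable f.
  apply: cmeasurableM; first exact: cmeasurable_cst.
  by apply: cmeasurableM; [exact: cmeasurable_real|exact: cmeasurable_cpow].
have fE t : k * mellin_integrand g (s / p%:C) t = f t / t%:C.
  by rewrite /f /mellin_integrand !mulrA.
have [|i2 e2] := @cintegral_pos_sub R f p q p0 mf.
  by apply: eq_cintegrable (cintegrableZ k ig) => t _; rewrite fE.
have E t : f (expR (p * ln t + q)) / t%:C =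
    mellin_integrand (fun t => g (expR (p * ln t + q))) s t.
  rewrite /f /mellin_integrand cpow_expR mulrCA -cexpD /cpow; congr (_ * cexp _ / _).
  by rewrite raddfD /= !realcM realcV; field.
split; first by apply: eq_cintegrable i2 => t _; rewrite E.
rewrite -mulrA -cintegralZ//.
transitivity (cintegral0y (fun t => f (expR (p * ln t + q)) / t%:C)).
  by apply: eq_cintegral => t _; rewrite E.
by rewrite e2; congr (_ * _); apply: eq_cintegral => t _; rewrite fE.
Qed.

Lemma mellin_dilate g (c : R) s : 0 < c -> measurable_fun pos g ->
  mellin_integrable g s ->
  mellin_integrable (fun t => g (c * t)) s /\
  mellin (fun t => g (c * t)) s = cpow c (- s) * mellin g s.
Proof.
move=> c0 mg ig.
have E t : 0 < t -> g (expR (1 * ln t + ln c)) = g (c * t).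
  by move=> t0; rewrite mul1r expRD !lnK// mulrC.
have sE : s / (1 : R)%:C = s by exact: divr1.
have [||i e] := @mellin_pow_sub g 1 (ln c) s _ mg; rewrite ?oner_eq0 ?sE//.
split; first exact: eq_mellin_integrable E i.
by rewrite -(eq_mellin s E) e normr1 invr1 mul1r mulr1 sE /cpow mulNr.
Qed.

Lemma mellin_inv g s : measurable_fun pos g -> mellin_integrable g (- s) ->
  mellin_integrable (fun t => g t^-1) s /\ mellin (fun t => g t^-1) s = mellin g (- s).
Proof.
move=> mg ig.
have E t : 0 < t -> g (expR (-1 * ln t + 0)) = g t^-1.
  by move=> t0; rewrite addr0 mulN1r expRN lnK.
have sE : s / (-1 : R)%:C = - s by rewrite raddfN /= invrN invr1 mulrN1.
have [||i e] := @mellin_pow_sub g (-1) 0 s _ mg; rewrite ?oppr_eq0 ?oner_eq0 ?sE//.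
split; first exact: eq_mellin_integrable E i.
by rewrite -(eq_mellin s E) e normrN normr1 invr1 mul1r mul0r mulr0 oppr0 cexp0 mul1r sE.
Qed.

(** Scaling and reflecting intervals produces indicators that disagree at an endpoint; this removes
    the discrepancy. *)
Lemma eq_mellin_but1 g h (x : R) s : measurable_fun pos g -> measurable_fun pos h ->
  (forall t, 0 < t -> t != x -> g t = h t) -> mellin g s = mellin h s.
Proof.
move=> mg mh gh.
have [g1 g2] := cmeasurable_mellin mg (cmeasurable_cpow s).
have [h1 h2] := cmeasurable_mellin mh (cmeasurable_cpow s).
have ae (u v : R -> R) : (forall t, 0 < t -> t != x -> u t = v t) ->
    measurable_fun pos u -> measurable_fun pos v ->
    \int[mu]_(t in pos) u t = \int[mu]_(t in pos) v t.
  move=> uv mu_ mv; rewrite /Rintegral; congr fine; apply: ae_eq_integral => //.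
  - exact/measurable_EFinP.
  - exact/measurable_EFinP.
  exists [set x]; split => //; first exact: lebesgue_measure_set1.
  move=> t /= /not_implyP[/posP t0 ne]; apply/eqP; apply: contra_notT ne => tx.
  by rewrite uv.
by rewrite /mellin /cintegral0y; congr (_ +i* _); apply: ae => // t t0 tx;
  rewrite /mellin_integrand gh.
Qed.

End MellinCalculus.

(** * The Mellin transform of the indicator of the unit interval *)

Section MellinUnit.
Context {R : realType}.
Import Normc.
Local Notation pos := (`]0, +oo[%classic : set R).
Implicit Types (g h : R -> R) (z s w : R[i]) (t : R).
Hint Resolve mpos mposL : core.

Lemma indic_unitE t : 0 < t -> \1_(`]0, 1]%classic : set R) t = (t <= 1)%R%:R :> R.
Proof.
move=> t0; rewrite indicE; congr (nat_of_bool _)%:R.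
by apply/idP/idP; rewrite inE /= in_itv /= t0.
Qed.

(** The indicator does not vanish near 0, so decay is of no help. The substitution [t -> t^(Re s)]
    reduces to exponent 1, where the integrand is at most [expln (-1) t / t]. *)
Lemma mellin_integrable_unit s : 0 < complex.Re s ->
  mellin_integrable \1_(`]0, 1]%classic : set R) s.
Proof.
move=> s0; set u : R -> R := \1__.
have mu_ : measurable_fun pos u by exact: measurable_indic.
have mu1 : measurable_fun pos (fun t => u t * t) by exact: measurable_funM.
have [|iu _] := integrable_pos_sub 0 (lt0r_neq0 s0) mu1.
  apply: (le_integrable _ _ _ integrable_expln) => //.
    by apply/measurable_EFinP; apply: measurable_funM => //; exact: measurable_inv_pos.
  move=> t /posP t0 /=; rewrite lee_fin mulfK ?gt_eqF// /u indic_unitE//.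
  have := leP t 1; case=> t1; last by rewrite normr0.
  have -> : expln (-1) t = t by rewrite /expln ler0_norm ?ln_le0// mulN1r opprK lnK.
  by rewrite divff ?gt_eqF// normr1.
apply: cintegrable_le iu _; first by apply: cmeasurable_mellin => //; exact: cmeasurable_cpow.
move=> t t0; rewrite normc_mellin_term// normc_cpow addr0 /u !indic_unitE ?expR_gt0//.
have [t1|t1] := leP t 1; last by rewrite normr0 !mul0r mulr_ge0 ?invr_ge0 ?(ltW t0)// mulr_ge0 ?expR_ge0.
rewrite (_ : expR _ <= 1 = true) ?normr1//.
by rewrite -[X in _ <= X]expR0 ler_expR pmulr_rle0// ln_le0.
Qed.

(* Scaling [t] by [e] gives [I = e^-s I + (1 - e^-s) / s]. *)
Lemma mellin_unit s : 0 < complex.Re s ->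
  mellin \1_(`]0, 1]%classic : set R) s = s^-1.
Proof.
move=> s0; set u : R -> R := \1__.
have iu : mellin_integrable u s by exact: mellin_integrable_unit.
have mu_ : measurable_fun pos u by exact: measurable_indic.
have e0 : 0 < expR 1 :> R by exact: expR_gt0.
have [id ed] := mellin_dilate e0 mu_ iu.
have e1 : expR (-1) < 1 :> R by rewrite expR_lt1 oppr_lt0.
pose v : R -> R := \1_`[expR (-1), 1].
have vn : rapid v by apply: rapid_segment; exact: expR_gt0.
have iv : mellin_integrable v s by exact: rapid_mellin_integrable.
have sn0 : s != 0 by apply: contraTneq s0 => ->; rewrite ltxx.
have ev := mellin_segment (expR_gt0 (-1)) (ltW e1) sn0.
have sum : mellin u s = mellin (fun t => u (expR 1 * t) + v t) s.
  apply: (@eq_mellin_but1 _ _ _ (expR (-1))) => //.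
    apply: measurable_funD; last by case: vn.
    apply: (measurable_comp _ _ mu_) => //.
    by move=> _ [t /posP t0 <-]; apply/posP; exact: mulr_gt0.
  move=> t t0 te; rewrite /u !indic_unitE ?mulr_gt0// /v indicE.
  have -> : (expR 1 * t <= 1) = (t <= expR (-1)) by rewrite mulrC -ler_pdivlMr// mul1r expRN.
  have -> : (t \in `[expR (-1), 1]%classic) = (expR (-1) <= t <= 1).
    by apply/idP/idP; rewrite inE /= in_itv.
  have [t1|t1|/eqP] := ltgtP t (expR (-1)); last by rewrite (negbTE te).
    by rewrite (le_trans (ltW t1) (ltW e1)) /= addr0.
  by rewrite add0r.
set I := mellin u s; set k := cpow (expR 1) (- s).
have IE : I = k * I + (1 - k) / s.
  rewrite {1}/I sum mellinD// ed ev cpow1l; congr (_ + (1 - _) / _).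
  by rewrite /k !cpow_expR mulNr raddfN mulrN.
(* The modulus of [k] is [exp(-Re s) < 1]. *)
have k1 : 1 - k != 0.
  apply/eqP => /eqP; rewrite subr_eq0 => /eqP/(congr1 (@normc R)).
  rewrite normc1 normc_cpow expRK mulr1; case: (s) s0 => a b /= a0.
  move=> e; have : expR (- a) < 1 by rewrite expR_lt1 oppr_lt0.
  by rewrite -e ltxx.
apply: (mulfI k1); rewrite -[RHS]/((1 - k) / s).
by apply/eqP; rewrite mulrBl mul1r subr_eq addrC; apply/eqP.
Qed.

End MellinUnit.

(** * Continuation and the Bessel series *)

Section ThetaMellin.
Context {R : realType}.
Import Normc.
Local Notation A := (@sqrt_theta1 R).
Implicit Types (z s w : R[i]) (t : R).
Hint Resolve mpos mposL : core.

(** On [t >= 1] the even powers in [majorant_decay] suffice. [B] is left open because the open and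
    the closed half line both occur. *)
Lemma rapid_sqrt_theta1_ge1 (B : set R) : measurable B ->
  (forall t, B t -> 1 <= t) -> rapid (fun t => \1_B t * A t).
Proof.
move=> mB B1; split.
  by apply: measurable_funM; [exact: measurable_indic|exact: measurable_sqrt_theta1].
move=> a; have [k ak] : exists k : nat, a <= k%:R.
  by exists (Num.truncn `|a|).+1; apply: le_trans (ler_norm _) (ltW (truncnS_gt _)).
have [K K0 HK] := @majorant_decay R k.
exists K => t t0; rewrite indicE; have [|_] := boolP (t \in B); last first.
  by rewrite mul0r normr0 mul0r ltW.
rewrite inE => /B1 t1; rewrite mul1r ger0_norm ?sqrt_theta1_ge0//.
apply: le_trans (HK t t0); apply: ler_pM; rewrite ?sqrt_theta1_ge0 ?expR_ge0 ?sqrt_theta1_le//.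
rewrite /expln ger0_norm ?ln_ge0// -[in leRHS](lnK t0) -expRM_natl ler_expR ler_wpM2r ?ln_ge0//.
by apply: le_trans ak _; rewrite ler_nat; lia.
Qed.

Definition theta_tail t : R := \1_`]1, +oo[ t * A t.

Lemma rapid_theta_tail : rapid theta_tail.
Proof.
apply: rapid_sqrt_theta1_ge1; first exact: measurable_itv.
by move=> t /=; rewrite in_itv /= andbT => /ltW.
Qed.

(** Riemann's splitting of the integral at [t = 1], with the part near 0 folded onto the tail. *)
Definition Z_entire s : R[i] := mellin theta_tail s + mellin theta_tail (1 / 2 - s).
Definition Z_half s : R[i] := Z_entire s + ((s - 1 / 2)^-1 - s^-1).

Lemma sqrtr_expR t : 0 < t -> Num.sqrt t = expR (2^-1 * ln t).
Proof.
move=> t0; rewrite -{1}(lnK t0); apply/eqP.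
rewrite -(@eqrXn2 _ 2)// ?sqrtr_ge0 ?expR_ge0// sqr_sqrtr ?expR_ge0//.
by rewrite -expRM_natl mulrA mulfV// mul1r.
Qed.

(** For [t <= 1] inversion reads [A(t) = t^(-1/2) A(1/t) + t^(-1/2) - 1]; the last two terms produce
    the poles at [1/2] and 0. *)
Lemma sqrt_theta1_split t : 0 < t ->
  A t = theta_tail t + expR (- 2^-1 * ln t) * (\1_`[1, +oo[ t^-1 * A t^-1)
   + (expR (- 2^-1 * ln t) * \1_`]0, 1] t + (- 1) * \1_`]0, 1] t).
Proof.
move=> t0; have ti0 : 0 < t^-1 by rewrite invr_gt0.
have i1 : \1_`]1, +oo[ t = (1 < t)%R%:R :> R.
  rewrite indicE; congr (nat_of_bool _)%:R.
  by apply/idP/idP; rewrite inE /= in_itv /= andbT.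
have i2 : \1_`[1, +oo[ t^-1 = (t <= 1)%R%:R :> R.
  rewrite indicE; congr (nat_of_bool _)%:R.
  rewrite -invf_ge1//.
  by apply/idP/idP; rewrite inE /= in_itv /= andbT.
rewrite /theta_tail i1 i2 indic_unitE//.
have [t1|t1] := leP t 1; last by rewrite mul1r !(mul0r, mulr0) !addr0.
rewrite mul0r add0r mul1r !mulr1 {1}/A -{1}[t]invrK sqrt_theta_inversion//.
rewrite sqrtr_expR// lnV// mulrN -mulNr /A; ring.
Qed.

Lemma ReD_real z (a : R) : complex.Re (z + a%:C) = complex.Re z + a.
Proof. by case: z. Qed.

Lemma mellin_sqrt_theta1 s : 1 / 2 < complex.Re s ->
  mellin_integrable A s /\ mellin A s = Z_half s.
Proof.
move=> s12; have s0 : 0 < complex.Re s by apply: lt_trans s12; rewrite divr_gt0.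
pose g2 t : R := \1_`[1, +oo[ t * A t.
have r2 : rapid g2.
  apply: rapid_sqrt_theta1_ge1; first exact: measurable_itv.
  by move=> t /=; rewrite in_itv /= andbT.
have r1 := rapid_theta_tail.
pose s' := s + (- 2^-1)%:C.
have half : 1 / 2 = (2^-1)%:C :> R[i] by rewrite div1r realcV rmorph_nat.
have s'E : s' = s - 1 / 2 by rewrite half /s' raddfN.
have s'0 : 0 < complex.Re s' by rewrite ReD_real; lra.
have [i2 e2] := mellin_inv r2.1 (rapid_mellin_integrable (- s') r2).
have i1 := rapid_mellin_integrable s r1.
have iu := mellin_integrable_unit s0.
have iu' := mellin_integrable_unit s'0.
have I2 := mellin_integrable_shift i2.
have I3 := mellin_integrableD (mellin_integrable_shift iu') (mellin_integrableZ (-1) iu).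
have I := mellin_integrableD (mellin_integrableD i1 I2) I3.
split.
  by apply: eq_mellin_integrable I => t t0; rewrite [RHS]sqrt_theta1_split.
rewrite (eq_mellin s sqrt_theta1_split).
rewrite (mellinD (mellin_integrableD i1 I2) I3) (mellinD i1 I2).
rewrite (mellinD (mellin_integrable_shift iu') (mellin_integrableZ (-1) iu)).
rewrite mellinZ// !mellin_shift !mellin_unit// e2 -/s' s'E opprB.
rewrite raddfN /= mulN1r /Z_half /Z_entire; congr (_ + _ + _).
(* The reflected piece lives on the closed half line and [theta_tail] on the open one; they differ
   only at [t = 1]. *)
apply: (@eq_mellin_but1 _ _ _ 1); [exact: r2.1|exact: r1.1|].
move=> t t0 t1; rewrite /g2 /theta_tail !indicE; congr ((nat_of_bool _)%:R * _).
by apply/idP/idP; rewrite !inE /= !in_itv /= !andbT; [rewrite le_eqVlt eq_sym (negbTE t1)|exact: ltW].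
Qed.

Lemma Z_half_reflect s : Z_half (1 / 2 - s) = Z_half s.
Proof.
rewrite /Z_half /Z_entire.
have -> : 1 / 2 - (1 / 2 - s) = s by ring.
have -> : 1 / 2 - s - 1 / 2 = - s by ring.
rewrite invrN -[1 / 2 - s]opprB invrN opprK; ring.
Qed.

End ThetaMellin.

Lemma sum_divisors (V : nmodType) m N (f : nat -> V) : (0 < m <= N)%N ->
  \sum_(d <- divisors m) f d = \sum_(i < N | (i.+1 %| m)%N) f i.+1.
Proof.
move=> /andP[m0 mN]; rewrite -(big_mkord (fun i => i.+1 %| m)%N (fun i => f i.+1)).
rewrite -(@big_add1 _ _ _ 0%N N.+1 (fun d => d %| m)%N f) -[RHS]big_filter.
apply/perm_big/uniq_perm; first exact: divisors_uniq.
  exact/filter_uniq/iota_uniq.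
move=> d; rewrite mem_filter -dvdn_divisors// mem_index_iota.
case: (boolP (d %| m)%N) => //= dm; apply/esym.
by rewrite (dvdn_gt0 m0 dm) ltnS (leq_trans (dvdn_leq m0 dm)).
Qed.

(** Partial sums ordered by [n] become sums over the region under a hyperbola, in the form that
    [sum_region_cvg] handles. *)
Lemma sum_divisors_region (V : nmodType) N (f : nat -> nat -> V) :
  \sum_(1 <= n < N.+1) \sum_(d <- divisors n) f d (n %/ d)%N =
  \sum_(i < N) \sum_(j < N | (i.+1 * j.+1 <= N)%N) f i.+1 j.+1.
Proof.
rewrite big_add1 /= big_mkord.
transitivity (\sum_(n < N) \sum_(i < N) \sum_(j < N | (i.+1 * j.+1 == n.+1)%N) f i.+1 j.+1).
  apply: eq_bigr => n _; rewrite (@sum_divisors _ _ N)//; last by rewrite ltn_ord.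
  rewrite big_mkcond; apply: eq_bigr => i _; case: ifPn => [/dvdnP[[|k] E]//|ni].
    have kN : (k < N)%N by have := ltn_ord n; nia.
    rewrite (big_pred1 (Ordinal kN)) ?E ?mulnK//.
    by move=> j /=; rewrite -val_eqE /= mulnC; nia.
  by apply/esym/big1 => j /eqP E; move: ni; rewrite -E dvdn_mulr.
rewrite exchange_big; apply: eq_bigr => i _.
under eq_bigr do rewrite big_mkcond.
rewrite exchange_big [RHS]big_mkcond; apply: eq_bigr => j _ /=.
case: ifPn => ij.
  have kN : ((i.+1 * j.+1).-1 < N)%N by move: ij; nia.
  rewrite (bigD1 (Ordinal kN))// ifT; last by apply/eqP => /=; lia.
  rewrite big1 => [|n nE]; first exact: addr0.
  case: eqP => // E; case/eqP: nE; apply/val_inj => /=; lia.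
by apply: big1 => n _; case: eqP => // E; move: ij; rewrite E ltn_ord.
Qed.

(** * Limits under the Mellin transform *)

Section BesselSeries.
Context {R : realType}.
Import Normc.
Local Notation mu := (@lebesgue_measure R).
Local Notation pos := (`]0, +oo[%classic : set R).
Implicit Types (z s w : R[i]) (t y : R).
Hint Resolve mpos mposL : core.

Lemma cvg_complex (u v : nat -> R) (a b : R) :
  u @ \oo --> a -> v @ \oo --> b ->
  (fun n => u n +i* v n : R[i]^o) @ \oo --> (a +i* b : R[i]^o).
Proof.
move=> ua vb; apply/cvgrPdist_le => e e0.
have [k k0 ek] : exists2 k : R, 0 < k & e = k%:C.
  by case: e e0 => x x'; rewrite ltcE /= => /andP[/eqP -> x0]; exists x.
have k2 : 0 < k / 2 by rewrite divr_gt0.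
near=> n.
have h1 : `|a - u n| <= k / 2 by near: n; move/cvgrPdist_le: ua; apply.
have h2 : `|b - v n| <= k / 2 by near: n; move/cvgrPdist_le: vb; apply.
rewrite normCE ek lecR; apply: le_trans (normc_le _) _ => /=; lra.
Unshelve. all: by end_near. Qed.

Lemma mellin_cvg (u : nat -> R -> R) (v : R -> R) s :
  (forall n, measurable_fun pos (u n)) -> measurable_fun pos v ->
  (forall t, 0 < t -> u ^~ t @ \oo --> v t) ->
  (forall a, exists C, forall n t, 0 < t -> `|u n t| * expln a t <= C) ->
  (fun n => mellin (u n) s : R[i]^o) @ \oo --> (mellin v s : R[i]^o).
Proof.
move=> mu_ mv uv ub; have [C HC] := ub (normc s + 1).
have dom n t : 0 < t -> normc (mellin_integrand (u n) s t) <= C * (expln (-1) t / t).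
  move=> t0; rewrite normc_mellin_term//.
  have := HC n t t0; rewrite explnD => h.
  have e : expln 1 t * expln (-1) t = 1 by rewrite -explnD subrr /expln mul0r expR0.
  have p1 := expln_gt0 (-1) t.
  have ti : 0 <= t^-1 by rewrite invr_ge0 ltW.
  rewrite mulrA; apply: ler_wpM2r => //.
  apply: (@le_trans _ _ (`|u n t| * expln (normc s) t)).
    by apply: ler_wpM2l => //; exact: normc_cpow_le.
  by rewrite -[leLHS]mulr1 -[X in _ * X <= _]e mulrA ler_pM2r// -mulrA.
have dc (f : nat -> R -> R) (g : R -> R) :
    (forall n, measurable_fun pos (f n)) -> measurable_fun pos g ->
    (forall t, 0 < t -> f ^~ t @ \oo --> g t) ->
    (forall n t, 0 < t -> `|f n t| <= C * (expln (-1) t / t)) ->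
    (fun n => \int[mu]_(t in pos) f n t) @ \oo --> \int[mu]_(t in pos) g t.
  move=> mf mg fg fC.
  have [|||||ig _ H] := @dominated_convergence _ _ _ mu pos mposL
    (fun n t => (f n t)%:E) (fun t => (g t)%:E) (fun t => (C * (expln (-1) t / t))%:E).
  - by move=> n; apply/measurable_EFinP; exact: mf.
  - by apply/measurable_EFinP; exact: mg.
  - apply: aeW => t /posP t0; apply: cvg_EFin; first exact: nearW.
    exact: fg.
  - exact: integrable_explnZ.
  - by apply: aeW => t n /posP t0; rewrite lee_fin; exact: fC.
  by apply: fine_cvg; rewrite fineK ?integrable_fin_num.
have E n t : mellin_integrand (u n) s t = cpow t s / t%:C * (u n t)%:C.
  by rewrite /mellin_integrand -mulrA mulrC.
have Ev t : mellin_integrand v s t = cpow t s / t%:C * (v t)%:C.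
  by rewrite /mellin_integrand -mulrA mulrC.
have [v1 v2] := cmeasurable_mellin mv (cmeasurable_cpow s).
have M n := cmeasurable_mellin (mu_ n) (cmeasurable_cpow s).
rewrite /mellin /cintegral0y; apply: cvg_complex; apply: dc => //.
- by move=> n; case: (M n).
- by move=> t t0; under eq_fun do rewrite E Re_mulr_real; rewrite Ev Re_mulr_real; apply: cvgM; [exact: cvg_cst|exact: uv].
- by move=> n t t0; apply: le_trans (Re_le_normc _) (dom n t t0).
- by move=> n; case: (M n).
- by move=> t t0; under eq_fun do rewrite E Im_mulr_real; rewrite Ev Im_mulr_real; apply: cvgM; [exact: cvg_cst|exact: uv].
- by move=> n t t0; apply: le_trans (Im_le_normc _) (dom n t t0).
Qed.

End BesselSeries.

(** * Pairs of Gaussians and Bessel functions *)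

Section BesselTerm.
Context {R : realType}.
Import Normc.
Local Notation pos := (`]0, +oo[%classic : set R).
Implicit Types (z s w : R[i]) (t y : R).
Hint Resolve mpos mposL : core.

(** For [t >= 1] the factor at [y/t] grows at most like [t^4], while the one at [y t] decays like
    any power. The product is invariant under [t -> 1/t], which settles [t < 1]. *)
Lemma majorant_prod y a : 0 < y -> exists C, forall t, 0 < t ->
  majorant (y * t) * majorant (y * t^-1) * expln a t <= C.
Proof.
move=> y0; have [k ak] : exists k : nat, a <= k%:R.
  by exists (Num.truncn `|a|).+1; apply: le_trans (ler_norm _) (ltW (truncnS_gt _)).
have [K0 K00 H0] := @majorant_decay R 0; have [K1 K10 H1] := @majorant_decay R k.
have H t : 1 <= t -> majorant (y * t) * majorant (y * t^-1) * expln a t <=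
    K1 * K0 / y ^+ (4 + k.*2 + 4).
  move=> t1; have t0 : 0 < t by exact: lt_le_trans t1.
  have ti0 : 0 < t^-1 by rewrite invr_gt0.
  rewrite ler_pdivlMr ?exprn_gt0//.
  have h1 := H1 (y * t) (mulr_gt0 y0 t0).
  have h0 : majorant (y * t^-1) * (y * t^-1) ^+ 4 <= K0 := H0 (y * t^-1) (mulr_gt0 y0 ti0).
  have M0 x : 0 <= (majorant x : R) := majorant_ge0 x.
  have yt0 : 0 <= y * t by rewrite mulr_ge0 ?ltW.
  have yti0 : 0 <= y * t^-1 by rewrite mulr_ge0 ?ltW.
  have := ler_pM (mulr_ge0 (M0 _) (exprn_ge0 (4 + k.*2) yt0))
     (mulr_ge0 (M0 _) (exprn_ge0 4 yti0)) h1 h0.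
  apply: le_trans.
  rewrite [leRHS](_ : _ = majorant (y * t) * majorant (y * t^-1) *
     (t ^+ k.*2 * y ^+ (4 + k.*2 + 4))); last first.
    rewrite !exprMn !exprVn !exprD; move: (majorant _) (majorant _) => m m'.
    by move: (y ^+ k.*2) (t ^+ k.*2) => Y T; field; rewrite gt_eqF.
  rewrite -[X in X <= _]mulrA; apply: ler_wpM2l; first exact: mulr_ge0.
  apply: ler_wpM2r; first by rewrite exprn_ge0// ltW.
  rewrite /expln ger0_norm ?ln_ge0// -[in leRHS](lnK t0) -expRM_natl ler_expR.
  rewrite ler_wpM2r ?ln_ge0//; apply: le_trans ak _.
  by rewrite ler_nat; lia.
exists (K1 * K0 / y ^+ (4 + k.*2 + 4)) => t t0.
have [t1|t1] := leP 1 t; first exact: H.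
have := H t^-1; rewrite invf_ge1// => /(_ (ltW t1)); rewrite invrK.
by rewrite [majorant _ * majorant _]mulrC /expln lnV// normrN.
Qed.

Definition gauss_pair y (d e : nat) t : R := gaussq (y * t) ^+ d * gaussq (y * t^-1) ^+ e.

Lemma gaussq_ge0 t : 0 <= (gaussq t : R). Proof. exact: expR_ge0. Qed.

Lemma gauss_pair_ge0 y d e t : 0 <= gauss_pair y d e t.
Proof. by rewrite mulr_ge0// exprn_ge0// gaussq_ge0. Qed.

Lemma gaussq_le_majorant t : (gaussq t : R) <= majorant t.
Proof.
rewrite /majorant mulrAC ler_peMl ?gaussq_ge0//.
have : 0 <= (pi * t ^+ 2)^-1 :> R by rewrite invr_ge0 mulr_ge0 ?pi_ge0 ?sqr_ge0.
by move: (_^-1) => x x0; nra.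
Qed.

Lemma measurable_gaussq (f : R -> R) : measurable_fun pos f ->
  measurable_fun pos (fun t => gaussq (f t)).
Proof.
move=> mf.
have m : measurable_fun pos (fun t => pi * f t ^+ 2).
  by apply: measurable_funM => //; apply: measurable_funX.
exact: (measurableT_comp (@measurable_expR R) (measurable_funN m)).
Qed.

Lemma measurable_mulV_pos y : measurable_fun pos (fun t => y * t^-1).
Proof. exact: (measurable_funM (measurable_cst y) measurable_inv_pos). Qed.

Lemma measurable_mul_pos y : measurable_fun pos (fun t : R => y * t).
Proof. by apply: measurable_funTS; exact: mulrl_measurable. Qed.

Lemma measurable_gauss_pair y d e : measurable_fun pos (gauss_pair y d e).
Proof.
by apply: measurable_funM; apply: measurable_funX; apply: measurable_gaussq;
  [exact: measurable_mul_pos|exact: measurable_mulV_pos].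
Qed.

Lemma rapid_gauss_pair y d e : 0 < y -> rapid (gauss_pair y d.+1 e.+1).
Proof.
move=> y0; split; first exact: measurable_gauss_pair.
move=> a; have [C HC] := majorant_prod a y0.
exists C => t t0; rewrite ger0_norm ?gauss_pair_ge0//.
apply: le_trans (HC t t0); rewrite ler_wpM2r ?expR_ge0//.
have h (u : R) n : 0 < u -> gaussq u ^+ n.+1 <= majorant u.
  move=> u0; apply: le_trans (gaussq_le_majorant u).
  rewrite exprS ler_piMr ?gaussq_ge0// exprn_ile1 ?gaussq_ge0//.
  exact: ltW (gaussq_lt1 u0).
apply: ler_pM; rewrite ?exprn_ge0 ?gaussq_ge0// h//; first exact: mulr_gt0.
by rewrite mulr_gt0// invr_gt0.
Qed.

(* Substitute [t^2 = (e / d)^(1/2) / u]. *)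
Lemma mellin_gauss_pair y s (d e : nat) : 0 < y -> (0 < d)%N -> (0 < e)%N ->
  mellin (gauss_pair y d e) (s - 1 / 2) =
  cpow (d * e)%:R (s / 4 - 1 / 8) * cpow d%:R (- (s / 2) + 1 / 4) *
  bessel_K (s / 2 - 1 / 4) (2 * pi * Num.sqrt (d * e)%:R * y ^+ 2).
Proof.
case: d e => [//|d] [//|e] y0 _ _; set T := gauss_pair _ _ _.
have rT : rapid T by exact: rapid_gauss_pair.
set x := 2 * pi * _ * _; set nu := s / 2 - 1 / 4.
have d0 : 0 < d.+1%:R :> R by rewrite ltr0n.
have e0 : 0 < e.+1%:R :> R by rewrite ltr0n.
pose q : R := (ln e.+1%:R - ln d.+1%:R) / 4; pose p : R := - 2^-1.
have p0 : p != 0 by rewrite oppr_eq0 invr_eq0.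
have E u : 0 < u -> T (expR (p * ln u + q)) = expR (- (x / 2) * (u + u^-1)).
  move=> u0; rewrite /T /gauss_pair /gaussq -!expRM_natl -expRD; congr expR.
  rewrite -expRN !exprMn.
  have -> : expR (p * ln u + q) ^+ 2 = u^-1 * expR (2 * q).
    rewrite -expRM_natl mulrDr expRD; congr (_ * _).
    by rewrite mulrA /p mulrN mulfV// mulN1r expRN lnK.
  have -> : expR (- (p * ln u + q)) ^+ 2 = u * expR (- (2 * q)).
    rewrite -expRM_natl mulrN mulrDr opprD expRD; congr (_ * _).
    by rewrite mulrA /p mulrN mulfV// mulN1r opprK lnK.
  have h1 : d.+1%:R * expR (2 * q) = Num.sqrt (d.+1 * e.+1)%:R.
    rewrite -{1}(lnK d0) -expRD natrM sqrtr_expR ?mulr_gt0// lnM//; congr expR.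
    by rewrite /q; move: (ln d.+1%:R) (ln e.+1%:R) => u1 u2; field.
  have h2 : e.+1%:R * expR (- (2 * q)) = Num.sqrt (d.+1 * e.+1)%:R.
    rewrite -{1}(lnK e0) -expRD natrM sqrtr_expR ?mulr_gt0// lnM//; congr expR.
    by rewrite /q; move: (ln d.+1%:R) (ln e.+1%:R) => u1 u2; field.
  rewrite [LHS](_ : _ = - (pi * y ^+ 2 * (u^-1 * (d.+1%:R * expR (2 * q)) +
     u * (e.+1%:R * expR (- (2 * q)))))); last by ring.
  rewrite h1 h2 /x; move: (Num.sqrt _) (pi : R) (u^-1) => a b v.
  by field.
have sE : - nu / p%:C = s - 1 / 2.
  by rewrite /nu /p raddfN /= realcV rmorph_nat invrN invrK; field.
have [|_] := @mellin_pow_sub R T p q (- nu) p0 rT.1.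
  by rewrite sE; exact: rapid_mellin_integrable.
rewrite sE (eq_mellin _ E) => mE.
rewrite /bessel_K -/(mellin_integrand (fun u => expR (- (x / 2) * (u + u^-1))) (- nu)).
rewrite [cintegral0y _]mE.
have -> : `|p|^-1 = 2 by rewrite normrN ger0_norm ?invrK.
set M := mellin T _; set X := cexp _.
have -> : 2^-1 * (2%:C * X * M) = X * M by rewrite rmorph_nat; field.
(* What remains is that the powers of [d] and [d e] in front cancel the factor [X] created by the
   substitution. *)
rewrite mulrA -[LHS]mul1r; congr (_ * _); rewrite /X /cpow -!cexpD -[LHS]cexp0; congr cexp.
have -> : q / p = (ln d.+1%:R - ln e.+1%:R) * 2^-1.
  by rewrite /q /p; move: (ln d.+1%:R) (ln e.+1%:R) => u v; field.
rewrite natrM lnM// realcM realcV !rmorph_nat [(_ - _)%:C]raddfB [(_ + _)%:C]raddfD /= /nu.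
by move: (ln d.+1%:R)%:C (ln e.+1%:R)%:C => u v; field.
Qed.

End BesselTerm.

(** * Convergence of the Bessel series *)

Section FourierSeries.
Context {R : realType}.
Import Normc.
Local Notation pos := (`]0, +oo[%classic : set R).
Local Notation A := (@sqrt_theta1 R).
Local Notation c := (@c_half R).
Implicit Types (z s w : R[i]) (t y : R).
Hint Resolve mpos mposL : core.

Lemma mellin_sum (I : Type) (r : seq I) (P : pred I) (F : I -> R -> R) s :
  (forall i, P i -> mellin_integrable (F i) s) ->
  mellin_integrable (fun t => \sum_(i <- r | P i) F i t) s /\
  mellin (fun t => \sum_(i <- r | P i) F i t) s = \sum_(i <- r | P i) mellin (F i) s.
Proof.
move=> iF; elim: r => [|i r [IHi IHe]].
  have z0 : cintegrable0y (fun=> 0 : R[i]).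
    by split; apply: eq_integrable (integrable0 _ _) => //.
  have E t : mellin_integrand (fun t => \sum_(i <- [::] | P i) F i t) s t = 0.
    by rewrite /mellin_integrand big_nil !mul0r.
  split; first by apply: eq_cintegrable z0 => t _; rewrite E.
  rewrite big_nil; transitivity (cintegral0y (fun t : R => 0 * (0 : R[i]))).
    by apply: eq_cintegral => t _; rewrite E mul0r.
  by rewrite cintegralZ// mul0r.
have [Pi|Pi] := boolP (P i); last first.
  have E t : 0 < t -> \sum_(i <- r | P i) F i t = \sum_(i <- i :: r | P i) F i t.
    by move=> _; rewrite big_cons (negbTE Pi).
  split; first exact: eq_mellin_integrable E IHi.
  by rewrite -(eq_mellin s E) IHe big_cons (negbTE Pi).
have E t : 0 < t -> F i t + \sum_(i <- r | P i) F i t = \sum_(i <- i :: r | P i) F i t.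
  by move=> _; rewrite big_cons Pi.
split; first exact: eq_mellin_integrable E (mellin_integrableD (iF i Pi) IHi).
by rewrite -(eq_mellin s E) mellinD//; [rewrite big_cons Pi IHe|exact: iF].
Qed.

Definition gauss_partial_sum y N t : R :=
  \sum_(i < N) \sum_(j < N | (i.+1 * j.+1 <= N)%N)
    c i.+1 * c j.+1 * gauss_pair y i.+1 j.+1 t.

Lemma fourier_partial_sum_mellin y s N : 0 < y ->
  fourier_partial_sum y s N = mellin (gauss_partial_sum y N) (s - 1 / 2).
Proof.
move=> y0; set s' := s - 1 / 2.
have ip (i j : nat) : mellin_integrable (gauss_pair y i.+1 j.+1) s'.
  by apply: rapid_mellin_integrable; exact: rapid_gauss_pair.
have [_ ->] := @mellin_sum _ (index_enum 'I_N) xpredT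
   (fun (i : 'I_N) t => \sum_(j < N | (i.+1 * j.+1 <= N)%N)
    c i.+1 * c j.+1 * gauss_pair y i.+1 j.+1 t) s'
   (fun i _ => (mellin_sum _ (fun (j : 'I_N) _ =>
      mellin_integrableZ (c i.+1 * c j.+1) (ip i j))).1).
transitivity (\sum_(i < N) \sum_(j < N | (i.+1 * j.+1 <= N)%N)
    ((c i.+1 * c j.+1)%:C * mellin (gauss_pair y i.+1 j.+1) s')); last first.
  apply: eq_bigr => i _; symmetry.
  have [_ ->] := @mellin_sum _ (index_enum 'I_N) (fun j : 'I_N => i.+1 * j.+1 <= N)%N
     (fun (j : 'I_N) t => c i.+1 * c j.+1 * gauss_pair y i.+1 j.+1 t) s'
     (fun j _ => mellin_integrableZ (c i.+1 * c j.+1) (ip i j)).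
  by apply: eq_bigr => j _; rewrite mellinZ.
rewrite -(sum_divisors_region N (fun d e => (c d * c e)%:C * mellin (gauss_pair y d e) s')).
rewrite /fourier_partial_sum; apply: eq_big_nat => n /andP[n0 _].
rewrite /fourier_term mulr_sumr mulr_suml; apply: eq_big_seq => d.
rewrite -dvdn_divisors// => dn.
have d0 := dvdn_gt0 n0 dn; have e0 : (0 < n %/ d)%N by rewrite divn_gt0// dvdn_leq.
rewrite mellin_gauss_pair// [(d * _)%N]mulnC divnK//; ring.
Qed.

Definition theta_pair y t : R := A (y * t) * A (y * t^-1).

Lemma measurable_theta_pair y : 0 < y -> measurable_fun pos (theta_pair y).
Proof.
move=> y0; apply: measurable_funM.
  apply: (measurable_comp mpos _ (@measurable_sqrt_theta1 R) (measurable_mul_pos y)).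
  by move=> _ [t /posP t0 <-]; apply/posP; exact: mulr_gt0.
apply: (measurable_comp mpos _ (@measurable_sqrt_theta1 R) (measurable_mulV_pos y)).
by move=> _ [t /posP t0 <-]; apply/posP; rewrite mulr_gt0// invr_gt0.
Qed.

Lemma rapid_theta_pair y : 0 < y -> rapid (theta_pair y).
Proof.
move=> y0; split; first exact: measurable_theta_pair.
move=> a; have [C HC] := majorant_prod a y0.
exists C => t t0; apply: le_trans (HC t t0); rewrite ler_wpM2r ?expR_ge0//.
have u0 : 0 < y * t by exact: mulr_gt0.
have v0 : 0 < y * t^-1 by rewrite mulr_gt0// invr_gt0.
rewrite ger0_norm ?mulr_ge0 ?sqrt_theta1_ge0//.
by apply: ler_pM; rewrite ?sqrt_theta1_ge0 ?sqrt_theta1_le.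
Qed.

Lemma gauss_partial_sum_le y N t : 0 < y -> 0 < t ->
  `|gauss_partial_sum y N t| <= majorant (y * t) * majorant (y * t^-1).
Proof.
move=> y0 t0; have u0 : 0 < y * t by exact: mulr_gt0.
have v0 : 0 < y * t^-1 by rewrite mulr_gt0// invr_gt0.
apply: (@le_trans _ _ ((\sum_(i < N) `|c i.+1 * gaussq (y * t) ^+ i.+1|) *
   (\sum_(j < N) `|c j.+1 * gaussq (y * t^-1) ^+ j.+1|))); last first.
  by apply: ler_pM; rewrite ?sumr_ge0 ?sum_norm_le_majorant.
rewrite mulr_suml; apply: le_trans (ler_norm_sum _ _ _) _; apply: ler_sum => i _.
rewrite mulr_sumr; apply: le_trans (ler_norm_sum _ _ _) _.
rewrite [leRHS](bigID (fun j : 'I_N => i.+1 * j.+1 <= N)%N) /= -[leLHS]addr0.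
apply: lerD; last by rewrite sumr_ge0// => j _; rewrite mulr_ge0.
by apply: ler_sum => j _; rewrite -normrM /gauss_pair mulrACA.
Qed.

Lemma gauss_partial_sum_cvg y t : 0 < y -> 0 < t ->
  gauss_partial_sum y ^~ t @ \oo --> theta_pair y t.
Proof.
move=> y0 t0; have u0 : 0 < y * t by exact: mulr_gt0.
have v0 : 0 < y * t^-1 by rewrite mulr_gt0// invr_gt0.
(* The inscribed square has side [log_4 N]: then [i+1] and [j+1] are at most [2^(log_4 N)], and
   their product is at most [N]. Any side tending to infinity would serve. *)
have Pk N i j : (i < trunc_log 4 N)%N -> (j < trunc_log 4 N)%N -> (i.+1 * j.+1 <= N)%N.
  move=> ik jk; have N0 : (0 < N)%N by case: N ik jk.
  apply: leq_trans (trunc_logP (isT : 1 < 4)%N N0).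
  have k2 : (trunc_log 4 N < 2 ^ trunc_log 4 N)%N by exact: ltn_expl.
  have -> : (4 ^ trunc_log 4 N = 2 ^ trunc_log 4 N * 2 ^ trunc_log 4 N)%N by rewrite -expnMn.
  by apply: leq_mul; apply: leq_trans (ltnW k2).
have kN N : (trunc_log 4 N <= N)%N.
  case: N => // N; apply: leq_trans (trunc_logP (isT : 1 < 4)%N (ltn0Sn N)).
  exact/ltnW/ltn_expl.
have ky : (fun N => trunc_log 4 N) @ \oo --> \oo.
  apply/cvgnyPge => M; near=> N; apply: trunc_log_max => //.
  by near: N; exact: nbhs_infty_ge.
have := sum_region_cvg Pk kN ky (sqrt_theta1_summable u0) (sqrt_theta1_summable v0)
  (sqrt_theta1_series u0) (sqrt_theta1_series v0).
apply: cvg_trans; apply: near_eq_cvg; apply: nearW => N; rewrite /gauss_partial_sum.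
by apply: eq_bigr => i _; apply: eq_bigr => j _; rewrite /gauss_pair mulrACA.
Unshelve. all: by end_near. Qed.

Lemma fourier_cvg y s : 0 < y ->
  fourier_partial_sum y s @ \oo --> (mellin (theta_pair y) (s - 1 / 2) : R[i]^o).
Proof.
move=> y0; have -> : fourier_partial_sum y s =
    (fun N => mellin (gauss_partial_sum y N) (s - 1 / 2)).
  by apply/funext => N; exact: fourier_partial_sum_mellin.
apply: mellin_cvg.
- move=> N; apply: measurable_sum => i.
  rewrite (_ : (fun t => _) = (fun t => \sum_(j < N) if (i.+1 * j.+1 <= N)%N
    then c i.+1 * c j.+1 * gauss_pair y i.+1 j.+1 t else 0)); last first.
    by apply/funext => t; rewrite big_mkcond.
  apply: measurable_sum => j; case: (i.+1 * j.+1 <= N)%N; last exact: measurable_cst.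
  by apply: measurable_funM => //; exact: measurable_gauss_pair.
- exact: measurable_theta_pair.
- by move=> t t0; exact: gauss_partial_sum_cvg.
move=> a; have [C HC] := majorant_prod a y0.
exists C => N t t0; apply: le_trans (HC t t0).
by apply: ler_wpM2r; [exact: expR_ge0|exact: gauss_partial_sum_le].
Qed.

End FourierSeries.

(** * Holomorphy and poles *)

Section Continuation.
Context {R : realType}.
Import Normc.
Implicit Types (f u v : R[i] -> R[i]) (z s w a b : R[i]) (t y : R).

Lemma holomorphic_at_but2 f a b z : (forall w, w != a -> w != b -> cdiff f w) ->
  z != a -> z != b -> holomorphic_at f z.
Proof.
move=> df za zb; have na := near_neq za; have nb := near_neq zb.
by near=> w; apply: df; near: w.
Unshelve. all: by end_near. Qed.

Lemma holomorphic_at_entire f z : (forall w, cdiff f w) -> holomorphic_at f z.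
Proof. exact: (@nearW _ (nbhs (z : R[i]^o)) _ (nbhs_filter _)). Qed.

Lemma simple_pole f u v z : holomorphic_at u z -> holomorphic_at v z -> v z != 0 ->
  (forall w, f w = u w + v w / (w - z)) -> pole_at f z.
Proof.
pose l w := w + - z.
have D w : cdiff u w -> cdiff v w -> cdiff (fun w => u w * l w + v w) w.
  move=> du dv; have dl : cdiff l w := cdiffD (@cdiff_id _ w) (@cdiff_cst _ (- z) w).
  exact: (cdiffD (cdiffM du dl) dv).
move=> hu hv vz fE; exists 1%N, (fun w => u w * l w + v w); split.
- by [].
- by apply: filterS2 hu hv => w; exact: D.
- by rewrite /l subrr mulr0 add0r.
apply: (@nearW _ (nbhs (z : R[i]^o)) _ (nbhs_filter _)) => w wz.
by rewrite fE expr1 mulrDl mulfK// subr_eq0.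
Qed.

(** The inverse of 0 is 0 here, so the function has a value at [a]. Were it differentiable there,
    its product with [w - a] would be continuous, yet that product is 0 at [a] and 1 elsewhere. *)
Lemma not_cdiff_inv a : ~ cdiff (fun w => (w - a)^-1) a.
Proof.
move=> d.
have := cdiffM d (cdiffD (@cdiff_id _ a) (@cdiff_cst _ (- a) a)).
move=> /(@derivable1_diffP _ R[i]^o)/differentiable_continuous /=.
move=> /cvgrPdist_lt /(_ 1 ltr01) [e /= e0 H].
have e2 : 0 < e / 2 by rewrite divr_gt0.
have en : e / 2 != 0 by rewrite gt_eqF.
have := H (a + e / 2); rewrite /ball_ /= opprD addNKr normrN gtr0_norm//.
rewrite gtr_pMr// invf_lt1// ltr1n => /(_ isT).
by rewrite subrr invr0 mul0r sub0r [a + _]addrC addrK mulVf// normrN1 ltxx.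
Qed.

Lemma cdiff_sum_Z z : cdiff (@Z_entire R) z.
Proof.
have d := @cdiff_mellin R _ ^~ (@rapid_theta_tail R).
apply: (eq_cdiff (f := fun s => mellin (@theta_tail R) s
   + mellin (@theta_tail R) (-1 * s + 1 / 2))).
  by move=> w; rewrite /Z_entire mulN1r addrC [1 / 2 - w]addrC addrC.
by apply: cdiffD; [exact: d|apply: cdiff_affine; exact: d].
Qed.

Lemma cdiff_inv_sub a z : z != a -> cdiff (fun w => (w - a)^-1) z.
Proof.
move=> za; apply: (@cdiffV _ (fun w => w - a)); first by rewrite subr_eq0.
exact: (cdiffD (@cdiff_id _ z) (@cdiff_cst _ (- a) z)).
Qed.

End Continuation.

(** * The continued functions Z and E *)

Section EHalf.
Context {R : realType}.
Import Normc.
Implicit Types (f u v : R[i] -> R[i]) (z s w a b : R[i]) (t y : R).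
Hint Resolve mpos mposL : core.

Lemma cdiff_Z_half z : z != 1 / 2 -> z != 0 -> cdiff (@Z_half R) z.
Proof.
move=> z12 z0.
apply: (eq_cdiff (f := fun w => @Z_entire R w + ((w - 1 / 2)^-1 + (-1) * (w - 0)^-1))).
  by move=> w; rewrite mulN1r subr0.
apply: cdiffD; first exact: cdiff_sum_Z.
apply: cdiffD; first exact: cdiff_inv_sub.
by apply: cdiffM; [exact: cdiff_cst|exact: cdiff_inv_sub].
Qed.

(** Turns holomorphy of [Z] at [s] into [s != 1/2]. Subtracting the other, differentiable, terms of
    [Z_half] would make [1/(w - 1/2)] differentiable at [1/2]. *)
Lemma not_holomorphic_Z_half : ~ holomorphic_at (@Z_half R) (1 / 2).
Proof.
move=> /nbhs_singleton d'; have d : cdiff (@Z_half R) (1 / 2) := d'.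
apply: (@not_cdiff_inv R (1 / 2)).
have n0 : (1 / 2 : R[i]) != 0 by rewrite mulf_neq0// invr_eq0 pnatr_eq0.
apply: (eq_cdiff (f := fun w => @Z_half R w + ((-1) * @Z_entire R w + (w - 0)^-1))).
  by move=> w; rewrite /Z_half subr0 mulN1r; ring.
apply: cdiffD; first exact: d.
apply: cdiffD; last exact: cdiff_inv_sub.
by apply: cdiffM; [exact: cdiff_cst|exact: cdiff_sum_Z].
Qed.

Lemma meromorphic_Z_half : meromorphic (@Z_half R).
Proof.
move=> z; have n0 : (1 / 2 : R[i]) != 0 by rewrite mulf_neq0// invr_eq0 pnatr_eq0.
have [->|z0] := eqVneq z 0.
  right; apply: (@simple_pole _ _ (fun w => @Z_entire R w + (w - 1 / 2)^-1) (fun=> -1)).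
  - apply: (@holomorphic_at_but2 _ _ (1 / 2) (1 / 2)); rewrite 1?eq_sym// => w w1 _.
    by apply: cdiffD; [exact: cdiff_sum_Z|exact: cdiff_inv_sub].
  - by apply: holomorphic_at_entire => w; exact: cdiff_cst.
  - by rewrite oppr_eq0 oner_eq0.
  - by move=> w; rewrite /Z_half subr0 mulN1r addrA.
have [->|z12] := eqVneq z (1 / 2).
  right; apply: (@simple_pole _ _ (fun w => @Z_entire R w + (-1) * (w - 0)^-1) (fun=> 1)).
  - apply: (@holomorphic_at_but2 _ _ 0 0) => // w w0 _.
    apply: cdiffD; first exact: cdiff_sum_Z.
    by apply: cdiffM; [exact: cdiff_cst|exact: cdiff_inv_sub].
  - by apply: holomorphic_at_entire => w; exact: cdiff_cst.
  - exact: oner_neq0.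
  - by move=> w; rewrite /Z_half subr0 mulN1r mul1r; ring.
by left; apply: (@holomorphic_at_but2 _ _ (1 / 2) 0) => // w; exact: cdiff_Z_half.
Qed.

(* The poles of [Z s] and [Z (1 - s)] at [1/2] cancel in the sum: with
   [w = s - 1/2] they leave [sqrt y * (y^w - y^-w) / w], and this quotient is the
   Mellin transform of the indicator of [[1/y, y]]. *)
Definition sinh_quot y w : R[i] :=
  if 1 <= y then mellin \1_`[y^-1, y] w else - mellin \1_`[y, y^-1] w.

Lemma sinh_quotE y w : 0 < y -> w != 0 ->
  sinh_quot y w = (cpow y w - cpow y (- w)) / w.
Proof.
move=> y0 w0; have yi0 : 0 < y^-1 by rewrite invr_gt0.
rewrite /sinh_quot; case: (leP 1 y) => y1.
  rewrite mellin_segment// ?cpow_inv//.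
  by apply: (le_trans _ y1); rewrite invf_le1.
have yy : y <= y^-1 by apply: le_trans (ltW y1) _; rewrite invf_ge1// ltW.
by rewrite mellin_segment// cpow_inv// -mulNr opprB.
Qed.

Lemma cdiff_sinh_quot y z : 0 < y -> cdiff (sinh_quot y) z.
Proof.
move=> y0; have yi0 : 0 < y^-1 by rewrite invr_gt0.
rewrite /sinh_quot; case: (leP 1 y) => y1.
  by apply: cdiff_mellin; exact: rapid_segment.
apply: (eq_cdiff (f := fun w => (-1) * mellin \1_`[y, y^-1] w)).
  by move=> w; rewrite mulN1r.
by apply: cdiffM; [exact: cdiff_cst|apply: cdiff_mellin; exact: rapid_segment].
Qed.

Definition E_entire y s : R[i] :=
  (Z_entire s * cpow y s + Z_entire (1 - s) * cpow y (1 - s)) +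
  (Num.sqrt y)%:C * (sinh_quot y (s - 1 / 2) + mellin (theta_pair y) (s - 1 / 2)).

Definition E_half y s : R[i] :=
  E_entire y s - cpow y s / s - cpow y (1 - s) / (1 - s).

Lemma cdiff_E_entire y z : 0 < y -> cdiff (E_entire y) z.
Proof.
move=> y0; have dp := @cdiff_cpow R y.
have dZ := @cdiff_sum_Z R.
have dM w := @cdiff_mellin R _ w (rapid_theta_pair y0).
have dS w := @cdiff_sinh_quot y w y0.
pose P w := mellin (theta_pair y) w.
apply: (eq_cdiff (f := fun w =>
  (Z_entire w * cpow y w + Z_entire (-1 * w + 1) * cpow y (-1 * w + 1)) +
  (Num.sqrt y)%:C * (sinh_quot y (1 * w + - (1 / 2)) + P (1 * w + - (1 / 2))))).
  by move=> w; rewrite mulN1r mul1r [- w + 1]addrC.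
exact: (cdiffD (cdiffD (cdiffM (dZ z) (dp z))
    (cdiffM (cdiff_affine (dZ _)) (cdiff_affine (dp _))))
  (cdiffM (@cdiff_cst _ (Num.sqrt y)%:C z)
    (cdiffD (cdiff_affine (dS _)) (cdiff_affine (dM _))))).
Qed.

Lemma sqrtr_cpow y : 0 < y -> (Num.sqrt y)%:C = cpow y (1 / 2).
Proof. by move=> y0; rewrite sqrtr_expR// -cpow_real realcV rmorph_nat div1r. Qed.

(** At [s = 0] and [s = 1] both sides contain the same inverse, whatever its value; only the
    quotient by [s - 1/2] needs a nonzero denominator. *)
Lemma E_halfE y s : 0 < y -> s != 1 / 2 ->
  E_half y s = Z_half s * cpow y s + Z_half (1 - s) * cpow y (1 - s) +
    (Num.sqrt y)%:C * mellin (theta_pair y) (s - 1 / 2).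
Proof.
move=> y0 s12; have w0 : s - 1 / 2 != 0 by rewrite subr_eq0.
rewrite /E_half /E_entire sinh_quotE// /Z_half.
have -> : 1 - s - 1 / 2 = - (s - 1 / 2) by field.
rewrite invrN; set M := mellin _ _.
have e1 : (Num.sqrt y)%:C * cpow y (s - 1 / 2) = cpow y s.
  by rewrite sqrtr_cpow// -cpowD addrC subrK.
have e2 : (Num.sqrt y)%:C * cpow y (- (s - 1 / 2)) = cpow y (1 - s).
  by rewrite sqrtr_cpow// -cpowD; congr cpow; field.
rewrite -e1 -e2; move: (cpow y _) (cpow y _) (Num.sqrt y)%:C => p q r.
move: (Z_entire _) (Z_entire _) (s^-1) ((1 - s)^-1) (_^-1) => Z1 Z2 S1 S2 S3.
by ring.
Qed.

Lemma meromorphic_E_half y : 0 < y -> meromorphic (E_half y).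
Proof.
move=> y0 z.
have dE w : cdiff (E_entire y) w by exact: cdiff_E_entire.
have dp := @cdiff_cpow R y.
have d1 w : cdiff (fun w => cpow y (1 - w)) w.
  apply: (eq_cdiff (f := fun w => cpow y (-1 * w + 1))).
    by move=> x; rewrite mulN1r addrC.
  exact: (cdiff_affine (dp _)).
have dm1 w : w != 1 -> cdiff (fun w => cpow y (1 - w) / (w - 1)) w.
  by move=> w1; exact: (cdiffM (d1 w) (cdiff_inv_sub w1)).
have dm0 w : w != 0 -> cdiff (fun w => (-1) * cpow y w / (w - 0)) w.
  by move=> w0; exact: (cdiffM (cdiffM (@cdiff_cst _ (-1) w) (dp w)) (cdiff_inv_sub w0)).
have EE w : E_half y w = E_entire y w + (-1) * cpow y w / (w - 0) + cpow y (1 - w) / (w - 1).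
  have e : (1 - w)^-1 = - (w - 1)^-1 by rewrite -invrN opprB.
  by rewrite /E_half e mulrN opprK subr0 mulN1r mulNr.
have [->|z0] := eqVneq z 0.
  right; apply: (@simple_pole _ _ (fun w => E_entire y w + cpow y (1 - w) / (w - 1))
    (fun w => (-1) * cpow y w)).
  - apply: (@holomorphic_at_but2 _ _ 1 1); rewrite 1?eq_sym ?oner_eq0// => w w1 _.
    exact: (cdiffD (dE w) (dm1 w w1)).
  - apply: (@holomorphic_at_but2 _ _ 1 1); rewrite 1?eq_sym ?oner_eq0// => w w1 _.
    exact: (cdiffM (@cdiff_cst _ (-1) w) (dp w)).
  - by rewrite cpow0 mulr1 oppr_eq0 oner_eq0.
  - by move=> w; rewrite EE addrAC.
have [->|z1] := eqVneq z 1.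
  right; apply: (@simple_pole _ _ (fun w => E_entire y w + (-1) * cpow y w / (w - 0))
    (fun w => cpow y (1 - w))).
  - apply: (@holomorphic_at_but2 _ _ 0 0); rewrite ?oner_eq0// => w w1 _.
    exact: (cdiffD (dE w) (dm0 w w1)).
  - exact: holomorphic_at_entire.
  - by rewrite subrr cpow0 oner_eq0.
  - by move=> w; rewrite EE.
left; apply: (@holomorphic_at_but2 _ _ 0 1) => // w w0 w1.
apply: (eq_cdiff (f := fun w => E_entire y w + (-1) * cpow y w / (w - 0) +
  cpow y (1 - w) / (w - 1))); first by move=> x; rewrite EE.
exact: (cdiffD (cdiffD (dE w) (dm0 w w0)) (dm1 w w1)).
Qed.

End EHalf.

(** * The kernel of E and its Mellin transform *)

Section Kernel.
Context {R : realType}.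
Local Notation A := (@sqrt_theta1 R).
Implicit Types (s : R[i]) (t y : R).

(** The product minus 1 equals [A(t/y) + (A(t/y) + 1) A(yt)], and inversion is applied to the
    bracket alone. *)
Lemma E_half_kernelE y t : 0 < y -> 0 < t ->
  E_half_kernel y t = A (y^-1 * t) +
    (Num.sqrt y * (expR (- 2^-1 * ln t) * A (y * t)) +
     Num.sqrt y * (expR (- 2^-1 * ln t) * theta_pair y t)).
Proof.
move=> y0 t0; have ti0 : 0 < t^-1 by rewrite invr_gt0.
have u0 : 0 < y * t^-1 by exact: mulr_gt0.
rewrite /E_half_kernel -exprVn -!exprMn sqrtrM; last first.
  by apply: le_trans ler01 _; apply: theta_ge1; rewrite exprn_gt0// mulr_gt0.
have E : Num.sqrt (theta ((y^-1 * t) ^+ 2)) = Num.sqrt (y * t^-1) * (A (y * t^-1) + 1).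
  by rewrite /A subrK -sqrt_theta_inversion// invfM invrK.
rewrite /theta_pair {1}/A E sqrtrM ?(ltW y0)// [Num.sqrt t^-1]sqrtr_expR// lnV//.
rewrite mulrN -mulNr /A; ring.
Qed.

Lemma mellin_E_half_kernel y s : 0 < y -> 1 < complex.Re s ->
  mellin_integrable (E_half_kernel y) s /\ E_half_integral y s = E_half y s.
Proof.
move=> y0 s1; have yi0 : 0 < y^-1 by rewrite invr_gt0.
have h12 : 1 / 2 < complex.Re s by lra.
pose s' := s + (- 2^-1)%:C.
have half : 1 / 2 = (2^-1)%:C :> R[i] by rewrite div1r realcV rmorph_nat.
have s'E : s' = s - 1 / 2 by rewrite half /s' raddfN.
(* The second term is a transform at [s - 1/2], which must still lie right of [1/2]; hence the half
   plane [Re s > 1]. *)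
have s'12 : 1 / 2 < complex.Re s' by rewrite ReD_real; lra.
have mA := @measurable_sqrt_theta1 R.
have [iA eA] := mellin_sqrt_theta1 h12.
have [iA' eA'] := mellin_sqrt_theta1 s'12.
have [i1 e1] := mellin_dilate yi0 mA iA.
have [i2 e2] := mellin_dilate y0 mA iA'.
have i3 := rapid_mellin_integrable s' (rapid_theta_pair y0).
have J2 := mellin_integrable_shift i2.
have J3 := mellin_integrable_shift i3.
have I2 := mellin_integrableZ (Num.sqrt y) J2.
have I3 := mellin_integrableZ (Num.sqrt y) J3.
have I23 := mellin_integrableD I2 I3.
have E t : 0 < t -> A (y^-1 * t) +
    (Num.sqrt y * (expR (- 2^-1 * ln t) * A (y * t)) +
     Num.sqrt y * (expR (- 2^-1 * ln t) * theta_pair y t)) = E_half_kernel y t.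
  by move=> t0; rewrite E_half_kernelE.
split; first exact: eq_mellin_integrable E (mellin_integrableD i1 I23).
rewrite /E_half_integral -(eq_mellin s E) (mellinD i1 I23) (mellinD I2 I3).
rewrite (mellinZ _ J2) (mellinZ _ J3) !mellin_shift -/s' e1 e2 eA eA'.
have s12 : s != 1 / 2.
  by apply: contraTneq s1 => ->; rewrite half /= -leNgt; lra.
rewrite E_halfE// -s'E addrA; congr (_ + _ + _).
  by rewrite cpow_inv// opprK mulrC.
have -> : Z_half s' = Z_half (1 - s).
  by rewrite -(Z_half_reflect (1 - s)) s'E; congr Z_half; field.
rewrite mulrA mulrC sqrtr_cpow// -cpowD; congr (_ * cpow _ _).
by rewrite s'E; field.
Qed.

End Kernel.

Theorem theorem4 (R : realType) :
  exists2 Z : R[i] -> R[i],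
    meromorphic_continuation (1 / 2) Z_half_integral Z
  & forall y : R, 0 < y ->
    (forall s : R[i], 1 < complex.Re s ->
       mellin_integrable (E_half_kernel y) s)
    /\
    exists2 E : R[i] -> R[i],
      meromorphic_continuation 1 (E_half_integral y) E
    & forall s : R[i],
      cvgn (fourier_partial_sum y s)
      /\
      (holomorphic_at E s -> holomorphic_at Z s -> holomorphic_at Z (1 - s) ->
       E s = Z s * cpow y s + Z (1 - s) * cpow y (1 - s)
             + (Num.sqrt y)%:C * limn (fourier_partial_sum y s)).
Proof.
exists (@Z_half R).
  split; first exact: meromorphic_Z_half.
  by move=> s s12; have [_ <-] := mellin_sqrt_theta1 s12.
move=> y y0; split; first by move=> s s1; have [] := mellin_E_half_kernel y0 s1.
exists (E_half y).
  split; first exact: meromorphic_E_half.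
  by move=> s s1; have [_ ->] := mellin_E_half_kernel y0 s1.
move=> s; have F := @fourier_cvg _ y s y0; split; first exact: cvgP F.
move=> _ hZ _; rewrite (cvg_lim (@norm_hausdorff _ _) F); apply: E_halfE => //.
(* At [s = 1/2] both [Z] terms have poles, although [E] is regular there; holomorphy of [Z] at [s]
   excludes this point. *)
by apply/eqP => s12; apply: (@not_holomorphic_Z_half R); rewrite -s12.
Qed.
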